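(* Let $\Lambda$ be a semigroup as in the context and suppose that the affine toric variety $Z^\Lambda$ is normal. For $\theta\le\sigma$ let $M_\theta:=M/(\theta^\perp\cap M)$, let $\sigma_\theta^\vee$ be the image of the cone $\sigma^\vee$ in $(M_\theta)_{\mathbb{R}}$, and let $\Lambda(\theta)$ be the semigroup $\Lambda(\theta):=(\sigma_\theta^\vee\cap M_\theta)\times\mathbb{Z}_{\ge0}^{\mathrm{codim}\,\theta}$. Then $$P_{\mathrm{geom}}^{Z^\Lambda}(T)=\sum_{\theta\le\sigma}(\mathbf{L}-1)^{\mathrm{codim}\,\theta}\,P_{\mathrm{geom}}^{(Z^{\Lambda(\theta)},0)}(T).$$
   Context: $M$ is a lattice of rank $d$, $N$ its dual lattice. $\Lambda\subset M$ is a finitely generated sub-semigroup (containing $0$) which generates $M$ as a group and such that $\sigma^\vee:=\mathbb{R}_{\ge0}\Lambda\subset M_{\mathbb{R}}$ is a strictly convex cone of dimension $d$; $\sigma\subset N_{\mathbb{R}}$ is the dual cone. $Z^\Lambda:=\mathrm{Spec}\,\mathbb{C}[\Lambda]$; it is normal iff $\Lambda=\sigma^\vee\cap M$. $\theta\le\sigma$ means $\theta$ is a face of $\sigma$, $\theta^\perp\subset M_{\mathbb{R}}$ is its orthogonal, and $\mathrm{codim}\,\theta=d-\dim\theta$. The origin $0$ of an affine toric variety $Z^\Lambda$ is the point defined by the maximal ideal $(X^\lambda)_{0\ne\lambda\in\Lambda}$. For a variety $S$ and a closed subvariety $Z\subset S$, $H(S)$ is the arc space of $S$, $H(S)_Z$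 the set of arcs with origin in $Z$, and $j_m$ the truncation map to the $m$-jet space. In $K_0(\mathrm{Var}_{\mathbb{C}})[[T]]$, where $K_0(\mathrm{Var}_{\mathbb{C}})$ is the Grothendieck ring of complex varieties and $\mathbf{L}=[\mathbb{A}^1_{\mathbb{C}}]$, $$P_{\mathrm{geom}}^{S}(T):=\sum_{m\ge0}[j_m(H(S))]T^m,\qquad P_{\mathrm{geom}}^{(S,Z)}(T):=\sum_{m\ge0}[j_m(H(S)_Z)]T^m$$ (the images $j_m(H(S))$, $j_m(H(S)_Z)$ are constructible). *)

(* Defs.v *)
From HB Require Import structures.
From mathcomp Require Import all_boot all_order all_algebra.
From mathcomp Require Import generic_quotient finmap.
From mathcomp Require Import boolp classical_sets functions fsbigop reals.
From mathcomp Require Import complex monalg.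

Set Implicit Arguments.
Unset Strict Implicit.
Unset Printing Implicit Defensive.

Import Order.TTheory GRing.Theory Num.Theory.

Local Open Scope classical_set_scope.
Local Open Scope ring_scope.
Local Open Scope quotient_scope.

Record series (R : Type) := Series { coefs : nat -> R }.

Add Printing Constructor series.

HB.instance Definition _ (R : Type) := [isNew for @coefs R].
HB.instance Definition _ (R : choiceType) := gen_eqMixin (series R).
HB.instance Definition _ (R : choiceType) := gen_choiceMixin (series R).

Lemma seriesP (R : Type) (x y : series R) :
  (forall n, coefs x n = coefs y n) -> x = y.
Proof. by case: x y => [x] [y] /= xy; congr Series; apply/funext. Qed.

Section SeriesRing.
Variable R : comPzRingType.
Implicit Types (x y z : series R) (a : R).

Definition series_zero : series R := Series (fun=> 0).
Definition series_opp x : series R := Series (fun n => - coefs x n).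
Definition series_add x y : series R := Series (fun n => coefs x n + coefs y n).
Definition series_one : series R := Series (fun n => (n == 0%N)%:R).
Definition series_mul x y : series R :=
  Series (fun n => \sum_(i < n.+1) coefs x i * coefs y (n - i)%N).
Definition series_scale a x : series R := Series (fun n => a * coefs x n).

Fact series_addA : associative series_add.
Proof. by move=> x y z; apply: seriesP => n /=; rewrite addrA. Qed.
Fact series_addC : commutative series_add.
Proof. by move=> x y; apply: seriesP => n /=; rewrite addrC. Qed.
Fact series_add0 : left_id series_zero series_add.
Proof. by move=> x; apply: seriesP => n /=; rewrite add0r. Qed.
Fact series_addN : left_inverse series_zero series_opp series_add.
Proof. by move=> x; apply: seriesP => n /=; rewrite addNr. Qed.

HB.instance Definition _ := GRing.isZmodule.Build (series R)
  series_addA series_addC series_add0 series_addN.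

Fact series_mulC : commutative series_mul.
Proof.
move=> x y; apply: seriesP => n /=.
rewrite (reindex_inj rev_ord_inj) /=; apply: eq_bigr => i _.
by rewrite subSS subKn 1?mulrC // -ltnS.
Qed.

Lemma coefs_mulr x y n :
  coefs (series_mul x y) n = \sum_(i < n.+1) coefs x (n - i)%N * coefs y i.
Proof. by rewrite series_mulC; apply: eq_bigr => i _; rewrite mulrC. Qed.

Fact series_mulA : associative series_mul.
Proof.
move=> x y z; apply: seriesP => i; rewrite [RHS]coefs_mulr.
pose c3 j k := coefs x j * (coefs y (i - j - k)%N * coefs z k).
transitivity (\sum_(j < i.+1) \sum_(k < i.+1 | (k <= i - j)%N) c3 j k).
  apply: eq_bigr => /= j _; rewrite [X in _ * X]coefs_mulr big_distrr /=.
  by rewrite (big_ord_narrow_leq (leq_subr j i)).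
rewrite (exchange_big_dep predT) //=; apply: eq_bigr => k _.
transitivity (\sum_(j < i.+1 | (j <= i - k)%N) c3 j k).
  apply: eq_bigl => j; rewrite -ltnS -(ltnS j) -!subSn ?leq_ord //.
  by rewrite -subn_gt0 -(subn_gt0 j) -!subnDA addnC.
rewrite (big_ord_narrow_leq (leq_subr k i)) /= big_distrl /=.
by apply: eq_bigr => j _; rewrite /c3 subnAC mulrA.
Qed.

Fact series_mul1 : left_id series_one series_mul.
Proof.
move=> x; apply: seriesP => n /=; rewrite big_ord_recl /= mul1r subn0.
by rewrite big1 ?addr0 // => i _; rewrite mul0r.
Qed.
Fact series_mulDl : left_distributive series_mul series_add.
Proof.
move=> x y z; apply: seriesP => n /=; rewrite -big_split /=.
by apply: eq_bigr => i _; rewrite mulrDl.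
Qed.

HB.instance Definition _ := GRing.Zmodule_isComPzRing.Build (series R)
  series_mulA series_mulC series_mul1 series_mulDl.

Fact series_scaleA a b x :
  series_scale a (series_scale b x) = series_scale (a * b) x.
Proof. by apply: seriesP => n /=; rewrite mulrA. Qed.
Fact series_scale1 : left_id 1 series_scale.
Proof. by move=> x; apply: seriesP => n /=; rewrite mul1r. Qed.
Fact series_scaleDr : right_distributive series_scale +%R.
Proof. by move=> a x y; apply: seriesP => n /=; rewrite mulrDr. Qed.
Fact series_scaleDl x : {morph series_scale^~ x : a b / a + b}.
Proof. by move=> a b; apply: seriesP => n /=; rewrite mulrDl. Qed.

HB.instance Definition _ := GRing.Zmodule_isLmodule.Build R (series R)
  series_scaleA series_scale1 series_scaleDr series_scaleDl.

Fact series_scaleAl a x y : a *: (x * y) = (a *: x) * y.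
Proof.
apply: seriesP => n /=; rewrite big_distrr /=.
by apply: eq_bigr => i _; rewrite mulrA.
Qed.

End SeriesRing.

Section SeriesAlgebra.
Variable R : comNzRingType.

Fact series_one_neq0 : 1 != 0 :> series R.
Proof.
by apply/eqP => /(congr1 (fun x => coefs x 0%N)) /eqP; rewrite oner_eq0.
Qed.

HB.instance Definition _ :=
  GRing.PzSemiRing_isNonZero.Build (series R) series_one_neq0.
HB.instance Definition _ := GRing.Lmodule_isLalgebra.Build R (series R)
  (@series_scaleAl R).
HB.instance Definition _ := GRing.Lalgebra_isComAlgebra.Build R (series R).

End SeriesAlgebra.

Section Varieties.
Variable k : closedFieldType.

(* Reduced schemes of finite type over the algebraically closed field [k] are
   identified with the spaces of their closed points, equipped with the
   Zariski topology and the sheaf of regular [k]-valued functions.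
   [sections U f] is only meaningful for open [U], and only depends on the
   restriction of [f] to [U]. *)
Record fspace := Space {
  points :> Type;
  opens : set (set points);
  sections : set points -> set (points -> k) }.

Implicit Types X Y P W : fspace.

Definition zclosed X (A : set X) := opens (~` A).

Definition locally_closed X (A : set X) :=
  exists U V, [/\ opens U, opens V & A = U `\` V].

Definition regular_map X Y (f : X -> Y) :=
  forall V : set Y, opens V ->
    opens (f @^-1` V) /\
    forall g, sections V g -> sections (f @^-1` V) (g \o f).

Definition isomorphic X Y := exists (f : X -> Y) (g : Y -> X),
  [/\ regular_map f, regular_map g, cancel f g & cancel g f].

Definition subspace X (A : set X) : fspace := @Space {x : X | A x}
  [set V | exists2 U, opens U & V = sval @^-1` U]
  (fun V f => forall x, V x -> exists U g,
     [/\ opens U, sections U g, U (sval x) &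
         forall y, V y -> U (sval y) -> f y = g (sval y)]).

(* [polyfun gen] is the [k]-algebra of functions on [T] generated by [gen]. *)
Inductive polyfun (T I : Type) (gen : I -> T -> k) : (T -> k) -> Prop :=
| PolyCst c : polyfun gen (fun=> c)
| PolyGen i : polyfun gen (gen i)
| PolyAdd p q : polyfun gen p -> polyfun gen q ->
    polyfun gen (fun x => p x + q x)
| PolyMul p q : polyfun gen p -> polyfun gen q ->
    polyfun gen (fun x => p x * q x).

(* The Zariski topology defined by the functions in [polyfun gen], with the
   functions that are locally quotients of such functions. *)
Definition zariski (T I : Type) (gen : I -> T -> k) : fspace := @Space T
  [set U | exists2 S : set (T -> k), S `<=` polyfun gen &
     U = [set x | exists2 p, S p & p x != 0]]
  (fun U f => forall x, U x -> exists p q,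
     [/\ polyfun gen p, polyfun gen q, q x != 0 &
         forall y, U y -> q y != 0 -> f y = p y / q y]).

Definition affine_space (n : nat) : fspace :=
  zariski (fun (i : 'I_n) (x : 'I_n -> k) => x i).

Definition affine X :=
  exists n (A : set (affine_space n)), zclosed A /\ isomorphic X (subspace A).

Record prevariety X : Prop := Prevariety {
  opensT : opens [set: X];
  opensI : forall U V : set X, opens U -> opens V -> opens (U `&` V);
  opens_bigcup : forall S : set (set X), S `<=` @opens X ->
    opens (\bigcup_(U in S) U);
  regular_sub : forall (U V : set X) f, opens U -> opens V -> V `<=` U ->
    sections U f -> sections V f;
  regular_glue : forall (U : set X) f, opens U ->
    (forall x, U x -> exists V g,
       [/\ opens V, V `<=` U, V x, sections V g & {in V, f =1 g}]) ->
    sections U f;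
  affine_cover : exists s : seq (set X),
    (forall U, U \in s -> opens U /\ affine (subspace U)) /\
    forall x, exists2 U, U \in s & U x }.

(* Testing against affine [W] is equivalent to the diagonal being closed. *)
Definition separated X :=
  forall W (f g : W -> X), affine W -> regular_map f -> regular_map g ->
    zclosed [set w | f w = g w].

Definition is_variety X := prevariety X /\ separated X.

Definition is_product X Y P := exists (p : P -> X) (q : P -> Y),
  [/\ regular_map p, regular_map q &
      forall W (f : W -> X) (g : W -> Y),
        is_variety W -> regular_map f -> regular_map g ->
        exists! h : W -> P, [/\ regular_map h, p \o h = f & q \o h = g]].

(* A set of representatives of the isomorphism classes: a variety over [k] has
   a finite cover by subsets of affine spaces, hence no more points than
   [seq k].  Letting the underlying set range over a whole universe would make
   the Grothendieck ring too large to be a [comPzRingType]. *)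
Record variety := Variety {
  var_points : set (seq k);
  variety_opens : set (set {x : seq k | var_points x});
  variety_regular :
    set {x : seq k | var_points x} -> set ({x : seq k | var_points x} -> k);
  varietyP : is_variety (Space variety_opens variety_regular) }.

Coercion space_of_variety (X : variety) : fspace :=
  Space (@variety_opens X) (@variety_regular X).

(* The commutative ring generated by the varieties, subject to the relations
   [X] = [Y] if X and Y are isomorphic, [X] = [Z] + [X \ Z] if Z is closed
   in X, and [X x Y] = [X][Y]: ring terms modulo the least ring congruence
   containing these relations. *)
Inductive K0_term :=
| K0_gen of variety
| K0_zero
| K0_one
| K0_opp of K0_term
| K0_add of K0_term & K0_term
| K0_mul of K0_term & K0_term.

Inductive K0_eq : K0_term -> K0_term -> Prop :=
| K0_refl a : K0_eq a a
| K0_sym a b : K0_eq a b -> K0_eq b a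
| K0_trans a b c : K0_eq a b -> K0_eq b c -> K0_eq a c
| K0_oppW a a' : K0_eq a a' -> K0_eq (K0_opp a) (K0_opp a')
| K0_addW a a' b b' : K0_eq a a' -> K0_eq b b' ->
    K0_eq (K0_add a b) (K0_add a' b')
| K0_mulW a a' b b' : K0_eq a a' -> K0_eq b b' ->
    K0_eq (K0_mul a b) (K0_mul a' b')
| K0_addA a b c : K0_eq (K0_add a (K0_add b c)) (K0_add (K0_add a b) c)
| K0_addC a b : K0_eq (K0_add a b) (K0_add b a)
| K0_add0 a : K0_eq (K0_add K0_zero a) a
| K0_addN a : K0_eq (K0_add (K0_opp a) a) K0_zero
| K0_mulA a b c : K0_eq (K0_mul a (K0_mul b c)) (K0_mul (K0_mul a b) c)
| K0_mulC a b : K0_eq (K0_mul a b) (K0_mul b a)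
| K0_mul1 a : K0_eq (K0_mul K0_one a) a
| K0_mulD a b c :
    K0_eq (K0_mul (K0_add a b) c) (K0_add (K0_mul a c) (K0_mul b c))
| K0_iso (X Y : variety) : isomorphic X Y -> K0_eq (K0_gen X) (K0_gen Y)
| K0_scissor (X Z U : variety) (A : set X) : zclosed A ->
    isomorphic Z (subspace A) -> isomorphic U (subspace (~` A)) ->
    K0_eq (K0_gen X) (K0_add (K0_gen Z) (K0_gen U))
| K0_prod (X Y P : variety) : is_product X Y P ->
    K0_eq (K0_gen P) (K0_mul (K0_gen X) (K0_gen Y)).

HB.instance Definition _ := gen_eqMixin K0_term.
HB.instance Definition _ := gen_choiceMixin K0_term.

Definition K0_eqb : rel K0_term := fun a b => `[< K0_eq a b >].

Fact K0_eqb_refl : reflexive K0_eqb.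
Proof. by move=> a; apply/asboolP; exact: K0_refl. Qed.
Fact K0_eqb_sym : symmetric K0_eqb.
Proof. by move=> a b; apply/asboolP/asboolP; exact: K0_sym. Qed.
Fact K0_eqb_trans : transitive K0_eqb.
Proof. by move=> b a c /asboolP ab /asboolP bc; apply/asboolP/(K0_trans ab). Qed.

Canonical K0_equiv := EquivRel K0_eqb K0_eqb_refl K0_eqb_sym K0_eqb_trans.
Canonical K0_enc := defaultEncModRel K0_eqb.

Definition K0 := {eq_quot K0_eqb}.

HB.instance Definition _ := Choice.on K0.
HB.instance Definition _ : EqQuotient K0_term K0_eqb K0 := EqQuotient.on K0.

Lemma K0_piP a b : \pi_K0 a = \pi_K0 b <-> K0_eq a b.
Proof. by split => [/eqmodP/asboolP //|ab]; apply/eqmodP/asboolP. Qed.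

Definition K0o (x : K0) : K0 := \pi_K0 (K0_opp (repr x)).
Definition K0a (x y : K0) : K0 := \pi_K0 (K0_add (repr x) (repr y)).
Definition K0m (x y : K0) : K0 := \pi_K0 (K0_mul (repr x) (repr y)).

Lemma K0oE a : K0o (\pi_K0 a) = \pi_K0 (K0_opp a).
Proof. by apply/K0_piP/K0_oppW/K0_piP; rewrite reprK. Qed.
Lemma K0aE a b : K0a (\pi_K0 a) (\pi_K0 b) = \pi_K0 (K0_add a b).
Proof. by apply/K0_piP/K0_addW; apply/K0_piP; rewrite reprK. Qed.
Lemma K0mE a b : K0m (\pi_K0 a) (\pi_K0 b) = \pi_K0 (K0_mul a b).
Proof. by apply/K0_piP/K0_mulW; apply/K0_piP; rewrite reprK. Qed.

Let pi_ind (P : K0 -> Prop) : (forall a, P (\pi_K0 a)) -> forall x, P x.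
Proof. by move=> Ppi x; rewrite -[x]reprK. Qed.

Fact K0aA : associative K0a.
Proof.
elim/pi_ind=> a; elim/pi_ind=> b; elim/pi_ind=> c.
by rewrite !K0aE; apply/K0_piP/K0_addA.
Qed.
Fact K0aC : commutative K0a.
Proof.
by elim/pi_ind=> a; elim/pi_ind=> b; rewrite !K0aE; apply/K0_piP/K0_addC.
Qed.
Fact K0a0 : left_id (\pi K0_zero) K0a.
Proof. by elim/pi_ind=> a; rewrite K0aE; apply/K0_piP/K0_add0. Qed.
Fact K0aN : left_inverse (\pi K0_zero) K0o K0a.
Proof. by elim/pi_ind=> a; rewrite K0oE K0aE; apply/K0_piP/K0_addN. Qed.

HB.instance Definition _ := GRing.isZmodule.Build K0 K0aA K0aC K0a0 K0aN.

Fact K0mA : associative K0m.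
Proof.
elim/pi_ind=> a; elim/pi_ind=> b; elim/pi_ind=> c.
by rewrite !K0mE; apply/K0_piP/K0_mulA.
Qed.
Fact K0mC : commutative K0m.
Proof.
by elim/pi_ind=> a; elim/pi_ind=> b; rewrite !K0mE; apply/K0_piP/K0_mulC.
Qed.
Fact K0m1 : left_id (\pi K0_one) K0m.
Proof. by elim/pi_ind=> a; rewrite K0mE; apply/K0_piP/K0_mul1. Qed.
Fact K0mD : left_distributive K0m K0a.
Proof.
elim/pi_ind=> a; elim/pi_ind=> b; elim/pi_ind=> c.
by rewrite K0aE !K0mE K0aE; apply/K0_piP/K0_mulD.
Qed.

HB.instance Definition _ :=
  GRing.Zmodule_isComPzRing.Build K0 K0mA K0mC K0m1 K0mD.

(* The junk value 0 is only taken when [X] is not a variety. *)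
Definition K0_class (X : fspace) : K0 :=
  if pselect (exists Y : variety, isomorphic X Y) is left XY
  then \pi_K0 (K0_gen (projT1 (cid XY))) else 0.

Definition Lefschetz : K0 := K0_class (affine_space 1).

Definition stratification X (A : set X) (s : seq (set X)) :=
  [/\ uniq s,
      forall B, B \in s -> locally_closed B,
      forall B C, B \in s -> C \in s -> B <> C -> B `&` C = set0 &
      A = [set x | exists2 B, B \in s & B x]].

(* The sum of the classes of the strata does not depend on the finite
   partition of [A] into locally closed subsets; one exists if and only if
   [A] is constructible. *)
Definition constructible_class X (A : set X) : K0 :=
  xget 0 [set a | exists2 s, stratification A s &
                  a = \sum_(B <- s) K0_class (subspace B)].

Definition jet_ring (m : nat) := {poly %/ ('X^(m.+1) : {poly k})}.

Definition truncate m (x : series k) : jet_ring m :=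
  in_qpoly 'X^(m.+1) (\poly_(i < m.+1) coefs x i).

Lemma in_qpoly_take m (p : {poly k}) :
  in_qpoly 'X^(m.+1) p = in_qpoly 'X^(m.+1) (take_poly m.+1 p).
Proof.
apply: val_inj; rewrite /= mk_monic_Xn /= -[in LHS](poly_take_drop m.+1 p).
by rewrite Pdiv.RingMonic.rmodpD ?monicXn // Pdiv.RingMonic.rmodp_mull
           ?monicXn // addr0.
Qed.

Fact truncate_is_linear m : linear (truncate m).
Proof.
move=> a x y; rewrite /truncate -linearP; congr in_qpoly.
by apply/polyP => i; rewrite !(coefE, coefZ); case: ifP; rewrite ?mulr0 ?addr0.
Qed.
HB.instance Definition _ m :=
  GRing.isSemilinear.Build k (series k) (jet_ring m) _ (truncate m)
    (GRing.semilinear_linear (@truncate_is_linear m)).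

Fact truncate_is_monoid_morphism m : monoid_morphism (truncate m).
Proof.
split=> [|x y]; rewrite /truncate.
  rewrite -in_qpoly1; congr in_qpoly; apply/polyP => i.
  by rewrite coef_poly coef1; case: ifP => // /negbT; case: i.
rewrite -in_qpolyM [RHS]in_qpoly_take; congr in_qpoly; apply/polyP => i.
rewrite coef_poly coef_take_poly; case: ifP => // im; rewrite coefM.
apply: eq_bigr => j _; rewrite !coef_poly !(leq_ltn_trans _ im) //.
  exact: leq_subr.
by rewrite -ltnS.
Qed.
HB.instance Definition _ m :=
  GRing.isMonoidMorphism.Build (series k) (jet_ring m) (truncate m)
    (@truncate_is_monoid_morphism m).

(* Arcs and jets of the affine variety [S] with coordinate ring [A]; [Z] is
   the closed subvariety defined by the vanishing of the elements of [I]. *)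
Section Arcs.
Variable A : comAlgType k.

Definition formal_arc := {lrmorphism A -> series k}.

Definition jet (m : nat) := {lrmorphism A -> jet_ring m}.

(* The [m]-jet scheme of [Spec A] is affine; its coordinate ring is generated
   by the functions sending a jet [phi] to the coefficient of [t^i] in
   [phi a], for [a] in [A] and [i <= m]. *)
Definition jet_space (m : nat) : fspace :=
  zariski (fun (ai : A * 'I_m.+1) (phi : jet m) =>
    (phi ai.1 : {poly k})`_(ai.2)).

Definition jet_of_arc m (phi : formal_arc) : jet_space m :=
  (truncate m \o phi : {lrmorphism A -> jet_ring m}).

Definition arcs_at (I : set A) : set formal_arc :=
  [set phi | forall a, I a -> coefs (phi a) 0%N = 0].

Definition Pgeom : series K0 :=
  Series (fun m => constructible_class (range (jet_of_arc m))).

Definition Pgeom_at (I : set A) : series K0 :=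
  Series (fun m => constructible_class [set jet_of_arc m phi | phi in arcs_at I]).

End Arcs.
End Varieties.

Arguments Lefschetz {k}.

Lemma lrmorphism_eq (R : pzSemiRingType) (A B : lSemiAlgType R)
  (f g : {lrmorphism A -> B}) : f =1 g -> f = g.
Proof.
case: f g => [f [[fa] [fm] [fs]]] [g [[ga] [gm] [gs]]] /= /funext fg.
by subst g; congr (GRing.LRMorphism.Pack (GRing.LRMorphism.Class _ _ _));
   congr (_ _); exact: Prop_irrelevance.
Qed.

Definition monoid_algebra (R : comNzRingType) (L : nmodType) := {malg R[L]}.

Section MonoidAlgebra.
Variables (R : comNzRingType) (L : nmodType).
Local Notation RL := (monoid_algebra R L).
Implicit Types (f g h : RL) (u v w : L).

HB.instance Definition _ := GRing.Lmodule.on RL.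

Definition monomial u : RL := mkmalgU u 1.

Definition ma_mul f g : RL := \sum_(u <- msupp f) \sum_(v <- msupp g)
  mkmalgU (u + v) (mcoeff u f * mcoeff v g).

Lemma ma_mulw (d1 d2 : {fset L}) f g :
  fsubset (msupp f) d1 -> fsubset (msupp g) d2 ->
  ma_mul f g = \sum_(u <- d1) \sum_(v <- d2)
    mkmalgU (u + v) (mcoeff u f * mcoeff v g).
Proof.
move=> le1 le2; rewrite /ma_mul (big_fset_incl _ le1) /=.
  apply/eq_bigr=> u _; apply/big_fset_incl => // v _ /mcoeff_outdom ->.
  by rewrite mulr0 monalgU0.
move=> u _ /mcoeff_outdom fu.
by rewrite big1 // => v _; rewrite fu mul0r monalgU0.
Qed.

Fact ma_mulC : commutative ma_mul.
Proof.
move=> f g; rewrite /ma_mul exchange_big /=.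
apply: eq_bigr => u _; apply: eq_bigr => v _.
by rewrite addrC mulrC.
Qed.

Fact ma_mulDl : left_distributive ma_mul +%R.
Proof.
move=> f g h; rewrite (ma_mulw (msuppD_le f g) (fsubset_refl _)).
rewrite (ma_mulw (fsubsetUl _ (msupp g)) (fsubset_refl (msupp h))).
rewrite (ma_mulw (fsubsetUr (msupp f) _) (fsubset_refl (msupp h))).
rewrite -big_split /=; apply/eq_bigr=> u _.
rewrite -big_split /=; apply/eq_bigr=> v _.
by rewrite mcoeffD mulrDl monalgUD.
Qed.

Fact ma_mulDr : right_distributive ma_mul +%R.
Proof. by move=> f g h; rewrite ![ma_mul f _]ma_mulC ma_mulDl. Qed.

Fact ma_mul0l f : ma_mul 0 f = 0.
Proof. by rewrite /ma_mul msupp0 big_seq_fset0. Qed.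

Fact ma_mulr0 f : ma_mul f 0 = 0.
Proof. by rewrite ma_mulC ma_mul0l. Qed.

Lemma ma_mulUU a b u v :
  ma_mul (mkmalgU u a) (mkmalgU v b) = mkmalgU (u + v) (a * b).
Proof. by rewrite (ma_mulw msuppU_le msuppU_le) !big_seq_fset1 !mcoeffUU. Qed.

Let ma_mul_suml I (s : seq I) (F : I -> RL) g :
  ma_mul (\sum_(i <- s) F i) g = \sum_(i <- s) ma_mul (F i) g.
Proof.
by apply: (big_morph (ma_mul^~ g)) => [f h|]; rewrite ?ma_mulDl ?ma_mul0l.
Qed.

Let ma_mul_sumr I (s : seq I) (F : I -> RL) g :
  ma_mul g (\sum_(i <- s) F i) = \sum_(i <- s) ma_mul g (F i).
Proof.
by apply: (big_morph (ma_mul g)) => [f h|]; rewrite ?ma_mulDr ?ma_mulr0.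
Qed.

Let ma_span f :
  exists (s : seq L) (c : L -> R), f = \sum_(u <- s) mkmalgU u (c u).
Proof. by exists (msupp f), (mcoeff^~ f); exact: monalgE. Qed.

Fact ma_mulA : associative ma_mul.
Proof.
move=> f g h; have [sf [cf ->]] := ma_span f.
have [sg [cg ->]] := ma_span g; have [sh [ch ->]] := ma_span h.
rewrite !(ma_mul_suml sf); apply: eq_bigr => u _.
rewrite !(ma_mul_suml sg) !(ma_mul_sumr sg) (ma_mul_suml sg).
apply: eq_bigr => v _.
rewrite !(ma_mul_sumr sh); apply: eq_bigr => w _.
by rewrite !ma_mulUU addrA mulrA.
Qed.

Fact ma_mul1 : left_id (monomial 0) ma_mul.
Proof.
move=> f; have [s [c ->]] := ma_span f; rewrite ma_mul_sumr.
by apply: eq_bigr => u _; rewrite ma_mulUU add0r mul1r.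
Qed.

Fact ma_one_neq0 : monomial 0 != 0.
Proof. by rewrite monalgU_eq0 oner_eq0. Qed.

HB.instance Definition _ := GRing.Zmodule_isComNzRing.Build RL
  ma_mulA ma_mulC ma_mul1 ma_mulDl ma_one_neq0.

Fact ma_scaleAl (a : R) f g : a *: (f * g) = (a *: f) * g.
Proof.
rewrite -[f * g]/(ma_mul f g) -[(a *: f) * g]/(ma_mul (a *: f) g).
rewrite (ma_mulw (msuppZ_le a f) (fsubset_refl (msupp g))) /ma_mul.
rewrite scaler_sumr; apply: eq_bigr => u _.
rewrite scaler_sumr; apply: eq_bigr => v _.
by apply/malgP => w; rewrite mcoeffZ !mcoeffU mulrnAr mcoeffZ mulrA.
Qed.

HB.instance Definition _ := GRing.Lmodule_isLalgebra.Build R RL ma_scaleAl.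
HB.instance Definition _ := GRing.Lalgebra_isComAlgebra.Build R RL.

End MonoidAlgebra.

(* [Spec A] is normal: [A] is a domain which is integrally closed in its field
   of fractions.  The equation is the integral dependence of [f / g] over [A]
   multiplied by [g ^+ n]. *)
Definition normal_domain (A : comNzRingType) :=
  (forall f g : A, f * g = 0 -> f = 0 \/ g = 0) /\
  forall n (a : 'I_n -> A) (f g : A), g != 0 ->
    f ^+ n + \sum_(i < n) a i * f ^+ i * g ^+ (n - i) = 0 ->
    exists h, f = h * g.

Section Submonoid.
Variables (V : nmodType) (S : addrClosed V).

Record submonoid : predArgType :=
  Submonoid { submonoid_val :> V; _ : submonoid_val \in S }.

HB.instance Definition _ := [isSub for submonoid_val].
HB.instance Definition _ := [Choice of submonoid by <:].

Fact submonoid_closed : addr_closed (fun x => x \in S).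
Proof. by split=> [|x y]; rewrite ?inE; [exact: rpred0 | exact: rpredD]. Qed.
HB.instance Definition _ :=
  GRing.SubChoice_isSubNmodule.Build V (fun x => x \in S) submonoid
    submonoid_closed.

End Submonoid.

(* The lattice [M] is [Z^d], written as row vectors; its dual [N] is [Z^d],
   written as column vectors; the pairing is the matrix product. *)
Section Cones.
Variables (R : realType) (d : nat).
Local Notation M := 'rV[int]_d.
Local Notation M_R := 'rV[R]_d.
Local Notation N_R := 'cV[R]_d.

Definition real_point (u : M) : M_R := map_mx intr u.

Definition pairing (x : M_R) (n : N_R) : R := (x *m n) 0 0.

Definition finitely_generated (L : addrClosed M) :=
  exists s : seq M, forall u, u \in L <->
    exists c : 'I_(size s) -> nat, u = \sum_(i < size s) s`_i *+ c i.

Definition generates_lattice (L : addrClosed M) :=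
  forall G : zmodClosed M, {subset L <= G} -> forall u, u \in G.

Definition cone_of (L : {pred M}) : set M_R :=
  [set x | exists2 s : seq (R * M),
    {in s, forall p, 0 <= p.1 /\ p.2 \in L} &
    x = \sum_(p <- s) p.1 *: real_point p.2].

Definition strictly_convex (C : set M_R) := forall x, C x -> C (- x) -> x = 0.

Definition dual_cone (C : set M_R) : set N_R :=
  [set n | forall x, C x -> 0 <= pairing x n].

(* The dimension of the linear span of [C]. *)
Definition span_dim (V : vectType R) (C : set V) : nat :=
  \max_(n < (\dim {:V}).+1 |
    `[< exists2 X : n.-tuple V, free X & {in X, forall v, C v} >]) n.

Definition codim (theta : set N_R) : nat := (d - span_dim theta)%N.

Definition faces (sigma : set N_R) : set (set N_R) :=
  [set theta | exists2 x, (forall n, sigma n -> 0 <= pairing x n) &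
    theta = sigma `&` [set n | pairing x n = 0]].

Definition orthogonal (theta : set N_R) : set M_R :=
  [set x | forall n, theta n -> pairing x n = 0].

Definition orthogonal_lattice (theta : set N_R) : {pred M} :=
  [pred u | `[< orthogonal theta (real_point u) >]].

Fact real_pointB u v : real_point (u - v) = real_point u - real_point v.
Proof. by apply/rowP => i; rewrite !mxE intrB. Qed.
Fact real_pointD u v : real_point (u + v) = real_point u + real_point v.
Proof. by apply/rowP => i; rewrite !mxE intrD. Qed.
Fact real_point0 : real_point 0 = 0.
Proof. by apply/rowP => i; rewrite !mxE. Qed.

Fact orthogonal0 theta : orthogonal theta 0.
Proof. by move=> n _; rewrite /pairing mul0mx mxE. Qed.
Fact orthogonalD theta x y :
  orthogonal theta x -> orthogonal theta y -> orthogonal theta (x + y).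
Proof.
move=> ox oy n tn; rewrite /pairing mulmxDl mxE.
by rewrite -/(pairing x n) -/(pairing y n) ox // oy // addr0.
Qed.
Fact orthogonalN theta x : orthogonal theta x -> orthogonal theta (- x).
Proof.
by move=> ox n tn; rewrite /pairing mulNmx mxE -/(pairing x n) ox // oppr0.
Qed.

Fact orthogonal_lattice_zmod theta : zmod_closed (orthogonal_lattice theta).
Proof.
split=> [|u v]; rewrite ?inE.
  by rewrite real_point0; exact (@orthogonal0 theta).
move=> ou ov; rewrite real_pointB.
by apply (@orthogonalD theta) => //; apply (@orthogonalN theta).
Qed.
HB.instance Definition _ theta :=
  GRing.isZmodClosed.Build M (orthogonal_lattice theta)
    (orthogonal_lattice_zmod theta).

(* [M_theta = M / (orthogonal theta /\ M)]. *)
Definition quotient_lattice (theta : set N_R) : zmodType :=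
  Quotient.quot (orthogonal_lattice theta).

(* The points of [M_theta] whose image in [(M_theta)_R] lies in the image of
   the cone generated by [L].  As [theta] is a rational cone, [(M_theta)_R] is
   the quotient of [M_R] by [orthogonal theta]. *)
Definition quotient_cone (L : {pred M}) (theta : set N_R) :
    {pred quotient_lattice theta} :=
  [pred q | `[< exists u x, [/\ q = (\pi u)%qT, cone_of L x &
                               orthogonal theta (real_point u - x)] >]].

Fact cone_of0 L : cone_of L 0.
Proof. by exists [::]; rewrite ?big_nil. Qed.
Fact cone_ofD L x y : cone_of L x -> cone_of L y -> cone_of L (x + y).
Proof.
move=> [s sL ->] [t tL ->]; exists (s ++ t); last by rewrite big_cat.
by move=> p; rewrite mem_cat => /orP[/sL|/tL].
Qed.

Fact quotient_cone_closed L theta : addr_closed (@quotient_cone L theta).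
Proof.
split=> [|p q]; rewrite ?inE.
  exists 0, 0; split; [by rewrite raddf0|exact: cone_of0|].
  by rewrite real_point0 subrr; exact (@orthogonal0 theta).
move=> [u [x [-> Lx ux]]] [v [y [-> Ly vy]]].
exists (u + v), (x + y); split; [by rewrite raddfD|exact: cone_ofD|].
by rewrite real_pointD opprD addrACA; apply (@orthogonalD theta).
Qed.
HB.instance Definition _ L theta :=
  GRing.isAddClosed.Build (quotient_lattice theta) (@quotient_cone L theta)
    (quotient_cone_closed L theta).

Definition Lambda (L : {pred M}) (theta : set N_R) : nmodType :=
  (submonoid (@quotient_cone L theta : addrClosed _) * {ffun 'I_(codim theta) -> nat})%type.

End Cones.

Arguments cone_of R {d} L.

(* The coordinate ring of [Z^L = Spec C[L]]. *)
Definition toric_ring (R : realType) (L : nmodType) := monoid_algebra R[i] L.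

(* The generators of the maximal ideal of the origin of [Z^L]. *)
Definition toric_origin (R : realType) (L : nmodType) : set (toric_ring R L) :=
  [set monomial R[i] u | u in [set u : L | u != 0]].

Arguments toric_origin : clear implicits.

(* Main.v *)
Require Import Defs.
From HB Require Import structures.
From mathcomp Require Import all_boot all_order all_algebra.
From mathcomp Require Import finmap monalg generic_quotient.
From mathcomp Require Import boolp classical_sets cardinality fsbigop reals.
From mathcomp Require Import complex zify ring.

(** Let [Z] be the toric variety of the saturated semigroup [L], with cone
    [sigma].  A jet of [Z] is a monoid morphism [psi] from [L] to
    [k[t]/t^(m+1)], and the elements of [L] which [psi] sends to units form a
    face of the monoid [L].  By Farkas' lemma such a face is [L] intersected
    with the lattice [O] orthogonal to a face [theta] of [sigma], and [theta]
    is unique ([monoid_face], [face_ext]): it is the torus orbit that contains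
    the origin of the jet.  Sorting jets by [theta] cuts the jet space into
    finitely many locally closed pieces.

    On the piece of [theta] the values of [psi] on [L] intersected with [O] are
    units, so [psi] extends to all the lattice points that are nonnegative on
    [theta]; by saturation these are the points [u] such that [u] plus a
    multiple of a fixed element [x0] interior to that face lies in [L],
    that is, the preimage of the cone of [theta] in [M / O]
    ([quotient_coneP]).  Choose a basis [e_1, ..., e_c] of [O], [c] the
    codimension of [theta], and a complement of [O] in [M]
    ([face_splitting]).  Then [psi] amounts to its restriction to the
    complement together with the units [psi (e_i)].  Writing such a unit as its
    value [a_i] at [t = 0] times [1 + y_i], the [a_i] are a point of the torus
    of dimension [c], and the restriction together with the [y_i] is a jet with
    origin at the origin of the toric variety of [Lambda L theta], [y_i] being
    the image of the [i]-th generator of the factor [N^c].  The correspondence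
    is an isomorphism of varieties ([orbit_part_iso]).  The same formulas over
    [k[[t]]] commute with truncation, hence a jet lifts to an arc if and only
    if its partner does ([orbit_arcs]).  Each piece of the set of liftable jets
    is therefore the product of a torus of dimension [c] and of the jets of arcs
    at the origin of the toric variety of [Lambda L theta], which explains the
    factor [(Lefschetz - 1) ^+ c] ([orbit_contribution]).

    Taking classes requires an explicit decomposition of the set of liftable
    jets at the origin into locally closed sets ([arcs_jets_constructible]).
    Fix the orders [a_i] of the values of a jet on generators of the semigroup,
    an order beyond [m] being recorded as [m+1].  If one arc [phi0] at the
    origin has these orders, a jet with the same orders lifts exactly when its
    leading parts satisfy the binomial relations among the generators modulo the
    powers of [t] that the jet determines, a closed condition.  To lift, one
    multiplies [phi0] by a character of the lattice with values in the units of
    [k[[t]]], which is built one coefficient at a time ([unit_interpolation]);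
    the obstruction to extending a homomorphism from a sublattice vanishes
    because the groups [k^*] and [k], in characteristic zero, are divisible.

    The remaining parts set up the geometry: Zariski spaces isomorphic to
    locally closed subsets of affine space are varieties, stable under locally
    closed subsets and products, jet spaces of toric varieties are among them
    ([jet_space_quasi_affine]), and the class of a constructible set may be
    computed on any finite partition into locally closed subsets
    ([constructible_class_fam]). *)

Set Implicit Arguments.
Unset Strict Implicit.
Unset Printing Implicit Defensive.

Import Order.TTheory GRing.Theory Num.Theory.
Local Open Scope classical_set_scope.
Local Open Scope ring_scope.

(** * Regular functions and regular maps of Zariski spaces *)

Section Zariski.
Variable k : closedFieldType.
Implicit Types (T I J : Type) (X Y W : fspace k).

Lemma polyfun_mono T I J (gen : I -> T -> k) (gen' : J -> T -> k) :
  (forall i, polyfun gen' (gen i)) -> polyfun gen `<=` polyfun gen'.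
Proof.
move=> h p; elim=> {p} [c|i|p q _ hp _ hq|p q _ hp _ hq] //.
- exact: PolyCst.
- exact: PolyAdd.
- exact: PolyMul.
Qed.

Lemma polyfun_comp T (T' : Type) I (gen : I -> T -> k) (h : T' -> T) p :
  polyfun gen p -> polyfun (fun i => gen i \o h) (p \o h).
Proof.
elim=> {p} [c|i|p q _ hp _ hq|p q _ hp _ hq].
- exact: PolyCst.
- exact: (PolyGen (fun i => gen i \o h)).
- exact: PolyAdd hp hq.
- exact: PolyMul hp hq.
Qed.

(** A polynomial in restricted functions is the restriction of the same
    polynomial; this is what makes a subspace of a Zariski space a Zariski space. *)
Lemma polyfun_lift T (T' : Type) I (gen : I -> T -> k) (h : T' -> T) p :
  polyfun (fun i => gen i \o h) p -> exists2 q, polyfun gen q & p = q \o h.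
Proof.
elim=> {p} [c|i|p q _ [p' hp ->] _ [q' hq ->]|p q _ [p' hp ->] _ [q' hq ->]].
- by exists (fun=> c) => //; apply: PolyCst.
- by exists (gen i) => //; apply: PolyGen.
- by exists (fun x => p' x + q' x) => //; apply: PolyAdd.
- by exists (fun x => p' x * q' x) => //; apply: PolyMul.
Qed.

Lemma polyfun_opp T I (gen : I -> T -> k) p :
  polyfun gen p -> polyfun gen (fun x => - p x).
Proof.
move=> hp; rewrite (_ : (fun x => - p x) = (fun x => -1 * p x)).
  by apply: PolyMul => //; apply: PolyCst.
by apply/funext => x; rewrite mulN1r.
Qed.

Lemma polyfun_sum T I (gen : I -> T -> k) (J : Type) (r : seq J) (P : pred J)
    (F : J -> T -> k) : (forall j, P j -> polyfun gen (F j)) ->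
  polyfun gen (fun x => \sum_(j <- r | P j) F j x).
Proof.
move=> hF; elim: r => [|j r IH].
  by rewrite (_ : (fun x => _) = fun=> 0);
    [exact: PolyCst | apply/funext => x; rewrite big_nil].
rewrite (_ : (fun x => _) = fun x => (if P j then F j x else 0) +
   \sum_(j <- r | P j) F j x); last first.
  by apply/funext => x; rewrite big_cons; case: (P j); rewrite ?add0r.
apply: PolyAdd IH; case Pj: (P j); [exact: hF|exact: PolyCst].
Qed.

Lemma polyfun_prod T I (gen : I -> T -> k) (J : Type) (r : seq J) (P : pred J)
    (F : J -> T -> k) : (forall j, P j -> polyfun gen (F j)) ->
  polyfun gen (fun x => \prod_(j <- r | P j) F j x).
Proof.
move=> hF; elim: r => [|j r IH].
  by rewrite (_ : (fun x => _) = fun=> 1);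
    [exact: PolyCst | apply/funext => x; rewrite big_nil].
rewrite (_ : (fun x => _) = fun x => (if P j then F j x else 1) *
   \prod_(j <- r | P j) F j x); last first.
  by apply/funext => x; rewrite big_cons; case: (P j); rewrite ?mul1r.
apply: PolyMul IH; case Pj: (P j); [exact: hF|exact: PolyCst].
Qed.

Section OneSpace.
Variables (T I : Type) (gen : I -> T -> k).
Local Notation Z := (zariski gen).
Local Notation pf := (polyfun gen).

Lemma zopenP (U : set T) : @opens k Z U <->
  forall x, U x -> exists p, [/\ pf p, p x != 0 & forall y, p y != 0 -> U y].
Proof.
split=> [[S Spf ->] x [p Sp px]|h].
  by exists p; split=> //; [exact: Spf | move=> y py; exists p].
exists [set p | pf p /\ forall y, p y != 0 -> U y] => [p []//|].
apply/seteqP; split=> [x Ux|x [p [_ h']]]; last exact: h'.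
by have [p [hp px hy]] := h _ Ux; exists p.
Qed.

Lemma zopen_nz p : pf p -> @opens k Z [set x | p x != 0].
Proof. by move=> hp; apply/zopenP => x px; exists p. Qed.

Lemma zopenT : @opens k Z [set: T].
Proof.
by apply/zopenP => x _; exists (fun=> 1); split; rewrite ?oner_eq0 //;
  exact: PolyCst.
Qed.

Lemma zopenI (U V : set T) : @opens k Z U -> @opens k Z V ->
  @opens k Z (U `&` V).
Proof.
move=> /zopenP hU /zopenP hV; apply/zopenP => x [/hU [p [hp px py]]].
move=> /hV [q [hq qx qy]]; exists (fun x => p x * q x); split.
- exact: PolyMul.
- by rewrite mulf_neq0.
- by move=> y; rewrite mulf_eq0 negb_or => /andP[/py ? /qy ?].
Qed.

Lemma zopen_bigcup (S : set (set T)) : S `<=` @opens k Z ->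
  @opens k Z (\bigcup_(U in S) U).
Proof.
move=> SZ; apply/zopenP => x [U SU Ux].
have /zopenP /(_ x Ux) [p [hp px py]] := SZ _ SU.
by exists p; split=> // y /py ?; exists U.
Qed.

Lemma zopenU (U V : set T) : @opens k Z U -> @opens k Z V ->
  @opens k Z (U `|` V).
Proof.
move=> hU hV; rewrite (_ : U `|` V = \bigcup_(W in [set U; V]) W).
  by apply: zopen_bigcup => W [->|->].
rewrite bigcup_setU !bigcup_set1 //.
Qed.

Lemma zopen_exists (J : Type) (U : J -> set T) :
  (forall j, @opens k Z (U j)) -> @opens k Z [set x | exists j, U j x].
Proof.
move=> hU; apply/zopenP => x [j Ujx]; have /zopenP /(_ x Ujx) := hU j.
by move=> [p [hp px py]]; exists p; split=> // y /py; exists j.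
Qed.

Lemma zopen0 : @opens k Z set0.
Proof. by apply/zopenP. Qed.

Lemma zclosed_all (J : Type) (A : J -> set T) :
  (forall j, @zclosed k Z (A j)) -> @zclosed k Z [set x | forall j, A j x].
Proof.
move=> hA; rewrite /zclosed (_ : ~` _ = [set x | exists j, (~` A j) x]).
  exact: zopen_exists.
apply/seteqP; split=> [x /= /existsNP//|x [j Ajx] h]; exact: Ajx.
Qed.

Lemma zclosedI (A B : set T) : @zclosed k Z A -> @zclosed k Z B ->
  @zclosed k Z (A `&` B).
Proof. by move=> hA hB; rewrite /zclosed setCI; apply: zopenU. Qed.

Lemma zclosed_eq0 p : pf p -> @zclosed k Z [set x | p x = 0].
Proof.
move=> hp; rewrite /zclosed (_ : ~` _ = [set x | p x != 0]); first exact: zopen_nz.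
by apply/seteqP; split=> x /= /eqP.
Qed.

Lemma zclosed_eq p q : pf p -> pf q -> @zclosed k Z [set x | p x = q x].
Proof.
move=> hp hq; rewrite (_ : [set x | _] = [set x | p x + - q x = 0]).
  by apply: zclosed_eq0; apply: PolyAdd => //; apply: polyfun_opp.
apply/seteqP; split=> x /=; first by move->; rewrite subrr.
by move/eqP; rewrite subr_eq0 => /eqP.
Qed.

Lemma sec_ext U g f : f =1 g -> @sections k Z U g -> @sections k Z U f.
Proof. by move=> /funext ->. Qed.

Lemma sec_cst U c : @sections k Z U (fun=> c).
Proof.
move=> x Ux; exists (fun=> c), (fun=> 1); split.
- exact: PolyCst.
- exact: PolyCst.
- by rewrite oner_eq0.
- by move=> y _ _; rewrite divr1.
Qed.

Lemma sec_poly U p : pf p -> @sections k Z U p.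
Proof.
move=> hp x Ux; exists p, (fun=> 1); split=> //.
- exact: PolyCst.
- by rewrite oner_eq0.
- by move=> y _ _; rewrite divr1.
Qed.

Lemma sec_gen U i : @sections k Z U (gen i).
Proof. by apply: sec_poly; apply: PolyGen. Qed.

Lemma sec_add U f g : @sections k Z U f -> @sections k Z U g ->
  @sections k Z U (fun x => f x + g x).
Proof.
move=> hf hg x Ux; have [p [q [hp hq qx e]]] := hf x Ux.
have [p' [q' [hp' hq' qx' e']]] := hg x Ux.
exists (fun x => p x * q' x + p' x * q x), (fun x => q x * q' x); split.
- by apply: PolyAdd; apply: PolyMul.
- exact: PolyMul.
- by rewrite mulf_neq0.
- move=> y Uy; rewrite mulf_eq0 negb_or => /andP[qy qy'].
  by rewrite e // e' // addf_div.
Qed.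

Lemma sec_mul U f g : @sections k Z U f -> @sections k Z U g ->
  @sections k Z U (fun x => f x * g x).
Proof.
move=> hf hg x Ux; have [p [q [hp hq qx e]]] := hf x Ux.
have [p' [q' [hp' hq' qx' e']]] := hg x Ux.
exists (fun x => p x * p' x), (fun x => q x * q' x); split.
- exact: PolyMul.
- exact: PolyMul.
- by rewrite mulf_neq0.
- move=> y Uy; rewrite mulf_eq0 negb_or => /andP[qy qy'].
  by rewrite e // e' // mulf_div.
Qed.

Lemma sec_opp U f : @sections k Z U f -> @sections k Z U (fun x => - f x).
Proof.
move=> hf; rewrite (_ : (fun x => - f x) = (fun x => -1 * f x)).
  by apply: sec_mul => //; exact: sec_cst.
by apply/funext => x; rewrite mulN1r.
Qed.

Lemma sec_inv U f : @sections k Z U f -> (forall x, U x -> f x != 0) ->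
  @sections k Z U (fun x => (f x)^-1).
Proof.
move=> hf nz x Ux; have [p [q [hp hq qx e]]] := hf x Ux.
exists (fun x => q x * q x), (fun x => p x * q x); split.
- exact: PolyMul.
- exact: PolyMul.
- rewrite mulf_neq0 //; have := nz x Ux; rewrite e // mulf_eq0 negb_or.
  by case/andP.
- move=> y Uy; rewrite mulf_eq0 negb_or => /andP[py qy].
  by rewrite e // invf_div -[RHS]mulf_div divff // mulr1.
Qed.

Lemma sec_sub (U V : set T) f : V `<=` U -> @sections k Z U f ->
  @sections k Z V f.
Proof.
move=> VU hf x Vx; have [p [q [hp hq qx e]]] := hf x (VU _ Vx).
by exists p, q; split=> // y /VU; apply: e.
Qed.

Lemma sec_local (U : set T) f :
  (forall x, U x -> exists V g, [/\ @opens k Z V, V x, @sections k Z V g &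
     forall y, U y -> V y -> f y = g y]) -> @sections k Z U f.
Proof.
move=> h x Ux; have [V [g [/zopenP oV Vx sg e]]] := h x Ux.
have [r [hr rx hV]] := oV x Vx; have [p [q [hp hq qx e']]] := sg x Vx.
exists (fun x => p x * r x), (fun x => q x * r x); split.
- exact: PolyMul.
- exact: PolyMul.
- by rewrite mulf_neq0.
- move=> y Uy; rewrite mulf_eq0 negb_or => /andP[qy ry].
  by rewrite e ?e' //; [rewrite -mulf_div divff ?mulr1|exact: hV|exact: hV].
Qed.

(** Regular functions form a ring, so it suffices to test generators. *)
Lemma sec_pfun U p (J : Type) (gen' : J -> T -> k) :
  (forall j, @sections k Z U (gen' j)) -> polyfun gen' p ->
  @sections k Z U p.
Proof.
move=> h; elim=> {p} [c|j|p q _ hp _ hq|p q _ hp _ hq] //.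
- exact: sec_cst.
- exact: sec_add.
- exact: sec_mul.
Qed.

Lemma sec_open (U : set T) f : @opens k Z U -> @sections k Z U f ->
  @opens k Z (U `&` [set x | f x != 0]).
Proof.
move=> /zopenP oU sf; apply/zopenP => x [Ux /= fx].
have [p [q [hp hq qx e]]] := sf x Ux; have [r [hr rx hU]] := oU x Ux.
exists (fun x => p x * q x * r x); split.
- by do !apply: PolyMul.
- rewrite !mulf_neq0 //; move: fx; rewrite e // mulf_eq0 negb_or.
  by case/andP.
- move=> y; rewrite !mulf_eq0 !negb_or => /andP[/andP[py qy] ry].
  have Uy := hU _ ry; split=> //=.
  by rewrite e // mulf_neq0 // invr_eq0.
Qed.

End OneSpace.

Lemma zopen_sub T I (gen : I -> T -> k) (A : set T) V :
  @opens k (zariski (fun i (x : {x : T | A x}) => gen i (sval x))) V ->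
  exists2 U, @opens k (zariski gen) U & V = sval @^-1` U.
Proof.
move=> oV.
exists [set x | exists p, [/\ polyfun gen p, p x != 0 &
            forall y : {x | A x}, p (sval y) != 0 -> V y]].
  by apply/zopenP => x [p [hp px hV]]; exists p; split=> // y py; exists p.
apply/seteqP; split=> [x Vx|x [p [_ px]]]; last exact.
have /zopenP /(_ x Vx) [p [/polyfun_lift[q hq ->] qx hy]] := oV.
by exists q; split.
Qed.

(** Induced and Zariski structures agree on every subset, since both the
    opens and the local fractions are given by functions that extend. *)
Lemma subspace_zariski T I (gen : I -> T -> k) (A : set T) :
  @subspace k (zariski gen) A =
  zariski (fun i (x : {x : T | A x}) => gen i (sval x)).
Proof.
rewrite /subspace [RHS]/zariski; congr (@Defs.Space k _ _ _).
  apply/seteqP; split.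
    move=> V [U oU ->].
    change (@opens k (zariski (fun i => gen i \o @sval T A)) (sval @^-1` U)).
    apply/zopenP => x Ux; have /zopenP /(_ _ Ux) [p [hp px hy]] := oU.
    exists (p \o sval); split=> //; first exact: polyfun_comp.
    by move=> y /hy.
  exact: zopen_sub.
apply/funext => V; apply/funext => f; apply/propext; split.
  move=> h x Vx; have [U [g [/zopenP oU sg Ux e]]] := h x Vx.
  have [p [q [hp hq qx e']]] := sg _ Ux.
  have [r [hr rx hU]] := oU _ Ux.
  exists ((fun x => p x * r x) \o sval), ((fun x => q x * r x) \o sval); split.
  - by apply: polyfun_comp; apply: PolyMul.
  - by apply: polyfun_comp; apply: PolyMul.
  - by rewrite /= mulf_neq0.
  - move=> y Vy; rewrite /= mulf_eq0 negb_or => /andP[qy ry].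
    by rewrite e ?e' -?mulf_div ?divff ?mulr1 //; exact: hU.
move=> h x Vx; have [p [q [/polyfun_lift[p' hp' ->] /polyfun_lift[q' hq' ->] qx e]]] := h x Vx.
exists [set x | q' x != 0], (fun x => p' x / q' x); split=> //.
- exact: zopen_nz.
- apply: sec_mul; first exact: sec_poly.
  by apply: sec_inv => //; exact: sec_poly.
Qed.

Lemma regular_comp X Y W (f : X -> Y) (g : Y -> W) :
  regular_map f -> regular_map g -> regular_map (g \o f).
Proof.
move=> rf rg V oV; have [o1 s1] := rg V oV; have [o2 s2] := rf _ o1.
by split=> [|h sh]; [exact: o2 | exact: (s2 (h \o g) (s1 h sh))].
Qed.

Lemma isomorphic_sym X Y : isomorphic X Y -> isomorphic Y X.
Proof. by move=> [f [g [? ? ? ?]]]; exists g, f. Qed.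

Lemma isomorphic_trans X Y W :
  isomorphic X Y -> isomorphic Y W -> isomorphic X W.
Proof.
move=> [f [g [rf rg fK gK]]] [f' [g' [rf' rg' fK' gK']]].
exists (f' \o f), (g \o g'); split; [exact: regular_comp|exact: regular_comp| |].
- exact: can_comp.
- exact: can_comp.
Qed.

Lemma regular_sub_restr X Y (f : X -> Y) (A : set X) (B : set Y)
   (h : forall x : {x : X | A x}, B (f (sval x))) :
  regular_map f ->
  @regular_map k (subspace A) (subspace B) (fun x => exist B (f (sval x)) (h x)).
Proof.
move=> rf V [U oU ->]; split.
  by exists (f @^-1` U) => //; have [] := rf U oU.
move=> g sg x Ux; have [U' [g' [oU' sg' Ux' e]]] := sg _ Ux.
have [o s] := rf U' oU'.
exists (f @^-1` U'), (g' \o f); split=> //; first exact: s.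
by move=> y Vy Uy; apply: e.
Qed.

Lemma isomorphic_subspace X Y (f : X -> Y) (g : Y -> X) (A : set X) :
  regular_map f -> regular_map g -> cancel f g -> cancel g f ->
  isomorphic (subspace A) (subspace (g @^-1` A)).
Proof.
move=> rf rg fK gK.
have h1 (x : {x : X | A x}) : (g @^-1` A) (f (sval x)).
  by rewrite /= fK; case: x.
have h2 (y : {y : Y | (g @^-1` A) y}) : A (g (sval y)) by case: y.
exists (fun x => exist _ (f (sval x)) (h1 x)), (fun y => exist _ (g (sval y)) (h2 y)).
split; [exact: regular_sub_restr|exact: regular_sub_restr| |].
- by move=> [x hx]; apply: eq_exist; rewrite /= fK.
- by move=> [x hx]; apply: eq_exist; rewrite /= gK.
Qed.

(** This criterion replaces every later verification that a map is regular:
    only the coordinate functions of the target have to be pulled back. *)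
Lemma regular_genP T I (T' I' : Type) (gen : I -> T -> k) (gen' : I' -> T' -> k)
    (f : T -> T') :
  (forall i, @sections k (zariski gen) setT (gen' i \o f)) <->
  @regular_map k (zariski gen) (zariski gen') f.
Proof.
split=> [h|rf i]; last first.
  have [_] := rf setT (zopenT _); rewrite preimage_setT; apply.
  exact: sec_gen.
have hs p : polyfun gen' p -> @sections k (zariski gen) setT (p \o f).
  by move=> /(@polyfun_comp _ _ _ _ f) ; apply: sec_pfun.
move=> V oV; split.
  apply/zopenP => x Vx; have /zopenP /(_ _ Vx) [p [hp px hV]] := oV.
  have /zopenP /(_ x) := sec_open (zopenT gen) (hs p hp).
  by case=> [//|q [hq qx hy]]; exists q; split=> // y /hy [_] /hV.
move=> g sg; apply: sec_local => x Vx.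
have [p [q [hp hq qx e]]] := sg _ Vx.
exists [set x | q (f x) != 0], (fun x => p (f x) / q (f x)); split=> //.
- by have := sec_open (zopenT gen) (hs q hq); rewrite setTI.
- apply: sec_mul; first by apply: (sec_sub _ (hs p hp)).
  by apply: sec_inv => //; apply: (sec_sub _ (hs q hq)).
- by move=> y Vy qy; rewrite /= e.
Qed.

End Zariski.

(** * Hilbert's basis theorem and quasi-compactness *)

Section Noetherian.

Section Ideal.
Variable R : comNzRingType.
Implicit Types (S : set R) (x y : R).

Inductive ideal_gen S : R -> Prop :=
| IdealZero : ideal_gen S 0
| IdealStep x a y : ideal_gen S x -> S y -> ideal_gen S (x + a * y).

Lemma ideal_genD S x y : ideal_gen S x -> ideal_gen S y -> ideal_gen S (x + y).
Proof.
move=> hx; elim=> {y} [|y a z _ IH Sz]; first by rewrite addr0.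
by rewrite addrA; apply: IdealStep.
Qed.

Lemma ideal_genM S a x : ideal_gen S x -> ideal_gen S (a * x).
Proof.
elim=> {x} [|x b z _ IH Sz]; first by rewrite mulr0; apply: IdealZero.
by rewrite mulrDr mulrA; apply: IdealStep.
Qed.

Lemma ideal_gen_in S x : S x -> ideal_gen S x.
Proof.
by move=> Sx; rewrite -[x]add0r -[x]mul1r; apply: IdealStep => //; apply: IdealZero.
Qed.

Lemma ideal_gen_sub S S' : S `<=` ideal_gen S' -> ideal_gen S `<=` ideal_gen S'.
Proof.
move=> h x; elim=> {x} [|x b z _ IH Sz]; first exact: IdealZero.
by apply: ideal_genD => //; apply: ideal_genM; apply: h.
Qed.

Lemma ideal_gen_finite S x : ideal_gen S x ->
  exists s : seq R, (forall y, y \in s -> S y) /\ ideal_gen [set` s] x.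
Proof.
elim=> {x} [|x b z _ [s [hs hx]] Sz].
  by exists [::]; split=> //; apply: IdealZero.
exists (z :: s); split.
  by move=> y; rewrite inE => /predU1P[->|/hs].
apply: IdealStep; last by rewrite /= mem_head.
apply: ideal_gen_sub hx => y /= ys; apply: ideal_gen_in.
by rewrite /= inE ys orbT.
Qed.

Definition noetherian := forall S : set R,
  exists s : seq R, (forall y, y \in s -> S y) /\ S `<=` ideal_gen [set` s].

Lemma noetherian_ideal S (s : seq R) : (forall y, y \in s -> ideal_gen S y) ->
  exists s' : seq R, (forall y, y \in s' -> S y) /\
    ideal_gen [set` s] `<=` ideal_gen [set` s'].
Proof.
elim: s => [|x s IH] h.
  by exists [::]; split=> //.
have [|s1 [h1 h1']] := IH; first by move=> y ys; apply: h; rewrite inE ys orbT.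
have [s2 [h2 h2']] := ideal_gen_finite (h x (mem_head _ _)).
exists (s1 ++ s2); split.
  by move=> y; rewrite mem_cat => /orP[/h1|/h2].
apply: ideal_gen_sub => y /=; rewrite inE => /predU1P[->|ys].
  apply: ideal_gen_sub h2' => z /= zs; apply: ideal_gen_in.
  by rewrite /= mem_cat zs orbT.
apply: (@ideal_gen_sub [set` s1]); last by apply: h1'; apply: ideal_gen_in.
by move=> z /= zs; apply: ideal_gen_in; rewrite /= mem_cat zs.
Qed.

End Ideal.

(** Finite choice of witnesses, kept as a list. *)
Lemma seq_choice (T U : eqType) (s : seq T) (P : T -> U -> Prop) :
  (forall x, x \in s -> exists y, P x y) ->
  exists t : seq U, (forall x, x \in s -> exists2 y, y \in t & P x y) /\
     (forall y, y \in t -> exists2 x, x \in s & P x y).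
Proof.
elim: s => [|x s IH] h; first by exists [::].
have [|t [h1 h2]] := IH; first by move=> y ys; apply: h; rewrite inE ys orbT.
have [y Pxy] := h x (mem_head _ _).
exists (y :: t); split=> z; rewrite inE => /predU1P[->|].
- by exists y; rewrite ?mem_head.
- by case/h1 => w wt Pzw; exists w => //; rewrite inE wt orbT.
- by exists x; rewrite ?mem_head.
- by case/h2 => w wt Pzw; exists w => //; rewrite inE wt orbT.
Qed.

(** The classical argument on ideals of leading coefficients.  [P n a p] says
    that [p] is in the ideal [I], of degree at most [n], with coefficient [a] at
    [n]; [L n] is the ideal of these [a].  The union of the [L n] is generated by
    finitely many coefficients, which settles all degrees from some [N] on; the
    [L n] with [n < N] are treated one by one. *)
Theorem hilbert_basis (R : comNzRingType) :
  noetherian R -> noetherian {poly R}.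
Proof.
move=> noethR S; pose I := ideal_gen S.
pose P n a (p : {poly R}) := [/\ I p, (size p <= n.+1)%N & p`_n = a].
pose L n := [set a : R | exists p, P n a p].
pose H (G : seq {poly R}) n := [set b | exists q m,
   [/\ q \in G, (m <= n)%N, (size q <= m.+1)%N & b = q`_m]].
have Hn n : exists G, (forall q, q \in G -> I q) /\ L n `<=` ideal_gen (H G n).
  have [s [sL Ls]] := noethR (L n).
  have [G [h1 h2]] := seq_choice sL.
  exists G; split=> [q /h2[a _ []] //|a /Ls].
  apply: ideal_gen_sub => b /= /h1 [q qG [_ sq e]].
  by apply: ideal_gen_in; exists q, n.
have HG G G' n m : {subset G <= G'} -> (n <= m)%N -> H G n `<=` H G' m.
  move=> GG' nm b [q [m' [qG mn sq ->]]]; exists q, m'; split=> //.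
    exact: GG'.
  exact: leq_trans nm.
have HGi G G' n m : {subset G <= G'} -> (n <= m)%N ->
   ideal_gen (H G n) `<=` ideal_gen (H G' m).
  by move=> GG' nm; apply: ideal_gen_sub => b /(HG _ _ _ _ GG' nm);
     apply: ideal_gen_in.
have HN N : exists G, (forall q, q \in G -> I q) /\
   forall n, (n < N)%N -> L n `<=` ideal_gen (H G n).
  elim: N => [|N [G [h1 h2]]]; first by exists [::].
  have [G' [h1' h2']] := Hn N; exists (G ++ G'); split.
    by move=> q; rewrite mem_cat => /orP[/h1|/h1'].
  move=> n; rewrite ltnS leq_eqVlt => /predU1P[->|nN].
    by move=> a /h2'; apply: HGi => // q qG; rewrite mem_cat qG orbT.
  by move=> a /(h2 _ nN); apply: HGi => // q qG; rewrite mem_cat qG.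
have [G0 [N [G0I G0L]]] : exists G0 N, (forall q, q \in G0 -> I q) /\
    forall n, (N <= n)%N -> L n `<=` ideal_gen (H G0 n).
  have [s [sL Ls]] := noethR (\bigcup_n L n).
  have sL' a : a \in s -> exists y : {poly R} * nat, P y.2 a y.1.
    by move/sL => [n _ [p h]]; exists (p, n).
  have [G [h1 h2]] := seq_choice sL'.
  exists (map fst G), (\max_(y <- G) y.2); split.
    by move=> q /mapP[y /h2 [a _ [? _ _]] ->].
  move=> n Nn a La; have /Ls : (\bigcup_n L n) a by exists n.
  apply: ideal_gen_sub => b /= /h1 [q qG [_ sq e]].
  apply: ideal_gen_in; exists q.1, q.2; split=> //; first exact: map_f.
  apply: leq_trans Nn; exact: (@leq_bigmax_seq _ G predT (fun y : {poly R} * nat => y.2) q qG isT).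
have [G1 [G1I G1L]] := HN N.
pose G := G0 ++ G1.
have GI q : q \in G -> I q by rewrite mem_cat => /orP[/G0I|/G1I].
have GL n : L n `<=` ideal_gen (H G n).
  move=> a; case: (ltnP n N) => nN.
    by move/(G1L _ nN); apply: HGi => // q qG; rewrite mem_cat qG orbT.
  by move/(G0L _ nN); apply: HGi => // q qG; rewrite mem_cat qG.
have key n a : ideal_gen (H G n) a -> exists q,
    [/\ ideal_gen [set` G] q, (size q <= n.+1)%N & q`_n = a].
  elim=> {a} [|x a y _ [q [Gq sq qn]] [q' [m [q'G mn sq' ->]]]].
    by exists 0; rewrite size_poly0 coef0; split=> //; apply: IdealZero.
  exists (q + a%:P * 'X^(n - m) * q'); split.
  - by apply: IdealStep.
  - rewrite (leq_trans (size_polyD _ _)) // geq_max sq /=.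
    rewrite -mulrA mul_polyC (leq_trans (size_scale_leq _ _)) //.
    rewrite (leq_trans (size_polyMleq _ _)) // size_polyXn.
    by move: mn sq'; lia.
  - rewrite coefD qn -mulrA coefCM coefXnM ltnNge leq_subr /=.
    by rewrite subKn.
(* Subtracting an element with the same coefficient at [n] lowers the degree. *)
have IG n : forall p, I p -> (size p <= n)%N -> ideal_gen [set` G] p.
  elim: n => [|n IH] p Ip sp.
    by move: sp; rewrite leqn0 size_poly_eq0 => /eqP ->; apply: IdealZero.
  have /GL /key [q [Gq sq e]] : L n p`_n by exists p.
  rewrite -[p](subrK q); apply: ideal_genD => //; apply: IH.
    rewrite -mulN1r; apply: ideal_genD => //; apply: ideal_genM.
    by apply: (ideal_gen_sub _ Gq) => y /GI.
  apply/leq_sizeP => j; rewrite leq_eqVlt => /predU1P[<-|nj].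
    by rewrite coefB e subrr.
  rewrite coefB !nth_default ?subrr //; exact: leq_trans nj.
have [s [sS Gs]] := noetherian_ideal GI.
exists s; split=> // p Sp; apply: Gs; apply: (IG (size p)) => //.
exact: ideal_gen_in.
Qed.

Lemma noetherian_field (k : fieldType) : noetherian k.
Proof.
move=> S; have [[a [Sa na]]|h] := pselect (exists a, S a /\ a != 0).
  exists [:: a]; split=> [y|y _]; first by rewrite inE => /eqP ->.
  rewrite -[y](divfK na); apply: ideal_genM; apply: ideal_gen_in.
  by rewrite /= mem_head.
exists [::]; split=> // y Sy; have [->|ny] := eqVneq y 0; first exact: IdealZero.
by case: h; exists y.
Qed.

(** Polynomials are represented by an iterated ring of univariate polynomials,
    whose elements are then evaluated at the points of the space. *)
Lemma polyfun_noetherian (k : closedFieldType) (T : Type) n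
    (gen : 'I_n -> T -> k) : exists (R : comNzRingType) (F : T -> {rmorphism R -> k}),
  noetherian R /\ forall p, polyfun gen p -> exists r, forall t, F t r = p t.
Proof.
suff [R [F [nR [hC hg]]]] : exists (R : comNzRingType) (F : T -> {rmorphism R -> k}),
  noetherian R /\ ((forall c, exists r, forall t, F t r = c) /\
     forall i, exists r, forall t, F t r = gen i t).
  exists R, F; split=> // p.
  elim=> {p} [c|i|p q _ [a ha] _ [b hb]|p q _ [a ha] _ [b hb]] //.
  - by exists (a + b) => t; rewrite rmorphD ha hb.
  - by exists (a * b) => t; rewrite rmorphM ha hb.
elim: n gen => [|n IH] gen.
  exists k, (fun _ => idfun); split; first exact: noetherian_field.
  by split=> [c|[]//]; exists c.
have [R [F [nR [hC hg]]]] := IH (fun i => gen (lift ord_max i)).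
pose G t : {rmorphism {poly R} -> k} := horner_eval (gen ord_max t) \o map_poly (F t).
have hP a t : G t a%:P = F t a by rewrite /G /= map_polyC /horner_eval hornerC.
exists {poly R}, G; split; first exact: hilbert_basis.
split=> [c|i]; first by have [r hr] := hC c; exists r%:P => t; rewrite hP.
have [j ->|->] := unliftP ord_max i.
  by have [r hr] := hg j; exists r%:P => t; rewrite hP.
by exists 'X => t; rewrite /G /= map_polyX /horner_eval hornerX.
Qed.

(** Quasi-compactness of a union of principal open sets: the ideal that the
    functions generate is already generated by finitely many of them. *)
Lemma polyfun_qcompact (k : closedFieldType) (T : Type) n
    (gen : 'I_n -> T -> k) (S : set (T -> k)) : S `<=` polyfun gen ->
  exists (m : nat) (p : 'I_m -> T -> k), (forall i, S (p i)) /\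
    forall x, (exists2 q, S q & q x != 0) -> exists i, p i x != 0.
Proof.
move=> Sp; have [R [F [nR hF]]] := polyfun_noetherian gen.
have [s [hs sS]] := nR [set r | exists2 q, S q & forall t, F t r = q t].
have hs' r : r \in s -> exists q : T -> k, S q /\ forall t, F t r = q t.
  by move=> /hs [q]; exists q.
have [t [h1 h2]] := seq_choice hs'.
exists (size t), (fun i => nth (fun=> 0) t i); split=> [i|x [q Sq qx]].
  by have [? _ []] := h2 _ (mem_nth (fun=> 0) (ltn_ord i)).
apply: contrapT => /forallNP h.
have [r hr] := hF q (Sp _ Sq).
have /sS : [set r | exists2 q, S q & forall t, F t r = q t] r by exists q.
have Fs y : y \in s -> F x y = 0.
  move=> /h1 [g gt [Sg ->]].
  have it : (index g t < size t)%N by rewrite index_mem.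
  by have /negP := h (Ordinal it); rewrite /= nth_index // negbK => /eqP.
suff hh : forall y, ideal_gen [set` s] y -> F x y = 0.
  by move/hh; rewrite hr => qx0; rewrite qx0 eqxx in qx.
move=> y; elim=> {y} [|y a z _ IH sz]; first by rewrite rmorph0.
by rewrite rmorphD rmorphM IH (Fs z) // mulr0 addr0.
Qed.

End Noetherian.

(** * Quasi-affine varieties *)

Section QuasiAffine.
Variable k : closedFieldType.
Implicit Types (T I J : Type) (X Y W P : fspace k).

Lemma isomorphic_zariski T I (T' I' : Type) (gen : I -> T -> k)
    (gen' : I' -> T' -> k) (f : T -> T') (g : T' -> T) :
  (forall i, @sections k (zariski gen) setT (gen' i \o f)) ->
  (forall i, @sections k (zariski gen') setT (gen i \o g)) ->
  cancel f g -> cancel g f -> isomorphic (zariski gen) (zariski gen').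
Proof. by move=> hf hg fK gK; exists f, g; split=> //; apply/regular_genP. Qed.

(** A family of finitely many functions that separates points and has locally
    closed image identifies a Zariski space with that image. *)
Section Embedded.
Variables (T : Type) (n : nat) (gen : 'I_n -> T -> k).
Let pt (t : T) : 'I_n -> k := fun i => gen i t.
Hypothesis pt_inj : injective pt.
Hypothesis pt_lc : @locally_closed k (affine_space k n) (range pt).

(** A locally closed subset of affine space is a finite union of sets defined
    by [p <> 0] inside a closed set; each is affine, as the closed subset
    [y p = 1] of an affine space with one more coordinate. *)
Lemma zariski_prevariety : prevariety (zariski gen).
Proof.
have gI U : @opens k (affine_space k n) U -> @opens k (zariski gen) (pt @^-1` U).
  move=> oU; suff rpt : @regular_map k (zariski gen) (affine_space k n) pt.
    by have [] := rpt U oU.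
  by apply/regular_genP => i; apply: sec_gen.
split.
- exact: zopenT.
- exact: zopenI.
- exact: zopen_bigcup.
- by move=> U V f oU oV VU; apply: sec_sub.
- move=> U f oU h; apply: sec_local => x /h [V [g [oV VU Vx sV e]]].
  by exists V, g; split=> // y Uy Vy; apply: e; rewrite inE.
have [U [V [oU oV UV]]] := pt_lc.
have [S Spf US] := oU.
have [m [p [hp hc]]] := polyfun_qcompact Spf.
exists [seq [set t | p j (pt t) != 0] | j <- enum 'I_m]; split; last first.
  move=> t; have : (U `\` V) (pt t) by rewrite -UV; exists t.
  rewrite US => -[/= /hc [j pj] _].
  by exists [set t | p j (pt t) != 0] => //; apply/mapP; exists j; rewrite ?mem_enum.
move=> W /mapP[j _ ->].
have pfj := Spf _ (hp j).
split.
  by apply: (gI [set x | p j x != 0]); apply: zopen_nz.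
have -> : @subspace k (zariski gen) [set t | p j (pt t) != 0] =
   zariski (fun i (x : {t | [set t | p j (pt t) != 0] t}) => gen i (sval x)).
  exact: subspace_zariski.
pose res (y : 'I_n.+1 -> k) : 'I_n -> k := fun i => y (lift ord_max i).
have pfres q : polyfun (fun i (x : 'I_n -> k) => x i) q ->
   polyfun (fun i (x : 'I_n.+1 -> k) => x i) (q \o res).
  move=> /(@polyfun_comp _ _ _ _ _ res); apply: polyfun_mono => i.
  exact: (PolyGen (fun i (x : 'I_n.+1 -> k) => x i)).
have rres : @regular_map k (affine_space k n.+1) (affine_space k n) res.
  apply/regular_genP => i.
  exact: (@sec_gen k _ _ (fun i (x : 'I_n.+1 -> k) => x i) setT (lift ord_max i)).
pose C := [set y : 'I_n.+1 -> k | ~ V (res y) /\ y ord_max * p j (res y) = 1].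
exists n.+1, C; split.
  apply: zclosedI.
    by rewrite /zclosed setCK; have [] := rres V oV.
  apply: (@zclosed_eq _ _ _ _ (fun y => y ord_max * p j (res y)) (fun=> 1)).
    apply: PolyMul; last exact: pfres.
    exact: (PolyGen (fun i (x : 'I_n.+1 -> k) => x i)).
  exact: PolyCst.
rewrite subspace_zariski.
pose F (t : {t | p j (pt t) != 0}) : 'I_n.+1 -> k := fun i =>
  if unlift ord_max i is Some i' then gen i' (sval t) else (p j (pt (sval t)))^-1.
have Fmax t : F t ord_max = (p j (pt (sval t)))^-1 by rewrite /F unlift_none.
have Flift t i : F t (lift ord_max i) = gen i (sval t) by rewrite /F liftK.
have Fres t : res (F t) = pt (sval t) by apply/funext => i; rewrite /res Flift.
have FC t : C (F t).
  rewrite /C /= Fres Fmax; split; last by rewrite mulVf //; case: t.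
  by have : range pt (pt (sval t)) by [exists (sval t)]; rewrite UV => -[].
have inv (y : {y | C y}) : exists t : {t | p j (pt t) != 0}, pt (sval t) = res (sval y).
  case: y => y [/= nV yp].
  have nz : p j (res y) != 0.
    by apply/eqP => e; move/eqP: yp; rewrite e mulr0 eq_sym oner_eq0.
  have : range pt (res y).
    by rewrite UV; split=> //; rewrite US; exists (p j).
  by move=> [t _ e]; have nzt : p j (pt t) != 0; [rewrite e | exists (exist _ t nzt)].
pose G y := sval (cid (inv y)).
have GE y : pt (sval (G y)) = res (sval y) by exact: (svalP (cid (inv y))).
apply: (@isomorphic_zariski _ _ _ _ _ _ (fun t => exist _ (F t) (FC t)) G).
- move=> i; have [i' ->|->] := unliftP ord_max i.
    apply: (@sec_ext _ _ _ _ _ (fun t => gen i' (sval t))).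
      by move=> t /=; rewrite Flift.
    exact: (@sec_gen k _ _ _ _ i').
  apply: (@sec_ext _ _ _ _ _ (fun t => (p j (pt (sval t)))^-1)).
    by move=> t /=; rewrite Fmax.
  apply: sec_inv; last by move=> [].
  apply: sec_poly.
  exact: (@polyfun_comp _ _ _ _ _ (fun t : {t | p j (pt t) != 0} => pt (sval t)) _ pfj).
- move=> i; rewrite (_ : _ \o _ = fun y => (sval y) (lift ord_max i)).
    exact: (@sec_gen k _ _ _ _ (lift ord_max i)).
  by apply/funext => y /=; have /(congr1 (fun f => f i)) := GE y.
- move=> t; have := GE (exist _ (F t) (FC t)); rewrite /= Fres => /pt_inj.
  by move: (G _) => [a ha]; case: t => [b hb] /= e; apply: eq_exist.
- move=> [y Cy] /=; apply: eq_exist; apply/funext => i.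
  have [i' ->|->] := unliftP ord_max i.
    by rewrite Flift; have /(congr1 (fun f => f i')) := GE (exist _ y Cy).
  rewrite Fmax GE /=; case: (Cy) => _ e.
  have nz : p j (res y) != 0.
    by apply/eqP => e'; move/eqP: e; rewrite e' mulr0 eq_sym oner_eq0.
  by apply: (mulIf nz); rewrite mulVf // e.
Qed.

(** Two maps agree where the differences of their coordinates vanish, a closed
    condition on every affine piece. *)
Lemma zariski_separated : separated (zariski gen).
Proof.
move=> W f g [m [A [_ [e [e' [re re' eK e'K]]]]]] rf rg.
move: e e' re re' eK e'K; rewrite subspace_zariski => e e' re re' eK e'K.
have rf' := regular_comp re' rf; have rg' := regular_comp re' rg.
move/regular_genP in rf'; move/regular_genP in rg'.
have cl : @opens k (zariski (fun (i : 'I_m) (x : {x | A x}) => sval x i))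
    [set z | exists i, gen i (f (e' z)) - gen i (g (e' z)) != 0].
  apply: zopen_exists => i.
  have := sec_open (zopenT _) (sec_add (rf' i) (sec_opp (rg' i))).
  by rewrite setTI.
have [o _] := re _ cl.
rewrite /zclosed; move: o; congr opens.
apply/seteqP; split=> w /=.
  by case=> i; rewrite eK => nz E; rewrite E subrr eqxx in nz.
move=> ne; apply: contrapT => /forallNP h; apply: ne; apply: pt_inj.
apply/funext => i; apply/eqP; rewrite -subr_eq0.
by have /negP := h i; rewrite negbK eK.
Qed.

Lemma zariski_variety : is_variety (zariski gen).
Proof. by split; [exact: zariski_prevariety | exact: zariski_separated]. Qed.

End Embedded.

Definition quasi_affine X := exists n (A : set (affine_space k n)),
  locally_closed A /\ isomorphic X (subspace A).

Lemma quasi_affine_iso X Y : isomorphic X Y -> quasi_affine X -> quasi_affine Y.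
Proof.
move=> XY [n [A [lcA XA]]]; exists n, A; split=> //.
exact: isomorphic_trans (isomorphic_sym XY) XA.
Qed.

(** The points are recoded as lists of coordinates, because [variety] only admits
    sets of such lists as carriers. *)
Lemma quasi_affine_variety X : quasi_affine X ->
  exists Y : variety k, isomorphic X Y.
Proof.
move=> [n [A [lcA XA]]].
pose Q (s : seq k) := exists2 a, A a & s = [seq a i | i <- enum 'I_n].
pose T := {s : seq k | Q s}.
pose gen (i : 'I_n) (t : T) : k := (sval t)`_i.
have nthE (a : 'I_n -> k) (i : 'I_n) : [seq a i | i <- enum 'I_n]`_i = a i.
  by rewrite (nth_map i) ?size_enum_ord // nth_ord_enum.
have inj : injective (fun t i => gen i t).
  move=> [s [a Aa sa]] [s' [b Ab sb]] e; apply: eq_exist.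
  rewrite sa sb; congr map; apply/funext => i.
  by have := congr1 (fun f => f i) e; rewrite /gen /= sa sb !nthE.
have rg : range (fun t i => gen i t) = A.
  apply/seteqP; split.
    move=> a [[s [b Ab sb]] _ <-]; suff -> : (fun i => gen i (exist Q s (ex_intro2 _ _ b Ab sb))) = b by [].
    by apply/funext => i; rewrite /gen /= sb nthE.
  move=> a Aa; have h : Q [seq a i | i <- enum 'I_n].
    by exists a.
  by exists (exist Q _ h) => //; apply/funext => i; rewrite /gen /= nthE.
have lc : @locally_closed k (affine_space k n) (range (fun t i => gen i t)).
  by rewrite rg.
have var := zariski_variety inj lc.
exists (Variety var).
apply: (isomorphic_trans XA).
rewrite (_ : space_of_variety _ = zariski gen) //.
rewrite subspace_zariski.
have h1 (x : {x | A x}) : Q [seq sval x i | i <- enum 'I_n].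
  by exists (sval x) => //; case: x.
have h2 (t : T) : A (fun i => gen i t) by rewrite -rg; exists t.
apply: (@isomorphic_zariski _ _ _ _ _ _ (fun x => exist Q _ (h1 x)) (fun t => exist A _ (h2 t))).
- move=> i; rewrite (_ : _ \o _ = fun x => sval x i).
    exact: (@sec_gen k _ _ _ _ i).
  by apply/funext => x; rewrite /= /gen /= nthE.
- by move=> i; exact: (@sec_gen k _ _ gen setT i).
- by move=> [x Ax]; apply: eq_exist; apply/funext => i; rewrite /gen /= nthE.
- move=> t; apply: inj; apply/funext => i; rewrite /gen /= nthE //.
Qed.

Section LC.
Variables (T I : Type) (gen : I -> T -> k).
Local Notation Z := (zariski gen).
Local Notation lc := (@locally_closed k Z).

Lemma lcI (A B : set T) : lc A -> lc B -> lc (A `&` B).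
Proof.
move=> [U [V [oU oV ->]]] [U' [V' [oU' oV' ->]]].
exists (U `&` U'), (V `|` V'); split; [exact: zopenI|exact: zopenU|].
by rewrite !setDE setCU setIACA.
Qed.

Lemma lc_open (U : set T) : @opens k Z U -> lc U.
Proof. by move=> oU; exists U, set0; split=> //; [exact: zopen0|rewrite setD0]. Qed.

Lemma lc_closed (C : set T) : @zclosed k Z C -> lc C.
Proof.
by move=> oU; exists setT, (~` C); split=> //; [exact: zopenT|rewrite setTD setCK].
Qed.

Lemma lcT : lc setT. Proof. exact/lc_open/zopenT. Qed.
Lemma lc0 : lc set0. Proof. exact/lc_open/zopen0. Qed.

End LC.

Lemma lc_preimage T I (T' I' : Type) (gen : I -> T -> k)
    (gen' : I' -> T' -> k) (f : T -> T') (A : set T') :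
  @regular_map k (zariski gen) (zariski gen') f ->
  @locally_closed k (zariski gen') A -> @locally_closed k (zariski gen) (f @^-1` A).
Proof.
move=> rf [U [V [oU oV ->]]]; exists (f @^-1` U), (f @^-1` V).
by split; [have [] := rf U oU | have [] := rf V oV |].
Qed.

Lemma subspace_subspace T I (gen : I -> T -> k) (A B : set T) : B `<=` A ->
  isomorphic (@subspace k (zariski gen) B)
    (zariski (fun i (y : {y : {x | A x} | B (sval y)}) => gen i (sval (sval y)))).
Proof.
move=> BA; rewrite subspace_zariski.
pose f (x : {x | B x}) : {y : {x | A x} | B (sval y)} :=
  exist (fun y : {x | A x} => B (sval y)) (exist _ (sval x) (BA _ (svalP x))) (svalP x).
pose g (y : {y : {x | A x} | B (sval y)}) : {x | B x} := exist (fun x => B x) (sval (sval y)) (svalP y).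
apply: (@isomorphic_zariski _ _ _ _ _ _ f g).
- by move=> i; exact: (@sec_gen k _ _ _ _ i).
- move=> i; exact: (@sec_gen k _ _ _ _ i).
- by move=> [x Bx]; apply: eq_exist.
- by move=> [[x Ax] Bx]; apply: eq_exist; apply: eq_exist.
Qed.

Lemma quasi_affine_sub T I (gen : I -> T -> k) (B : set T) :
  quasi_affine (zariski gen) -> @locally_closed k (zariski gen) B ->
  quasi_affine (@subspace k (zariski gen) B).
Proof.
move=> [n [A [lcA [f [g [rf rg fK gK]]]]]] lcB.
have iso := @isomorphic_subspace k _ _ f g B rf rg fK gK.
apply: (quasi_affine_iso (isomorphic_sym iso)); clear iso.
move: f g rf rg fK gK; rewrite subspace_zariski => f g rf rg fK gK.
have lcgB := lc_preimage rg lcB.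
have [U [V [oU oV e]]] := lcgB.
have [U' oU' eU] := @zopen_sub k _ _ (fun (i : 'I_n) (x : 'I_n -> k) => x i) A U oU.
have [V' oV' eV] := @zopen_sub k _ _ (fun (i : 'I_n) (x : 'I_n -> k) => x i) A V oV.
pose C := A `&` (U' `\` V').
have lcC : @locally_closed k (affine_space k n) C.
  by apply: lcI => //; exists U', V'.
exists n, C; split=> //.
rewrite subspace_zariski; apply: isomorphic_sym.
have -> : g @^-1` B = (fun y : {x | A x} => C (sval y)).
  rewrite e; apply/seteqP; split=> [[y Ay]|[y Ay]] /=.
    by rewrite eU eV.
  by move=> [_]; rewrite eU eV.
by apply: (@subspace_subspace _ _ (fun (i : 'I_n) (x : 'I_n -> k) => x i)) => y [].
Qed.

Definition zprod_gen T I (T' I' : Type) (gen : I -> T -> k)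
    (gen' : I' -> T' -> k) (i : I + I') (x : T * T') : k :=
  match i with inl i => gen i x.1 | inr i => gen' i x.2 end.

Section Product.
Variables (T I T' I' : Type) (gen : I -> T -> k) (gen' : I' -> T' -> k).
Local Notation P := (zariski (zprod_gen gen gen')).

Lemma zprod_fst : @regular_map k P (zariski gen) fst.
Proof. by apply/regular_genP => i; exact: (@sec_gen k _ _ (zprod_gen gen gen') setT (inl i)). Qed.

Lemma zprod_snd : @regular_map k P (zariski gen') snd.
Proof. by apply/regular_genP => i; exact: (@sec_gen k _ _ (zprod_gen gen gen') setT (inr i)). Qed.

Lemma zprod_pair S J (genS : J -> S -> k) (f : S -> T) (g : S -> T') :
  @regular_map k (zariski genS) (zariski gen) f ->
  @regular_map k (zariski genS) (zariski gen') g ->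
  @regular_map k (zariski genS) P (fun s => (f s, g s)).
Proof.
move=> /regular_genP rf /regular_genP rg; apply/regular_genP.
by case=> i; [exact: rf|exact: rg].
Qed.

(** The structure of a prevariety is determined by its affine open subsets. *)
Lemma regular_local W Y (h : W -> Y) : prevariety W ->
  (forall U : set W, opens U -> affine (subspace U) ->
     @regular_map k (subspace U) Y (h \o sval)) -> regular_map h.
Proof.
move=> [oT oI oB rs rg [s [hs cov]]] hU.
have oh V : opens V -> opens (h @^-1` V).
  move=> oV.
  have -> : h @^-1` V = \bigcup_(W in [set W | opens W /\ W `<=` h @^-1` V]) W.
    apply/seteqP; split=> [x Vx|x [A [_ AV] Ax]]; last exact: AV.
    have [U Us Ux] := cov x; have [oU aU] := hs _ Us.
    have [[U' oU' e] _] := hU U oU aU V oV.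
    exists (U `&` U'); last first.
      split=> //; suff : (sval @^-1` U') (exist _ x Ux) by [].
      by rewrite -e.
    split; first exact: oI.
    move=> y [Uy U'y]; suff : ((h \o sval) @^-1` V) (exist _ y Uy) by [].
    by rewrite e.
  by apply: oB => A [].
move=> V oV; split; first exact: oh.
move=> g sg; apply: rg; first exact: oh.
move=> x Vx; have [U Us Ux] := cov x; have [oU aU] := hs _ Us.
have [_ sU] := hU U oU aU V oV.
have [A [g' [oA sA Ax e]]] := sU _ sg (exist _ x Ux) Vx.
have oVA := oI _ _ (oh V oV) (oI _ _ oA oU).
exists (h @^-1` V `&` (A `&` U)), g'; split=> //.
- by apply: (rs A) => // y [_ []].
- by move=> y; rewrite inE => -[Vy [Ay Uy]]; exact: (e (exist _ y Uy)).
Qed.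

Lemma regular_sval W (U : set W) : opens U -> @regular_map k (subspace U) W sval.
Proof.
move=> oU V oV; split; first by exists V.
by move=> g sg x Vx; exists V, g; split.
Qed.

(** The universal property needs only that a map into the product is regular
    when its two components are, which is local on the source. *)
Lemma zariski_product : is_product (zariski gen) (zariski gen') P.
Proof.
exists fst, snd; split; [exact: zprod_fst|exact: zprod_snd|].
move=> W f g [pW _] rf rg; exists (fun w => (f w, g w)); split; last first.
  move=> h [_ <- <-]; apply/funext => w /=; by case: (h w).
split=> //; apply: (regular_local pW) => U oU [m [A [_ [e [e' [re re' eK e'K]]]]]].
move: e e' re re' eK e'K; rewrite subspace_zariski => e e' re re' eK e'K.
have rfe := regular_comp re' (regular_comp (regular_sval oU) rf).
have rge := regular_comp re' (regular_comp (regular_sval oU) rg).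
have := regular_comp re (zprod_pair rfe rge).
by congr regular_map; apply/funext => w /=; rewrite eK.
Qed.

End Product.

Lemma zprod_iso T I (T' I' : Type) (gen : I -> T -> k) (gen' : I' -> T' -> k)
  S J (S' J' : Type) (genS : J -> S -> k) (genS' : J' -> S' -> k) :
  isomorphic (zariski gen) (zariski genS) ->
  isomorphic (zariski gen') (zariski genS') ->
  isomorphic (zariski (zprod_gen gen gen')) (zariski (zprod_gen genS genS')).
Proof.
move=> [f [g [rf rg fK gK]]] [f' [g' [rf' rg' fK' gK']]].
exists (fun x => (f x.1, f' x.2)), (fun x => (g x.1, g' x.2)); split.
- by apply: zprod_pair; [exact: (regular_comp (@zprod_fst _ _ _ _ _ _))|exact: (regular_comp (@zprod_snd _ _ _ _ _ _))].
- by apply: zprod_pair; [exact: (regular_comp (@zprod_fst _ _ _ _ _ _))|exact: (regular_comp (@zprod_snd _ _ _ _ _ _))].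
- by move=> [x y] /=; rewrite fK fK'.
- by move=> [x y] /=; rewrite gK gK'.
Qed.

Lemma quasi_affine_prod T I (T' I' : Type) (gen : I -> T -> k) (gen' : I' -> T' -> k) :
  quasi_affine (zariski gen) -> quasi_affine (zariski gen') ->
  quasi_affine (zariski (zprod_gen gen gen')).
Proof.
move=> [n [A [lcA]]]; rewrite subspace_zariski => isoA.
move=> [m [B [lcB]]]; rewrite subspace_zariski => isoB.
apply: (quasi_affine_iso (isomorphic_sym (zprod_iso isoA isoB))).
pose p (x : 'I_(n + m) -> k) : 'I_n -> k := fun i => x (lshift m i).
pose q (x : 'I_(n + m) -> k) : 'I_m -> k := fun i => x (rshift n i).
pose g := fun (i : 'I_(n + m)) (x : 'I_(n + m) -> k) => x i.
have rp : @regular_map k (affine_space k (n + m)) (affine_space k n) p.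
  by apply/regular_genP => i; exact: (@sec_gen k _ _ g setT (lshift m i)).
have rq : @regular_map k (affine_space k (n + m)) (affine_space k m) q.
  by apply/regular_genP => i; exact: (@sec_gen k _ _ g setT (rshift n i)).
pose C := p @^-1` A `&` q @^-1` B.
exists (n + m)%N, C; split.
  by apply: lcI; [exact: lc_preimage rp lcA | exact: lc_preimage rq lcB].
rewrite subspace_zariski.
pose j (x : {x | A x} * {x | B x}) : 'I_(n + m) -> k :=
  fun i => match fintype.split i with inl i => (sval x.1 : 'I_n -> k) i | inr i => (sval x.2 : 'I_m -> k) i end.
have pj x : p (j x) = sval x.1.
  by apply/funext => i; rewrite /p /j -[lshift m i]/(unsplit (inl i)) unsplitK.
have qj x : q (j x) = sval x.2.
  by apply/funext => i; rewrite /q /j -[rshift n i]/(unsplit (inr i)) unsplitK.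
have jC x : C (j x).
  by split; rewrite /= ?pj ?qj; case: x => [[x Ax] [y By]].
pose r (x : {x | C x}) : {x | A x} * {x | B x} :=
  (exist A (p (sval x)) (svalP x).1, exist B (q (sval x)) (svalP x).2).
apply: (@isomorphic_zariski _ _ _ _ _ _ (fun x => exist _ _ (jC x)) r).
- move=> i; rewrite -(splitK i); case: (fintype.split i) => i'.
    apply: (@sec_ext _ _ _ _ _ (fun x => (sval x.1 : 'I_n -> k) i')).
      by move=> x; exact: (congr1 (fun f : 'I_n -> k => f i') (pj x)).
    exact: (@sec_gen k _ _ _ _ (inl i')).
  apply: (@sec_ext _ _ _ _ _ (fun x => (sval x.2 : 'I_m -> k) i')).
    by move=> x; exact: (congr1 (fun f : 'I_m -> k => f i') (qj x)).
  exact: (@sec_gen k _ _ _ _ (inr i')).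
- case=> i; first exact: (@sec_gen k _ _ _ _ (lshift m i)).
  exact: (@sec_gen k _ _ _ _ (rshift n i)).
- move=> [[x Ax] [y By]]; rewrite /r; congr (_, _); apply: eq_exist.
    exact: (pj (exist _ x Ax, exist _ y By)).
  exact: (qj (exist _ x Ax, exist _ y By)).
- move=> [x Cx]; apply: eq_exist; apply/funext => i; rewrite /j.
  by case: splitP => i' /= e; congr x; apply: val_inj.
Qed.

End QuasiAffine.

(** * Classes in the Grothendieck ring *)

Section Grothendieck.
Variable k : closedFieldType.
Implicit Types (T I J : Type) (X Y W P : fspace k).

Lemma K0_class_variety X (Y : variety k) :
  isomorphic X Y -> K0_class X = (\pi_(K0 k) (K0_gen Y))%qT.
Proof.
move=> XY; rewrite /K0_class; case: pselect => [h|[]]; last by exists Y.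
apply/K0_piP/K0_iso; case: (cid h) => Y' /= XY'.
exact: isomorphic_trans (isomorphic_sym XY') XY.
Qed.

Lemma K0_class_iso X Y : isomorphic X Y -> K0_class X = K0_class Y.
Proof.
move=> XY; have [[V YV]|h] := pselect (exists V : variety k, isomorphic Y V).
  by rewrite (K0_class_variety YV); apply/K0_class_variety/(isomorphic_trans XY).
rewrite /K0_class; case: pselect => [[V XV]|_]; case: pselect => //.
by case: h; exists V; apply: isomorphic_trans XV; apply: isomorphic_sym.
Qed.

(** The defining relation of the ring, transported from varieties to
    quasi-affine Zariski spaces. *)
Lemma K0_class_scissor T I (gen : I -> T -> k) (A : set T) :
  quasi_affine (zariski gen) -> @zclosed k (zariski gen) A ->
  K0_class (zariski gen) =
    K0_class (@subspace k (zariski gen) A) +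
    K0_class (@subspace k (zariski gen) (~` A)).
Proof.
move=> qX clA; have [Y XY] := quasi_affine_variety qX.
have [Z AZ] := quasi_affine_variety (quasi_affine_sub qX (lc_closed clA)).
have [U CU] := quasi_affine_variety (quasi_affine_sub qX (lc_open clA)).
rewrite (K0_class_variety XY) (K0_class_variety AZ) (K0_class_variety CU).
have [f [g [rf rg fK gK]]] := XY.
rewrite -[RHS]/(K0a _ _) K0aE; apply/K0_piP/(@K0_scissor _ Y Z U (g @^-1` A)).
- by have [] := rg _ clA.
- apply: isomorphic_trans (isomorphic_sym AZ) _.
  exact: (@isomorphic_subspace k _ _ f g A rf rg fK gK).
- apply: isomorphic_trans (isomorphic_sym CU) _.
  exact: (@isomorphic_subspace k _ _ f g (~` A) rf rg fK gK).
Qed.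

Lemma is_product_iso X Y P (X' Y' P' : fspace k) :
  isomorphic X X' -> isomorphic Y Y' -> isomorphic P P' ->
  is_product X Y P -> is_product X' Y' P'.
Proof.
move=> [f [f' [rf rf' fK f'K]]] [g [g' [rg rg' gK g'K]]] [h [h' [rh rh' hK h'K]]].
move=> [p [q [rp rq univ]]].
exists (f \o (p \o h')), (g \o (q \o h')); split.
- exact: regular_comp (regular_comp rh' rp) rf.
- exact: regular_comp (regular_comp rh' rq) rg.
move=> W a b vW ra rb.
have [u [[ru pu qu] uniq_u]] := univ W (f' \o a) (g' \o b) vW (regular_comp ra rf') (regular_comp rb rg').
exists (h \o u); split.
  split; first exact: regular_comp ru rh.
    apply/funext => w /=; rewrite hK.
    by have /(congr1 (fun z => z w)) /= -> := pu; rewrite f'K.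
  apply/funext => w /=; rewrite hK.
  by have /(congr1 (fun z => z w)) /= -> := qu; rewrite g'K.
move=> v [rv pv qv]; rewrite (uniq_u (h' \o v)).
  by apply/funext => w /=; rewrite h'K.
split; first exact: regular_comp rv rh'.
  by apply/funext => w /=; rewrite -pv /= fK.
by apply/funext => w /=; rewrite -qv /= gK.
Qed.

Lemma K0_class_prod T I (T' I' : Type) (gen : I -> T -> k) (gen' : I' -> T' -> k) :
  quasi_affine (zariski gen) -> quasi_affine (zariski gen') ->
  K0_class (zariski (zprod_gen gen gen')) =
    K0_class (zariski gen) * K0_class (zariski gen').
Proof.
move=> qX qY; have [X iX] := quasi_affine_variety qX.
have [Y iY] := quasi_affine_variety qY.
have [P iP] := quasi_affine_variety (quasi_affine_prod qX qY).
rewrite (K0_class_variety iX) (K0_class_variety iY) (K0_class_variety iP).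
rewrite -[RHS]/(K0m _ _) K0mE; apply/K0_piP/K0_prod.
exact: is_product_iso iX iY iP (zariski_product gen gen').
Qed.

Lemma affine_space_quasi_affine n : quasi_affine (affine_space k n).
Proof.
exists n, setT; split; first exact: lcT.
rewrite subspace_zariski.
pose f (x : 'I_n -> k) : {x : 'I_n -> k | [set: 'I_n -> k] x} := exist _ x I.
apply: (@isomorphic_zariski _ _ _ _ _ _ _ f sval).
- by move=> i; exact: (@sec_gen k _ _ _ _ i).
- by move=> i; exact: (@sec_gen k _ _ _ _ i).
- by [].
- by move=> [x []].
Qed.

Definition torus n := {x : 'I_n -> k | forall i, x i != 0}.
Definition torus_gen n (i : 'I_n) (x : torus n) : k := sval x i.

Lemma torusE n : @subspace k (affine_space k n) [set x | forall i, x i != 0] =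
  zariski (@torus_gen n).
Proof. exact: subspace_zariski. Qed.

(** It is the locus where the product of the coordinates does not vanish. *)
Lemma torus_quasi_affine n : quasi_affine (zariski (@torus_gen n)).
Proof.
rewrite -torusE; apply: quasi_affine_sub; first exact: affine_space_quasi_affine.
apply: lc_open.
rewrite (_ : [set x | _] = [set x | \prod_(i < n) x i != 0]).
  by apply: zopen_nz; apply: polyfun_prod => i _; exact: (PolyGen (fun i (x : 'I_n -> k) => x i)).
apply/seteqP; split=> x /=; first by move=> h; apply/prodf_neq0 => i _; exact: h.
by move=> /prodf_neq0 h i; apply: h.
Qed.

Lemma zariski_prod_point T I (gen : I -> T -> k) :
  isomorphic (zariski (zprod_gen (@torus_gen 0) gen)) (zariski gen).
Proof.
have h (i : 'I_0) : (fun=> 0 : k) i != 0 by case: i.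
apply: (@isomorphic_zariski _ _ _ _ _ _ _ snd (fun x => (exist _ (fun=> 0) h : torus 0, x))).
- by move=> i; exact: (@sec_gen k _ _ _ _ (inr i)).
- by case=> i; [case: i | exact: (@sec_gen k _ _ _ _ i)].
- move=> [[x hx] y] /=; congr (_, _); apply: eq_exist.
  by apply/funext => -[].
- by [].
Qed.

(** The torus of dimension zero serves as the point.  Its class need not be the
    unit of the ring, but acts as [1] on classes of spaces. *)
Definition point_class : K0 k := K0_class (zariski (@torus_gen 0)).

Lemma point_class_mul T I (gen : I -> T -> k) : quasi_affine (zariski gen) ->
  point_class * K0_class (zariski gen) = K0_class (zariski gen).
Proof.
move=> qX; rewrite -K0_class_prod //; last exact: torus_quasi_affine.
exact/K0_class_iso/(zariski_prod_point gen).
Qed.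

(** The affine line is the torus of dimension one and the origin. *)
Lemma torus1_class : K0_class (zariski (@torus_gen 1)) = Lefschetz - point_class.
Proof.
apply/eqP; rewrite eq_sym subr_eq; apply/eqP.
have cl : @zclosed k (affine_space k 1) [set x | x ord0 = 0].
  apply: (@zclosed_eq0 _ _ _ _ (fun x => x ord0)).
  exact: (PolyGen (fun i (x : 'I_1 -> k) => x i)).
rewrite /Lefschetz (K0_class_scissor (affine_space_quasi_affine 1) cl) addrC.
congr (_ + _).
  rewrite -torusE; congr (K0_class (subspace _)); apply/seteqP; split=> x /=.
    by move=> nz i; rewrite (ord1 i); apply/eqP.
  by move=> nz; apply/eqP.
rewrite subspace_zariski; apply: K0_class_iso.
have h (i : 'I_0) : (fun=> 0 : k) i != 0 by case: i.
apply: (@isomorphic_zariski _ _ _ _ _ _ _ (fun=> exist _ (fun=> 0) h : torus 0)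
   (fun=> exist (fun x : 'I_1 -> k => x ord0 = 0) (fun=> 0) erefl)).
- by case.
- by move=> i; exact: sec_cst.
- by move=> [x e]; apply: eq_exist; apply/funext => i; rewrite (ord1 i).
- by move=> [x e]; apply: eq_exist; apply/funext => -[].
Qed.

Lemma torus_prodS n T I (gen : I -> T -> k) :
  isomorphic (zariski (zprod_gen (@torus_gen n.+1) gen))
    (zariski (zprod_gen (@torus_gen 1) (zprod_gen (@torus_gen n) gen))).
Proof.
have h1 (x : torus n.+1) (i : 'I_1) : (fun i : 'I_1 => sval x ord0) i != 0.
  by case: x => x h; apply: h.
have h2 (x : torus n.+1) (i : 'I_n) : (fun i => sval x (lift ord0 i)) i != 0.
  by case: x => x h; apply: h.
pose j (x : torus 1) (y : torus n) (i : 'I_n.+1) : k :=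
  if unlift ord0 i is Some i' then sval y i' else sval x ord0.
have h3 x y i : j x y i != 0.
  rewrite /j; case: unlift => [i'|]; [case: y => y h|case: x => x h]; exact: h.
pose f (z : torus n.+1 * T) : torus 1 * (torus n * T) :=
  (exist _ _ (h1 z.1), (exist _ _ (h2 z.1), z.2)).
pose g (z : torus 1 * (torus n * T)) : torus n.+1 * T :=
  (exist _ _ (h3 z.1 z.2.1), z.2.2).
apply: (@isomorphic_zariski _ _ _ _ _ _ _ f g).
- case=> [i|[i|i]].
  + exact: (@sec_gen k _ _ _ _ (inl ord0)).
  + exact: (@sec_gen k _ _ _ _ (inl (lift ord0 i))).
  + exact: (@sec_gen k _ _ _ _ (inr i)).
- case=> i; last exact: (@sec_gen k _ _ _ _ (inr (inr i))).
  have [i' ->|->] := unliftP ord0 i.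
    apply: (@sec_ext _ _ _ _ _ (fun z => sval z.2.1 i')).
      by move=> z; rewrite /= /torus_gen /= /j liftK.
    exact: (@sec_gen k _ _ _ _ (inr (inl i'))).
  apply: (@sec_ext _ _ _ _ _ (fun z => sval z.1 ord0)).
    by move=> z; rewrite /= /torus_gen /= /j unlift_none.
  exact: (@sec_gen k _ _ _ _ (inl ord0)).
- move=> [[x hx] t]; congr (_, _); apply: eq_exist; apply/funext => i.
  by have [i' ->|->] := unliftP ord0 i; rewrite /j /= ?liftK ?unlift_none.
- move=> [[x hx] [[y hy] t]]; congr (_, (_, _)); apply: eq_exist; apply/funext => i.
    by rewrite [LHS]/= /j unlift_none (ord1 i).
  by rewrite [LHS]/= /j liftK.
Qed.

(** Induction on the dimension; the point class left over from [torus1_class]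
    is absorbed by [point_class_mul]. *)
Lemma torus_prod_class n T I (gen : I -> T -> k) : quasi_affine (zariski gen) ->
  K0_class (zariski (zprod_gen (@torus_gen n) gen)) =
    (Lefschetz - 1) ^+ n * K0_class (zariski gen).
Proof.
move=> qX; elim: n => [|n IH].
  by rewrite expr0 mul1r; exact/K0_class_iso/(zariski_prod_point gen).
have qn : quasi_affine (zariski (zprod_gen (@torus_gen n) gen)).
  by apply: quasi_affine_prod => //; exact: torus_quasi_affine.
rewrite (K0_class_iso (torus_prodS n gen)) K0_class_prod //; last exact: torus_quasi_affine.
by rewrite torus1_class exprS -mulrA -IH !mulrBl point_class_mul // mul1r.
Qed.

Section Additivity.
Variables (T I : Type) (gen : I -> T -> k).
Local Notation X := (zariski gen).
Local Notation lc := (@locally_closed k X).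
Hypothesis qX : quasi_affine X.

Definition subset_class (B : set T) : K0 k := K0_class (@subspace k X B).

Lemma subset_class_split (B U : set T) : lc B -> @opens k X U ->
  subset_class B = subset_class (B `&` U) + subset_class (B `\` U).
Proof.
move=> lcB oU; have qB := quasi_affine_sub qX lcB.
rewrite /subset_class; move: qB; rewrite subspace_zariski => qB.
have cl : @zclosed k (zariski (fun i (x : {x | B x}) => gen i (sval x)))
    [set x | ~ U (sval x)].
  rewrite /zclosed (_ : ~` _ = [set x | U (sval x)]); last first.
    by apply/seteqP; split=> x /= ; rewrite not_notE.
  apply/zopenP => x Ux; have /zopenP /(_ _ Ux) [p [hp px hy]] := oU.
  exists (p \o sval); split=> //; last by move=> y /hy.
  exact: (@polyfun_comp _ _ _ _ gen sval).
rewrite (K0_class_scissor qB cl) addrC; congr (_ + _); apply: K0_class_iso; apply: isomorphic_sym.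
  rewrite [X in isomorphic _ X]subspace_zariski.
  have -> : ~` [set x : {x | B x} | ~ U (sval x)] = (fun x => (B `&` U) (sval x)).
    apply/seteqP; split=> -[x Bx] /=; rewrite not_notE //.
    by case.
  by apply: subspace_subspace => x [].
rewrite [X in isomorphic _ X]subspace_zariski.
have -> : [set x : {x | B x} | ~ U (sval x)] = (fun x => (B `\` U) (sval x)).
  apply/seteqP; split=> -[x Bx] //=.
  by case.
by apply: subspace_subspace => x [].
Qed.

Lemma subset_class0 : subset_class set0 = 0.
Proof.
have /eqP := subset_class_split (lc0 gen) (zopen0 gen).
by rewrite set0I setD0 -subr_eq subrr eq_sym => /eqP.
Qed.

Lemma lcD (B U : set T) : lc B -> @opens k X U -> lc (B `\` U).
Proof.
move=> lcB oU; rewrite setDE; apply: lcI => //; apply: lc_closed.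
by rewrite /zclosed setCK.
Qed.

(** Additivity over a finite partition, by induction on the number of parts.
    The first part is a difference of open sets [U] and [V], and its complement
    is cut into the two locally closed sets inside [U `&` V] and outside [U]. *)
Lemma subset_class_partition (J : eqType) (r : seq J) (F : J -> set T) (B : set T) :
  uniq r -> lc B -> (forall j, j \in r -> lc (F j)) ->
  (forall i j, i \in r -> j \in r -> i != j -> F i `&` F j = set0) ->
  (forall x, B x -> exists2 j, j \in r & F j x) ->
  subset_class B = \sum_(j <- r) subset_class (B `&` F j).
Proof.
elim: r B => [|j r IH] B /=.
  move=> _ _ _ _ h; rewrite big_nil (_ : B = set0) ?subset_class0 //.
  by apply/seteqP; split=> // x /h [].
move=> /andP[jr ur] lcB lcF dF cov; rewrite big_cons.
have [U [V [oU oV FUV]]] := lcF j (mem_head _ _).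
have split3 C : lc C -> subset_class C = subset_class (C `&` F j) + (subset_class (C `&` U `&` V) + subset_class (C `\` U)).
  move=> lcC; rewrite (subset_class_split lcC oU) (subset_class_split (lcI lcC (lc_open oU)) oV).
  by rewrite FUV setIDA [RHS]addrCA addrA.
have mr i : i \in r -> i \in j :: r by rewrite inE orbC => ->.
have lcF' i : i \in r -> lc (F i) by move=> /mr; apply: lcF.
have dF' i i' : i \in r -> i' \in r -> i != i' -> F i `&` F i' = set0.
  by move=> /mr ? /mr; apply: dF.
have cov' C : C `<=` B -> C `&` F j = set0 -> forall x, C x -> exists2 j, j \in r & F j x.
  move=> CB CF x Cx; have [j0] := cov x (CB _ Cx).
  rewrite inE => /predU1P[->|ir] Fx; last by exists j0.
  by have : set0 x by rewrite -CF.
rewrite (split3 B lcB); congr (_ + _).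
have lc1 : lc (B `&` U `&` V) by apply: lcI; [apply: lcI => //|]; exact: lc_open.
have lc2 : lc (B `\` U) by exact: lcD.
rewrite (IH (B `&` U `&` V)) //; last first.
  apply: cov'; first by move=> x [[]].
  by rewrite FUV; apply/seteqP; split=> // x [[[_ _] Vx] [_]].
rewrite (IH (B `\` U)) //; last first.
  apply: cov'; first by move=> x [].
  by rewrite FUV; apply/seteqP; split=> // x [[_ nU] []].
rewrite -big_split /= big_seq [RHS]big_seq; apply: eq_bigr => i ir.
rewrite [RHS]split3; last by apply: lcI => //; exact: lcF'.
have ij : i != j by apply: contraNneq jr => <-.
have -> : B `&` F i `&` F j = set0.
  by rewrite -setIA dF ?setI0 ?mem_head //; exact: mr.
rewrite subset_class0 add0r; congr (subset_class _ + subset_class _).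
  by rewrite setIAC (setIAC B U).
by rewrite !setDE setIAC.
Qed.

(** Two stratifications give the same sum, as both agree with the sum over
    their common refinement. *)
Lemma constructible_classE (s : seq (set T)) (A : set T) :
  @stratification k X A s ->
  @constructible_class k X A = \sum_(B <- s) subset_class B.
Proof.
move=> strs; rewrite /constructible_class; case: xgetP => [a _ [t strt ->]|]; last first.
  by move=> /(_ (\sum_(B <- s) subset_class B)); case; exists s.
have [us ls ds As] := strs; have [ut lt dt At] := strt.
have E (s1 s2 : seq (set T)) : @stratification k X A s1 -> @stratification k X A s2 ->
   \sum_(B <- s1) subset_class B = \sum_(B <- s1) \sum_(C <- s2) subset_class (B `&` C).
  move=> [u1 l1 d1 A1] [u2 l2 d2 A2].
  rewrite big_seq [RHS]big_seq; apply: eq_bigr => B Bs.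
  apply: (@subset_class_partition _ s2 id) => //; first exact: l1.
    by move=> i j h1 h2 /eqP; apply: d2.
  move=> x Bx; have : A x by rewrite A1; exists B.
  by rewrite A2.
rewrite -!/(subset_class _) (E t s) // (E s t) // exchange_big /=.
by apply: eq_bigr => B _; apply: eq_bigr => C _; rewrite setIC.
Qed.

(** A version for indexed families, in which empty members may be repeated;
    a [stratification] is a list without repetition. *)
Lemma constructible_class_fam (J : eqType) (r : seq J) (F : J -> set T) (A : set T) :
  uniq r -> (forall j, j \in r -> lc (F j)) ->
  (forall i j, i \in r -> j \in r -> i != j -> F i `&` F j = set0) ->
  A = [set x | exists2 j, j \in r & F j x] ->
  @constructible_class k X A = \sum_(j <- r) subset_class (F j).
Proof.
move=> ur lF dF AE.
have inj : {in [seq j <- r | F j != set0] &, injective F}.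
  move=> i j; rewrite !mem_filter => /andP[ni ir] /andP[nj jr] e.
  apply/eqP; apply: contraT => ij; have := dF _ _ ir jr ij.
  by rewrite e setIid => /eqP; rewrite (negPf nj).
(* Distinct indices give distinct sets once the empty ones are removed. *)
rewrite (@constructible_classE [seq F j | j <- r & F j != set0]).
  rewrite big_map big_filter [RHS](bigID (fun j => F j != set0)) /=.
  rewrite [X in _ = _ + X]big1 ?addr0 // => j /negbNE /eqP ->.
  exact: subset_class0.
split.
- by rewrite map_inj_in_uniq // filter_uniq.
- by move=> B /mapP[j]; rewrite mem_filter => /andP[_ /lF ?] ->.
- move=> B C /mapP[i0]; rewrite mem_filter => /andP[_ ir] -> /mapP[j].
  rewrite mem_filter => /andP[_ jr] -> ne; apply: dF => //.
  by apply: contra_notN ne => /eqP ->.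
- rewrite AE; apply/seteqP; split=> x /=.
    move=> [j jr Fx]; exists (F j) => //; apply/mapP; exists j => //.
    rewrite mem_filter jr andbT; apply/eqP => e.
    by have : set0 x by rewrite -e.
  by move=> [B /mapP[j]]; rewrite mem_filter => /andP[_ jr] -> Fx; exists j.
Qed.

End Additivity.
End Grothendieck.

(** * Characters of a semigroup, power series and truncated series *)

Section MonoidAlgebraLift.
Variables (R : comNzRingType) (L : nmodType) (B : comAlgType R).
Local Notation RL := (monoid_algebra R L).

Definition monhom (chi : L -> B) :=
  chi 0 = 1 /\ forall u v, chi (u + v) = chi u * chi v.

(** The universal property of the semigroup algebra. *)
Definition ma_lift (chi : L -> B) (h : monhom chi) (f : RL) : B :=
  \sum_(u <- msupp f) mcoeff u f *: chi u.

Section Lift.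
Variables (chi : L -> B) (h : monhom chi).
Local Notation F := (ma_lift h).

Lemma ma_liftw (d : {fset L}) f : fsubset (msupp f) d ->
  F f = \sum_(u <- d) mcoeff u f *: chi u.
Proof.
move=> le; rewrite /ma_lift (big_fset_incl _ le) //= => u _ /mcoeff_outdom ->.
by rewrite scale0r.
Qed.

Fact ma_lift_is_linear : linear F.
Proof.
move=> a f g; pose d := fsetU (msupp f) (msupp g).
have le1 : fsubset (msupp f) d by exact: fsubsetUl.
have le2 : fsubset (msupp g) d by exact: fsubsetUr.
have le3 : fsubset (msupp (a *: f + g)) d.
  apply: (fsubset_trans (msuppD_le _ _)); apply: fsetSU; exact: msuppZ_le.
rewrite (ma_liftw le1) (ma_liftw le2) (ma_liftw le3) scaler_sumr -big_split /=.
by apply: eq_bigr => u _; rewrite mcoeffD mcoeffZ scalerDl scalerA.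
Qed.

HB.instance Definition _ := GRing.isSemilinear.Build R RL B _ F
    (GRing.semilinear_linear ma_lift_is_linear).

Lemma ma_liftU u a : F (mkmalgU u a) = a *: chi u.
Proof. by rewrite (ma_liftw msuppU_le) big_seq_fset1 mcoeffUU. Qed.

Fact ma_lift_is_monoid_morphism : monoid_morphism F.
Proof.
have [h0 hD] := h; split; first by rewrite ma_liftU h0 scale1r.
move=> f g; rewrite [in LHS]/GRing.mul /= /ma_mul raddf_sum /ma_lift mulr_suml.
apply: eq_bigr => u _; rewrite raddf_sum mulr_sumr; apply: eq_bigr => v _.
by apply: (etrans (ma_liftU _ _)); rewrite hD -scalerAl -scalerAr scalerA.
Qed.

HB.instance Definition _ := GRing.isMonoidMorphism.Build RL B F
  ma_lift_is_monoid_morphism.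

Definition ma_lrmorphism : {lrmorphism RL -> B} := F.

Lemma ma_lrmorphismE u : ma_lrmorphism (monomial R u) = chi u.
Proof. by apply: (etrans (ma_liftU _ _)); rewrite scale1r. Qed.
End Lift.

Lemma mkmalgU_monomial (u : L) (a : R) : mkmalgU u a = a *: monomial R u.
Proof. by apply/malgP => w; rewrite mcoeffZ !mcoeffU mulrnAr mulr1. Qed.

Lemma lrmorphism_monomials (f : {lrmorphism RL -> B}) (x : RL) :
  f x = \sum_(u <- msupp x) mcoeff u x *: f (monomial R u).
Proof.
rewrite {1}[x]monalgE raddf_sum /=; apply: eq_bigr => u _.
by rewrite mkmalgU_monomial linearZ.
Qed.

Lemma ma_ext (f g : {lrmorphism RL -> B}) :
  (forall u, f (monomial R u) = g (monomial R u)) -> f = g.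
Proof.
move=> e; apply: lrmorphism_eq => x; rewrite !lrmorphism_monomials.
by apply: eq_bigr => u _; rewrite e.
Qed.

Lemma monomialD u v : monomial R (u + v : L) = monomial R u * monomial R v.
Proof. by rewrite [RHS]/GRing.mul /= ma_mulUU mulr1. Qed.

Lemma lrmorphism_monhom (f : {lrmorphism RL -> B}) : monhom (fun u => f (monomial R u)).
Proof. by split=> [|u v]; rewrite ?(rmorph1 f) // monomialD rmorphM. Qed.

Lemma monomialMn (u : L) n : monomial R (u *+ n) = monomial R u ^+ n.
Proof.
elim: n => [|n IH]; first by rewrite mulr0n expr0.
by rewrite mulrS exprS monomialD IH.
Qed.

Lemma monhomMn chi (u : L) n : monhom chi -> chi (u *+ n) = chi u ^+ n.
Proof.
move=> [h0 hD]; elim: n => [|n IH]; first by rewrite mulr0n expr0.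
by rewrite mulrS exprS hD IH.
Qed.

Lemma monhom_sum chi (I : Type) (r : seq I) (P : pred I) (F : I -> L) :
  monhom chi -> chi (\sum_(i <- r | P i) F i) = \prod_(i <- r | P i) chi (F i).
Proof. by move=> [h0 hD]; apply: big_morph. Qed.

End MonoidAlgebraLift.

Section SeriesUnits.
Variable k : fieldType.
Implicit Types x y : series k.

Lemma coefsM x y n : coefs (x * y) n = \sum_(i < n.+1) coefs x i * coefs y (n - i)%N.
Proof. by []. Qed.
Lemma coefsZ a x n : coefs (a *: x) n = a * coefs x n.
Proof. by []. Qed.
Lemma coefs1 n : coefs (1 : series k) n = (n == 0%N)%:R.
Proof. by []. Qed.

(** A list rather than a function, because each coefficient refers to all the
    previous ones. *)
Fixpoint inv_coefs x n : seq k :=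
  if n is m.+1 then let s := inv_coefs x m in
    rcons s (- (\sum_(i < m.+1) s`_i * coefs x (m.+1 - i)) / coefs x 0)
  else [:: (coefs x 0)^-1].

Lemma size_inv_coefs x n : size (inv_coefs x n) = n.+1.
Proof. by elim: n => //= n IH; rewrite size_rcons IH. Qed.

Definition series_inv x : series k := Series (fun n => (inv_coefs x n)`_n).

Lemma nth_inv_coefs x n i : (i <= n)%N -> (inv_coefs x n)`_i = coefs (series_inv x) i.
Proof.
elim: n => [|n IH]; first by rewrite leqn0 => /eqP ->.
rewrite leq_eqVlt => /predU1P[->//|]; rewrite ltnS => le_in.
by rewrite /= nth_rcons size_inv_coefs ltnS le_in IH.
Qed.

Lemma series_invS x n : coefs (series_inv x) n.+1 =
  - (\sum_(i < n.+1) coefs (series_inv x) i * coefs x (n.+1 - i)) / coefs x 0.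
Proof.
rewrite [LHS]/= nth_rcons size_inv_coefs ltnn eqxx; congr (- _ / _).
by apply: eq_bigr => i _; rewrite nth_inv_coefs // -ltnS.
Qed.

Definition series_unit : pred (series k) := fun x => coefs x 0 != 0.
Definition series_inverse x := if series_unit x then series_inv x else x.

Fact series_mulVr : {in series_unit, left_inverse 1 series_inverse *%R}.
Proof.
move=> x ux; have {}ux : series_unit x := ux; rewrite /series_inverse ux; apply: seriesP => -[|n].
  by rewrite coefsM big_ord_recl big_ord0 addr0 /= mulVf.
rewrite coefsM big_ord_recr [ord_max : nat]/= series_invS subnn divfK //.
by rewrite coefs1 /= addrN.
Qed.
Fact series_unitPl x y : y * x = 1 -> series_unit x.
Proof.
move/(congr1 (fun z => coefs z 0%N)); rewrite coefsM big_ord_recl big_ord0 addr0.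
rewrite coefs1 /= => e; apply/eqP => x0; move/eqP: e.
by rewrite x0 mulr0 eq_sym oner_eq0.
Qed.
Fact series_inv_out : {in [predC series_unit], series_inverse =1 id}.
Proof. move=> x ux; have {}ux : ~~ series_unit x := ux; by rewrite /series_inverse (negPf ux). Qed.

HB.instance Definition _ := GRing.ComNzRing_hasMulInverse.Build (series k)
  series_mulVr series_unitPl series_inv_out.

Lemma series_unitE x : (x \is a GRing.unit) = (coefs x 0 != 0).
Proof. by []. Qed.

End SeriesUnits.

Section ResidueRings.
Variable k : closedFieldType.

Definition series_ev (x : series k) : k := coefs x 0.
Fact series_ev_zmod : zmod_morphism series_ev.
Proof. by []. Qed.
Fact series_ev_mon : monoid_morphism series_ev.
Proof. by split=> // x y; rewrite /series_ev coefsM big_ord_recl big_ord0 addr0. Qed.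
HB.instance Definition _ := GRing.isZmodMorphism.Build (series k) k series_ev series_ev_zmod.
HB.instance Definition _ := GRing.isMonoidMorphism.Build (series k) k series_ev series_ev_mon.

Variable m : nat.
Local Notation J := (jet_ring k m).
Implicit Types x y : J.

Definition jcoef (x : J) (i : nat) : k := (x : {poly k})`_i.

Lemma size_jet x : (size (x : {poly k}) <= m.+1)%N.
Proof. by apply: (leq_trans (size_npoly x)); rewrite mk_monic_Xn size_polyXn. Qed.

Lemma jcoef_truncate (x : series k) i : (i <= m)%N -> jcoef (truncate m x) i = coefs x i.
Proof.
move=> im; rewrite /jcoef /truncate in_qpoly_small ?coef_poly ?ltnS ?im //.
by rewrite mk_monic_Xn size_polyXn ltnS size_poly.
Qed.

Lemma jet_eqP x y : (forall i, (i <= m)%N -> jcoef x i = jcoef y i) <-> x = y.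
Proof.
split=> [e|-> //]; apply: val_inj; apply/polyP => i /=.
have [im|mi] := leqP i m; first exact: e.
by rewrite !nth_default // (leq_trans (size_jet _)).
Qed.

Definition jet_lift (x : J) : series k := Series (jcoef x).

Lemma jet_liftK : cancel jet_lift (truncate m).
Proof. by move=> x; apply/jet_eqP => i im; rewrite jcoef_truncate. Qed.

Lemma truncate_eqP (x y : series k) : truncate m x = truncate m y <->
  forall i, (i <= m)%N -> coefs x i = coefs y i.
Proof.
split=> [e i im|e]; first by rewrite -!jcoef_truncate // e.
by apply/jet_eqP => i im; rewrite !jcoef_truncate // e.
Qed.

Lemma jcoefM x y i : (i <= m)%N ->
  jcoef (x * y) i = \sum_(j < i.+1) jcoef x j * jcoef y (i - j)%N.
Proof.
move=> im; rewrite -[x]jet_liftK -[y]jet_liftK -rmorphM jcoef_truncate // coefsM.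
by apply: eq_bigr => j _; rewrite !jet_liftK.
Qed.
Lemma jcoefD x y i : jcoef (x + y) i = jcoef x i + jcoef y i.
Proof. by rewrite /jcoef poly_of_qpolyD coefD. Qed.
Lemma jcoefZ a x i : jcoef (a *: x) i = a * jcoef x i.
Proof. by rewrite /jcoef poly_of_qpolyZ coefZ. Qed.
Lemma jcoef1 i : jcoef (1 : J) i = (i == 0%N)%:R.
Proof. by rewrite /jcoef -[(1 : J) : {poly k}]/(1%:P) coefC; case: eqP. Qed.

Definition jet_ev (x : J) : k := jcoef x 0.
Fact jet_ev_zmod : zmod_morphism jet_ev.
Proof. by move=> x y; rewrite /jet_ev jcoefD -scaleN1r jcoefZ mulN1r. Qed.
Fact jet_ev_mon : monoid_morphism jet_ev.
Proof.
split=> [|x y]; first by rewrite /jet_ev jcoef1.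
by rewrite /jet_ev jcoefM // big_ord_recl big_ord0 addr0.
Qed.
HB.instance Definition _ := GRing.isZmodMorphism.Build J k jet_ev jet_ev_zmod.
HB.instance Definition _ := GRing.isMonoidMorphism.Build J k jet_ev jet_ev_mon.

(** A truncated series is the truncation of a series with the same constant
    term, whose inverse may be truncated. *)
Lemma jet_ev_unit x : jet_ev x != 0 -> x \is a GRing.unit.
Proof.
move=> nz; rewrite -[x]jet_liftK; apply: rmorph_unit.
by rewrite series_unitE.
Qed.

Lemma jet_ev_truncate (x : series k) : jet_ev (truncate m x) = series_ev x.
Proof. exact: jcoef_truncate. Qed.

End ResidueRings.

(** * Jet spaces of affine toric varieties *)

(** Families of series or truncated series depending on a parameter, all of
    whose coefficients lie in a class [P] of functions.  The class is abstract
    because polynomial functions and regular functions are both needed. *)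
Section SeriesFunctions.
Variables (k : closedFieldType) (T : Type) (P : (T -> k) -> Prop).
Hypothesis P_ext : forall g f : T -> k, f =1 g -> P g -> P f.
Hypothesis P_cst : forall c, P (fun=> c).
Hypothesis P_add : forall f g, P f -> P g -> P (fun t => f t + g t).
Hypothesis P_mul : forall f g, P f -> P g -> P (fun t => f t * g t).

Definition sfun (F : T -> series k) := forall i, P (fun t => coefs (F t) i).

Lemma closed_sum (J : Type) (r : seq J) (F : J -> T -> k) : (forall j, P (F j)) ->
  P (fun t => \sum_(j <- r) F j t).
Proof.
move=> hF; elim: r => [|j r IH].
  by apply: (P_ext _ (P_cst 0)) => t; rewrite big_nil.
by apply: (P_ext _ (P_add (hF j) IH)) => t; rewrite big_cons.
Qed.

Lemma sfun_cst c : sfun (fun=> c). Proof. by move=> i; apply: P_cst. Qed.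

Lemma sfun_mul F G : sfun F -> sfun G -> sfun (fun t => F t * G t).
Proof.
move=> hF hG i; apply: (P_ext (g := fun t => \sum_(j <- index_enum 'I_i.+1)
   coefs (F t) j * coefs (G t) (i - j))) => //.
by apply: closed_sum => j; apply: P_mul.
Qed.

Lemma sfun_exp F n : sfun F -> sfun (fun t => F t ^+ n).
Proof.
move=> hF; elim: n => [|n IH]; first exact: sfun_cst.
move=> i; apply: (P_ext _ (sfun_mul hF IH i)) => t; by rewrite exprS.
Qed.

Lemma sfun_prod (J : Type) (r : seq J) (F : J -> T -> series k) :
  (forall j, sfun (F j)) -> sfun (fun t => \prod_(j <- r) F j t).
Proof.
move=> hF; elim: r => [|j r IH] i.
  by apply: (P_ext _ (sfun_cst 1 i)) => t; rewrite big_nil.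
by apply: (P_ext _ (sfun_mul (hF j) IH i)) => t; rewrite big_cons.
Qed.

Lemma sfun_shift F a : sfun F -> sfun (fun t => Series (fun j => coefs (F t) (j + a))).
Proof. by move=> hF i; apply: hF. Qed.

(** The recursion for the coefficients of the inverse only divides by the
    constant coefficient. *)
Lemma sfun_inv F : (forall f, P f -> (forall t, f t != 0) -> P (fun t => (f t)^-1)) ->
  sfun F -> (forall t, coefs (F t) 0 != 0) -> sfun (fun t => (F t)^-1).
Proof.
move=> P_inv hF nz i.
have invE t : (F t)^-1 = series_inv (F t).
  by rewrite {1}/GRing.inv /= /series_inverse /series_unit nz.
have h0 : P (fun t => (coefs (F t) 0)^-1) by apply: P_inv.
have h n : forall j, (j <= n)%N -> P (fun t => coefs (series_inv (F t)) j).
  elim: n => [j|n IH j]; first by rewrite leqn0 => /eqP ->.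
  rewrite leq_eqVlt => /predU1P[->|]; last exact: IH.
  apply: (P_ext (g := fun t => (-1 * (\sum_(i <- index_enum 'I_n.+1)
     coefs (series_inv (F t)) i * coefs (F t) (n.+1 - i))) * (coefs (F t) 0)^-1)).
    by move=> t; rewrite series_invS mulN1r.
  apply: (P_mul _ h0); apply: (P_mul (P_cst _)); apply: closed_sum => l.
  by apply: P_mul => //; apply: IH; rewrite -ltnS.
by apply: (P_ext _ (h i i (leqnn i))) => t; rewrite invE.
Qed.

Variable m : nat.
Definition jfun (F : T -> jet_ring k m) := forall i, (i <= m)%N -> P (fun t => jcoef (F t) i).

Lemma jfun_sfun F : jfun F <-> sfun (fun t => jet_lift (F t)).
Proof.
split=> h i; last by move=> _; exact: h.
have [im|mi] := leqP i m; first exact: h.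
apply: (P_ext _ (P_cst 0)) => t /=.
by rewrite /jcoef nth_default // (leq_trans (size_jet _)).
Qed.

Lemma sfun_jfun F : sfun F -> jfun (fun t => truncate m (F t)).
Proof. by move=> h i im; apply: (P_ext _ (h i)) => t; rewrite jcoef_truncate. Qed.

Lemma jfun_ext F G : F =1 G -> jfun G -> jfun F.
Proof. by move=> e h i im; apply: (P_ext _ (h i im)) => t; rewrite e. Qed.

Lemma jfun_cst c : jfun (fun=> c).
Proof. by move=> i _; apply: P_cst. Qed.

Lemma jfun_add F G : jfun F -> jfun G -> jfun (fun t => F t + G t).
Proof.
move=> hF hG i im; apply: (P_ext _ (P_add (hF i im) (hG i im))) => t.
exact: jcoefD.
Qed.

Lemma jfun_scale f F : P f -> jfun F -> jfun (fun t => f t *: F t).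
Proof.
move=> hF hG i im; apply: (P_ext _ (P_mul hF (hG i im))) => t; exact: jcoefZ.
Qed.

Lemma jfun_mul F G : jfun F -> jfun G -> jfun (fun t => F t * G t).
Proof.
move=> /jfun_sfun hF /jfun_sfun hG.
apply: (jfun_ext _ (sfun_jfun (sfun_mul hF hG))) => t.
by rewrite (rmorphM (truncate m)) /= !jet_liftK.
Qed.

Lemma jfun_exp F n : jfun F -> jfun (fun t => F t ^+ n).
Proof.
move=> /jfun_sfun hF; apply: (jfun_ext _ (sfun_jfun (sfun_exp n hF))) => t.
by rewrite (rmorphXn (truncate m)) /= jet_liftK.
Qed.

Lemma jfun_prod (J : Type) (r : seq J) (F : J -> T -> jet_ring k m) :
  (forall j, jfun (F j)) -> jfun (fun t => \prod_(j <- r) F j t).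
Proof.
move=> hF; elim: r => [|j r IH].
  by apply: (jfun_ext _ (jfun_cst 1)) => t; rewrite big_nil.
by apply: (jfun_ext _ (jfun_mul (hF j) IH)) => t; rewrite big_cons.
Qed.

Lemma jfun_inv F : (forall f, P f -> (forall t, f t != 0) -> P (fun t => (f t)^-1)) ->
  jfun F -> (forall t, jet_ev (F t) != 0) -> jfun (fun t => (F t)^-1).
Proof.
move=> P_inv /jfun_sfun hF nz.
apply: (jfun_ext _ (sfun_jfun (sfun_inv P_inv hF nz))) => t.
by rewrite -{1}[F t]jet_liftK rmorphV // series_unitE; apply: nz.
Qed.

(** Exponents in [int] occur because a character is evaluated on lattice
    coordinates. *)
Lemma jfun_exprz F (z : int) : (forall f, P f -> (forall t, f t != 0) -> P (fun t => (f t)^-1)) ->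
  jfun F -> (forall t, jet_ev (F t) != 0) -> jfun (fun t => F t ^ z).
Proof.
move=> P_inv hF nz; case: z => n; first exact: jfun_exp.
apply: (jfun_ext (G := fun t => (F t ^+ n.+1)^-1)) => //.
apply: jfun_inv => //; first exact: jfun_exp.
by move=> t; rewrite (rmorphXn (@jet_ev k m)) expf_neq0 ?nz.
Qed.

End SeriesFunctions.

Section JetSpace.
Variables (k : closedFieldType) (L : nmodType) (N : nat) (lam : 'I_N -> L).
Hypothesis lam_gen : forall u, exists c : 'I_N -> nat, u = \sum_i lam i *+ c i.
Local Notation A := (monoid_algebra k L).
Variable m : nat.
Local Notation J := (jet_ring k m).
Local Notation X := (jet_space A m).
Local Notation mon := (monomial k).

Definition jet_gen (ai : A * 'I_m.+1) (phi : jet A m) : k := (phi ai.1 : {poly k})`_(ai.2).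

Lemma monhom_lam (B : comAlgType k) (f : L -> B) (c : 'I_N -> nat) : monhom f ->
  f (\sum_i lam i *+ c i) = \prod_i f (lam i) ^+ c i.
Proof.
by move=> h; rewrite (monhom_sum _ _ _ h); apply: eq_bigr => i _; rewrite monhomMn.
Qed.

Lemma monhom_gen_eq (B : comAlgType k) (f g : L -> B) : monhom f -> monhom g ->
  (forall i, f (lam i) = g (lam i)) -> f =1 g.
Proof.
move=> hf hg e u; have [c ->] := lam_gen u; rewrite !monhom_lam //.
by apply: eq_bigr => i _; rewrite e.
Qed.

Lemma jet_lamE (phi : jet A m) (c : 'I_N -> nat) :
  phi (mon (\sum_i lam i *+ c i)) = \prod_i phi (mon (lam i)) ^+ c i.
Proof. exact: (monhom_lam c (lrmorphism_monhom phi)). Qed.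

Lemma jet_ext (phi psi : jet A m) :
  (forall i, phi (mon (lam i)) = psi (mon (lam i))) -> phi = psi.
Proof.
move=> e; apply: ma_ext => u.
exact: (monhom_gen_eq (lrmorphism_monhom phi) (lrmorphism_monhom psi) e).
Qed.

Lemma jet_poly (a : A) i : (i <= m)%N -> polyfun jet_gen (fun phi => jcoef (phi a) i).
Proof.
by move=> im; rewrite -ltnS in im; exact: (PolyGen jet_gen (a, Ordinal im)).
Qed.

Lemma jfun_jet (a : A) : jfun (polyfun jet_gen) (fun phi : jet A m => phi a).
Proof. by move=> i im; apply: jet_poly. Qed.

Let K := #|{: 'I_N * 'I_m.+1}|.
Let coord (phi : jet A m) (q : 'I_K) : k :=
  jcoef (phi (mon (lam (enum_val q).1))) (enum_val q).2.
Let tup (y : 'I_K -> k) (i : 'I_N) : J :=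
  truncate m (Series (fun j => y (enum_rank (i, inord j)))).

Let tup_coef y i j (jm : (j <= m)%N) : jcoef (tup y i) j = y (enum_rank (i, inord j)).
Proof. exact: jcoef_truncate. Qed.

Let tup_coord phi i : tup (coord phi) i = phi (mon (lam i)).
Proof. by apply/jet_eqP => j jm; rewrite tup_coef // /coord enum_rankK /= inordK. Qed.

(** A jet is determined by its values on the generators [lam i], i.e. by
    finitely many coefficients.  A tuple of coefficients comes from a jet when
    it satisfies the relation attached to each pair of exponent vectors with
    the same sum in the semigroup, so that the image is closed. *)
Lemma jet_space_quasi_affine : quasi_affine X.
Proof.
pose g (q : 'I_K) (y : 'I_K -> k) := y q.
have htup i : jfun (polyfun g) (fun y => tup y i).
  move=> j jm; rewrite (_ : (fun _ => _) = g (enum_rank (i, inord j))).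
    exact: PolyGen.
  by apply/funext => y; rewrite tup_coef.
have pext (g0 f : ('I_K -> k) -> k) : f =1 g0 -> polyfun g g0 -> polyfun g f.
  by move=> /funext ->.
have hprod c : jfun (polyfun g) (fun y => \prod_i tup y i ^+ c i).
  by apply: jfun_prod => // [*|*|*|i]; [exact: PolyCst|exact: PolyAdd|exact: PolyMul|];
    apply: jfun_exp => //; [exact: PolyCst|exact: PolyAdd|exact: PolyMul].
pose Rel := {cc : ('I_N -> nat) * ('I_N -> nat) |
   \sum_i lam i *+ cc.1 i = \sum_i lam i *+ cc.2 i}.
pose C := [set y : 'I_K -> k | forall p : Rel * 'I_m.+1,
   jcoef (\prod_i tup y i ^+ (sval p.1).1 i) p.2 =
   jcoef (\prod_i tup y i ^+ (sval p.1).2 i) p.2].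
have clC : @zclosed k (affine_space k K) C.
  apply: (@zclosed_all _ _ _ _ (Rel * 'I_m.+1)) => p.
  by apply: zclosed_eq; apply: hprod; rewrite -ltnS.
have C_coord phi : C (coord phi).
  move=> [[[c c'] /= e] i] /=; under eq_bigr do rewrite tup_coord.
  by under [in RHS]eq_bigr do rewrite tup_coord; rewrite -!jet_lamE e.
pose cof u := sval (cid (lam_gen u)).
have cofE u : u = \sum_i lam i *+ cof u i by exact: (svalP (cid (lam_gen u))).
pose chi y u : J := \prod_i tup y i ^+ cof u i.
have chiE y : C y -> forall u (c : 'I_N -> nat), u = \sum_i lam i *+ c i ->
    chi y u = \prod_i tup y i ^+ c i.
  move=> Cy u c e; apply/jet_eqP => i im; rewrite -ltnS in im.
  have h : \sum_i lam i *+ (cof u, c).1 i = \sum_i lam i *+ (cof u, c).2 i.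
    by rewrite -cofE.
  exact: (Cy (exist _ _ h, Ordinal im)).
have chi_hom y : C y -> monhom (chi y).
  move=> Cy; split=> [|u v].
    rewrite (chiE y Cy 0 (fun=> 0%N)); first by rewrite big1 // => i _; rewrite expr0.
    by rewrite big1 // => i _; rewrite mulr0n.
  rewrite (chiE y Cy (u + v) (fun i => (cof u i + cof v i)%N)).
    by rewrite -big_split; apply: eq_bigr => i _; rewrite exprD.
  rewrite {1}(cofE u) {1}(cofE v) -big_split; apply: eq_bigr => i _ /=.
  by rewrite mulrnDr.
have chi_lam y : C y -> forall i, chi y (lam i) = tup y i.
  move=> Cy i; rewrite (chiE y Cy (lam i) (fun j => (j == i) : nat)).
    rewrite (bigD1 i) //= eqxx expr1 big1 ?mulr1 // => j /negPf ->.
    by rewrite expr0.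
  rewrite (bigD1 i) //= eqxx mulr1n big1 ?addr0 // => j /negPf ->.
  by rewrite mulr0n.
pose back (y : {y | C y}) : jet A m := ma_lrmorphism (chi_hom (sval y) (svalP y)).
exists K, C; split; first exact: lc_closed.
rewrite subspace_zariski.
apply: (@isomorphic_zariski _ _ _ _ _ _ _ (fun phi => exist C (coord phi) (C_coord phi)) back).
- by move=> q; apply: sec_poly; apply: jet_poly; rewrite -ltnS.
- move=> [a i]; set g' := (fun (i : 'I_K) (x : {x | C x}) => _).
  have pext' (g0 f : {x | C x} -> k) : f =1 g0 -> polyfun g' g0 -> polyfun g' f.
    by move=> /funext ->.
  apply: sec_poly.
  apply: (pext' (fun y => \sum_(u <- msupp a) mcoeff u a * jcoef (chi (sval y) u) i)).
    move=> y /=; rewrite lrmorphism_monomials poly_of_qpoly_sum coef_sum.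
    apply: eq_bigr => u _.
    by rewrite poly_of_qpolyZ coefZ (ma_lrmorphismE (chi_hom (sval y) (svalP y))).
  apply: polyfun_sum => u _; apply: PolyMul; first exact: PolyCst.
  have := hprod (cof u) i _; rewrite -ltnS => /(_ (ltn_ord i)).
  exact: (@polyfun_comp _ _ _ _ _ sval).
- move=> phi; apply: jet_ext => i.
  rewrite (ma_lrmorphismE (chi_hom _ _)) chi_lam; last exact: C_coord.
  exact: tup_coord.
- move=> [y Cy]; apply: eq_exist; apply/funext => q; rewrite /coord.
  rewrite (ma_lrmorphismE (chi_hom _ _)) chi_lam; last exact: Cy.
  rewrite tup_coef; last by rewrite -ltnS.
  by rewrite inord_val -surjective_pairing enum_valK.
Qed.

End JetSpace.

(** * Units of the power series ring with prescribed monomials *)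

Section Divisible.
Variable D : zmodType.

(** Integer matrices act on tuples of elements of an abelian group; this is the
    language in which homomorphisms from a lattice to the group are solved for. *)
Definition int_act p q (A : 'M[int]_(p, q)) (x : 'I_q -> D) (i : 'I_p) : D :=
  \sum_j x j *~ A i j.

Lemma int_act_mul p q r (A : 'M[int]_(p, q)) (B : 'M[int]_(q, r)) x :
  int_act (A *m B) x =1 int_act A (int_act B x).
Proof.
move=> i; rewrite /int_act; transitivity (\sum_j \sum_l x j *~ B l j *~ A i l).
  apply: eq_bigr => j _; rewrite mxE mulrz_sumr; apply: eq_bigr => l _.
  by rewrite mulrC mulrzA.
by rewrite exchange_big; apply: eq_bigr => l _; rewrite mulrz_suml.
Qed.

Lemma int_act1 p (x : 'I_p -> D) : int_act 1%:M x =1 x.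
Proof.
move=> i; rewrite /int_act (bigD1 i) //= mxE eqxx mulr1z big1 ?addr0 // => j ji.
by rewrite mxE eq_sym (negPf ji) mulr0z.
Qed.

Lemma eq_int_act p q (A : 'M[int]_(p, q)) x y : x =1 y -> int_act A x =1 int_act A y.
Proof. by move=> e i; apply: eq_bigr => j _; rewrite e. Qed.

(** Smith's normal form reduces the system to divisions by the elementary
    divisors.  In other words, a homomorphism to a divisible group extends from
    the sublattice spanned by the rows of [V] to the whole lattice; the second
    hypothesis is that it is well defined on the sublattice. *)
Lemma divisible_extension N n (V : 'M[int]_(N, n)) (chi : 'I_N -> D) :
  (forall (d : int) (x : D), d != 0 -> exists y, y *~ d = x) ->
  (forall c : 'rV[int]_N, c *m V = 0 -> int_act c chi 0 = 0) ->
  exists x : 'I_n -> D, int_act V x =1 chi.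
Proof.
move=> div rel; have [P Pu [Q Qu [d _ VE]]] := int_Smith_normal_form V.
set Delta := (\matrix_(i, j) _) in VE.
pose chi' := int_act (invmx P) chi.
have PV : invmx P *m V = Delta *m Q by rewrite VE -mulmxA mulKmx.
have chi'0 (i : 'I_N) : (forall j : 'I_n, Delta i j = 0) -> chi' i = 0.
  move=> h; rewrite /chi' -(rel (row i (invmx P))).
    by apply: eq_bigr => j _; rewrite mxE.
  rewrite -row_mul PV row_mul (_ : row i Delta = 0) ?mul0mx //.
  by apply/rowP => j; rewrite mxE h mxE.
have hy (s : 'I_n) : exists y, forall i : 'I_N, (i == s :> nat) -> y *~ d`_s = chi' i.
  have [ds|ds] := eqVneq d`_s 0.
    exists 0 => i /eqP e; rewrite mul0rz chi'0 // => j.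
    rewrite mxE; case: eqP => [e'|]; rewrite ?mulr0n // e ds mul0rn //.
  have [sN|Ns] := ltnP s N; last first.
    by exists 0 => i /eqP e; have := ltn_ord i; rewrite e ltnNge Ns.
  have [y hy] := div _ (chi' (Ordinal sN)) ds; exists y => i /eqP e.
  by rewrite hy; congr chi'; apply: val_inj.
pose y s := sval (cid (hy s)).
have yE (s : 'I_n) (i : 'I_N) : (i == s :> nat) -> y s *~ d`_s = chi' i by exact: (svalP (cid (hy s)) i).
exists (int_act (invmx Q) y) => i.
rewrite -int_act_mul VE -!mulmxA mulmxV // mulmx1 int_act_mul.
rewrite (@eq_int_act _ _ P _ chi').
  by rewrite /chi' -int_act_mul mulmxV // int_act1.
move=> {}i; rewrite /int_act; have [iN|Ni] := ltnP i n.
  rewrite (bigD1 (Ordinal iN)) //= mxE eqxx mulr1n -(yE (Ordinal iN) i) //=.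
  rewrite big1 ?addr0 // => j ji; rewrite mxE.
  case: eqP => [e|]; last by rewrite mulr0n mulr0z.
  by case/eqP: ji; apply: val_inj.
have D0 (j : 'I_n) : Delta i j = 0.
  by rewrite mxE; case: eqP => // e; have := ltn_ord j; rewrite -e ltnNge Ni.
by rewrite chi'0 // big1 // => j _; rewrite D0 mulr0z.
Qed.

End Divisible.

Section UnitGroup.
Variable k : fieldType.

(** The group [k^*] written additively, as required by [divisible_extension]. *)
Definition kunits := {x : k | x != 0}.
HB.instance Definition _ := Choice.on kunits.

Implicit Types x y z : kunits.
Definition kunit1 : kunits := exist _ 1 (oner_neq0 k).
Definition kunitM x y : kunits := exist _ (sval x * sval y) (mulf_neq0 (svalP x) (svalP y)).
Definition kunitV x : kunits := exist _ (sval x)^-1 (invr_neq0 (svalP x)).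
Fact kunitA : associative kunitM.
Proof. by move=> x y z; apply: eq_exist; rewrite /= mulrA. Qed.
Fact kunitC : commutative kunitM.
Proof. by move=> x y; apply: eq_exist; rewrite /= mulrC. Qed.
Fact kunit1M : left_id kunit1 kunitM.
Proof. by move=> [x hx]; apply: eq_exist; rewrite /= mul1r. Qed.
Fact kunitVM : left_inverse kunit1 kunitV kunitM.
Proof. by move=> [x hx]; apply: eq_exist; rewrite /= mulVf. Qed.
HB.instance Definition _ := GRing.isZmodule.Build kunits kunitA kunitC kunit1M kunitVM.

Lemma kunit_inj : injective (fun x : kunits => sval x).
Proof. by move=> [x hx] [y hy] /= e; exact: eq_exist. Qed.

Lemma kunit_sum (I : Type) (r : seq I) (F : I -> kunits) :
  sval (\sum_(i <- r) F i) = \prod_(i <- r) sval (F i).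
Proof. exact: (big_morph (fun x : kunits => sval x)). Qed.

Lemma kunitMz x (z : int) : sval (x *~ z) = sval x ^ z.
Proof.
have h n : sval (x *+ n) = sval x ^+ n.
  by elim: n => [|n IH]; rewrite ?mulr0n ?expr0 // mulrS exprS -IH.
by case: z => n; [exact: h|exact: (congr1 (fun y : k => y^-1) (h n.+1))].
Qed.
End UnitGroup.

(** An algebraically closed field contains roots of all orders. *)
Lemma kunits_divisible (k : closedFieldType) (d : int) (x : kunits k) :
  d != 0 -> exists y, y *~ d = x.
Proof.
have pos n (u : kunits k) : (0 < n)%N -> exists y : kunits k, y *+ n = u.
  move=> n0; have [y hy] := solve_monicpoly (fun i => if i == 0%N then sval u else 0) n0.
  have {}hy : y ^+ n = sval u.
    rewrite hy; case: n n0 {hy} => // n _.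
    rewrite big_ord_recl /= expr0 mulr1 big1 ?addr0 // => i _.
    by rewrite mul0r.
  have y0 : y != 0.
    apply/eqP => e; move: hy (svalP u); rewrite e expr0n gtn_eqF // => <-.
    by rewrite eqxx.
  exists (exist _ y y0).
  have : sval ((exist _ y y0 : kunits k) *+ n) = sval u by rewrite pmulrn kunitMz -[LHS]/(y ^+ n) hy.
  by case: (_ *+ _) u {hy} => z hz [u hu] /= e; exact: eq_exist.
case: d => n nz.
  by apply: pos; rewrite lt0n; apply: contraNneq nz => ->.
have [y hy] := pos n.+1 (- x) isT; exists y.
by rewrite NegzE mulrNz -pmulrn hy opprK.
Qed.

Section Units.
Variable k : closedFieldType.
Implicit Types x y : series k.

(** Congruence modulo [t^B]. *)
Definition eqmod B x y := forall j, (j < B)%N -> coefs x j = coefs y j.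

Lemma eqmodS B x y : eqmod B.+1 x y <-> truncate B x = truncate B y.
Proof.
split=> h; first by apply/truncate_eqP => i iB; apply: h.
by move=> j; rewrite ltnS => jB; move/truncate_eqP: h; apply.
Qed.

Lemma eqmod_sym B x y : eqmod B x y -> eqmod B y x.
Proof. by move=> h j jB; rewrite h. Qed.
Lemma eqmod_trans B x y z : eqmod B x y -> eqmod B y z -> eqmod B x z.
Proof. by move=> h h' j jB; rewrite h // h'. Qed.
Lemma eqmodM B x x' y y' : eqmod B x x' -> eqmod B y y' -> eqmod B (x * y) (x' * y').
Proof.
case: B => [|B]; first by move=> _ _ j.
by move=> /eqmodS h /eqmodS h'; apply/eqmodS; rewrite !rmorphM /= h h'.
Qed.

Lemma eqmodV B x x' : x \is a GRing.unit -> x' \is a GRing.unit ->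
  eqmod B x x' -> eqmod B x^-1 x'^-1.
Proof.
case: B => [|B]; first by move=> _ _ _ j.
by move=> ux ux' /eqmodS h; apply/eqmodS; rewrite !rmorphV /= ?h.
Qed.

Lemma eqmod_prod B (I : Type) (r : seq I) (P : pred I) (F G : I -> series k) :
  (forall i, P i -> eqmod B (F i) (G i)) ->
  eqmod B (\prod_(i <- r | P i) F i) (\prod_(i <- r | P i) G i).
Proof.
move=> h; elim/big_rec2: _ => // i x y Pi hxy.
by apply: eqmodM => //; apply: h.
Qed.

Lemma eqmodX B x y n : eqmod B x y -> eqmod B (x ^+ n) (y ^+ n).
Proof.
by move=> h; elim: n => [|n IH]; rewrite ?expr0 ?exprS //; apply: eqmodM.
Qed.

(** On units congruent to [1] modulo [t^(B+1)] the coefficient at [B+1] is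
    additive: this is what linearizes one step of the interpolation. *)
Lemma lead1M B x y : eqmod B.+1 x 1 -> eqmod B.+1 y 1 ->
  coefs (x * y) B.+1 = coefs x B.+1 + coefs y B.+1.
Proof.
move=> hx hy; rewrite coefsM big_ord_recl big_ord_recr /= subn0 hx // coefs1 mul1r.
rewrite big1 ?add0r => [|i _]; last first.
  by rewrite /bump /= hx ?coefs1 ?mul0r // ltnS add1n.
by rewrite addrC subnn hy // coefs1 /= mulr1.
Qed.

Lemma eqmod1_unit B x : eqmod B.+1 x 1 -> x \is a GRing.unit.
Proof. by move=> h; rewrite series_unitE h // coefs1 oner_eq0. Qed.

Lemma eqmod1V B x : eqmod B.+1 x 1 -> eqmod B.+1 x^-1 1.
Proof.
move=> h; rewrite -[X in eqmod _ _ X]invr1; apply: eqmodV => //.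
- exact: eqmod1_unit h.
- exact: unitr1.
Qed.

Lemma lead1V B x : eqmod B.+1 x 1 -> coefs x^-1 B.+1 = - coefs x B.+1.
Proof.
move=> h; apply/eqP; rewrite -addr_eq0 addrC -lead1M //; last exact: eqmod1V.
by rewrite divrr ?coefs1 //; exact: eqmod1_unit h.
Qed.

Lemma eqmod1X B x n : eqmod B.+1 x 1 -> eqmod B.+1 (x ^+ n) 1.
Proof. by move=> /(@eqmodX _ _ _ n); rewrite expr1n. Qed.

Lemma lead1X B x n : eqmod B.+1 x 1 -> coefs (x ^+ n) B.+1 = coefs x B.+1 *+ n.
Proof.
move=> h; elim: n => [|n IH]; first by rewrite expr0 mulr0n coefs1.
by rewrite exprS lead1M ?IH ?mulrS //; exact: eqmod1X.
Qed.

Lemma eqmod1z B x z : eqmod B.+1 x 1 -> eqmod B.+1 (x ^ z) 1.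
Proof.
by move=> h; case: z => n; [exact: eqmod1X|exact: (eqmod1V (eqmod1X n.+1 h))].
Qed.

Lemma lead1z B x z : eqmod B.+1 x 1 -> coefs (x ^ z) B.+1 = coefs x B.+1 *~ z.
Proof.
move=> h; case: z => n; first exact: lead1X.
rewrite -[x ^ _]/((x ^+ n.+1)^-1) lead1V; last exact: eqmod1X.
by rewrite lead1X // NegzE mulrNz.
Qed.

Lemma eqmod1_prod B (I : Type) (r : seq I) (F : I -> series k) :
  (forall i, eqmod B.+1 (F i) 1) -> eqmod B.+1 (\prod_(i <- r) F i) 1.
Proof.
move=> h; have := @eqmod_prod B.+1 I r xpredT F (fun=> 1) (fun i _ => h i).
by rewrite big1_eq.
Qed.

Lemma lead1_prod B (I : Type) (r : seq I) (F : I -> series k) :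
  (forall i, eqmod B.+1 (F i) 1) ->
  coefs (\prod_(i <- r) F i) B.+1 = \sum_(i <- r) coefs (F i) B.+1.
Proof.
move=> h; elim: r => [|i r IH]; first by rewrite !big_nil coefs1.
by rewrite !big_cons lead1M ?IH //; exact: eqmod1_prod.
Qed.

Lemma series_exprz_unit x z : x \is a GRing.unit -> x ^ z \is a GRing.unit.
Proof. by move=> ux; case: z => n; rewrite ?unitrV unitrX. Qed.

Lemma unit_exprzMl (R : comUnitRingType) (x y : R) z : x \is a GRing.unit ->
  y \is a GRing.unit -> (x * y) ^ z = x ^ z * y ^ z.
Proof. by move=> ux uy; rewrite exprMz_comm //; exact: mulrC. Qed.

Lemma series_prod_unit (I : Type) (r : seq I) (P : pred I) (F : I -> series k) :
  (forall i, P i -> F i \is a GRing.unit) -> \prod_(i <- r | P i) F i \is a GRing.unit.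
Proof. by move=> h; apply: rpred_prod. Qed.

Hypothesis char0 : [pchar k] =i pred0.

Lemma char0_divisible (d : int) (x : k) : d != 0 -> exists y : k, y *~ d = x.
Proof.
move=> d0; exists (x / d%:~R); rewrite -mulrzr divfK //.
move/pcharf0P: char0 => h; case: d d0 => n nz.
  by rewrite -pmulrn h.
by rewrite NegzE mulrNz oppr_eq0 -pmulrn h.
Qed.

Variables (N n : nat) (v : 'I_N -> 'rV[int]_n) (r : 'I_N -> series k).
Variable b : 'I_N -> nat.
Hypothesis r_unit : forall i, r i \is a GRing.unit.
Hypothesis r_rel : forall j (c : 'I_N -> int), (forall i, c i != 0 -> (j < b i)%N) ->
  \sum_i v i *~ c i = 0 -> eqmod j.+1 (\prod_i r i ^ c i) 1.

(** The character of the lattice with value [U s] on the [s]-th basis vector. *)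
Definition unit_monomial (U : 'I_n -> series k) (w : 'rV[int]_n) := \prod_s U s ^ (w 0 s).

Lemma unit_monomial_unit U w : (forall s, U s \is a GRing.unit) -> unit_monomial U w \is a GRing.unit.
Proof. by move=> hU; apply: series_prod_unit => s _; exact: series_exprz_unit. Qed.

Lemma unit_monomialD U w w' : (forall s, U s \is a GRing.unit) ->
  unit_monomial U (w + w') = unit_monomial U w * unit_monomial U w'.
Proof.
move=> hU; rewrite /unit_monomial -big_split; apply: eq_bigr => s _.
by rewrite mxE exprzDr.
Qed.

Lemma unit_monomial0 U : unit_monomial U 0 = 1.
Proof. by rewrite /unit_monomial big1 // => s _; rewrite mxE expr0z. Qed.

Lemma rVMzE (w : 'rV[int]_n) z s : (w *~ z) 0 s = w 0 s * z.
Proof.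
rewrite -mulrzz; case: z => m; first by rewrite -!pmulrn mulmxnE.
by rewrite NegzE !mulrNz mxE -!pmulrn mulmxnE.
Qed.

Lemma unit_monomialMz U w z : (forall s, U s \is a GRing.unit) -> unit_monomial U (w *~ z) = unit_monomial U w ^ z.
Proof.
move=> hU; rewrite /unit_monomial.
have h (F : 'I_n -> series k) : (forall s, F s \is a GRing.unit) ->
   (\prod_s F s) ^ z = \prod_s F s ^ z.
  move=> hF; elim: (index_enum _) => [|s t IH]; first by rewrite !big_nil exp1rz.
  by rewrite !big_cons unit_exprzMl ?IH // series_prod_unit.
rewrite h => [|s]; last exact: series_exprz_unit.
by apply: eq_bigr => s _; rewrite exprz_exp rVMzE.
Qed.

Lemma unit_monomial_sum U (I : Type) (t : seq I) (F : I -> 'rV[int]_n) :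
  (forall s, U s \is a GRing.unit) ->
  unit_monomial U (\sum_(i <- t) F i) = \prod_(i <- t) unit_monomial U (F i).
Proof.
move=> hU; elim: t => [|i t IH]; first by rewrite !big_nil unit_monomial0.
by rewrite !big_cons unit_monomialD // IH.
Qed.

Let restr (B : nat) : 'M[int]_(N, n) := \matrix_(i, s) (if (B < b i)%N then v i 0 s else 0).

Let restr_rel B (c : 'rV[int]_N) : c *m restr B = 0 ->
  \sum_i v i *~ (if (B < b i)%N then c 0 i else 0) = 0.
Proof.
move=> h; apply/rowP => s; move/rowP/(_ s): h; rewrite !mxE => h.
rewrite summxE -[RHS]h; apply: eq_bigr => i _; rewrite rVMzE mxE mulrC.
by case: ifP; rewrite ?mul0r ?mulr0.
Qed.

(** The character is found one coefficient at a time: the constant terms solve a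
    linear system in [k^*], the next coefficients systems in [k].  By
    [divisible_extension] each system is solvable when the right-hand sides
    satisfy the relations between those [v i] whose value is prescribed at the
    current order, which is what [r_rel] says. *)
Lemma unit_interpolation B : exists U : 'I_n -> series k, (forall s, U s \is a GRing.unit) /\
  forall i, (forall j, (j < b i)%N -> (j < B)%N -> coefs (unit_monomial U (v i)) j = coefs (r i) j).
Proof.
elim: B => [|[_|B [U [uU hU]]]]; first by exists (fun=> 1); split=> // s; exact: unitr1.
(* Constant terms; vectors without any condition are dropped from the system. *)
- pose chi i : kunits k := if (0 < b i)%N then (exist _ (coefs (r i) 0) (r_unit i) : kunits k) else 0.
  have [c cV|x hx] := @divisible_extension _ _ _ (restr 0) chi (@kunits_divisible k).
    pose c' i := if (0 < b i)%N then c 0 i else 0.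
    have := @r_rel 0 c' _ (restr_rel cV) 0 isT.
    have sup i : c' i != 0 -> (0 < b i)%N by rewrite /c'; case: ifP; rewrite ?eqxx.
    move=> /(_ sup); rewrite coefs1 /= => h1.
    apply: kunit_inj; apply: (etrans _ h1); rewrite /int_act kunit_sum.
    rewrite -[RHS]/(series_ev _) rmorph_prod; apply: eq_bigr => i _.
    rewrite kunitMz rmorphXz // /chi /c'; case: ifP => // _.
    by rewrite expr0z exp1rz.
  exists (fun s => sval (x s) *: 1); split=> [s|i [|//] bi _].
    by rewrite series_unitE coefsZ coefs1 mulr1; case: (x s).
  have := hx i; rewrite /int_act /chi bi => /(congr1 (fun y : kunits k => sval y)).
  rewrite kunit_sum /= => <-; rewrite /unit_monomial -[LHS]/(series_ev _) rmorph_prod.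
  apply: eq_bigr => s _; rewrite kunitMz mxE bi rmorphXz //.
    by congr (_ ^ _); rewrite -[LHS]/(coefs (sval (x s) *: 1) 0) coefsZ coefs1 mulr1.
  by rewrite series_unitE coefsZ coefs1 mulr1; case: (x s).
(* The character found so far is corrected by the factors [1 + x s * t^(B+1)],
   where [x] solves the linear system given by the quotients [q i]. *)
- pose W i := unit_monomial U (v i).
  have uW i : W i \is a GRing.unit by apply: unit_monomial_unit.
  pose q i := if (B.+1 < b i)%N then r i / W i else 1.
  have q1 i : eqmod B.+1 (q i) 1.
    rewrite /q; case: ifP => // Bi; rewrite -(divrr (uW i)).
    apply: eqmodM => // j jB; rewrite hU //.
    exact: (ltn_trans jB Bi).
  pose chi i := coefs (q i) B.+1.
  have chi0 i : (b i <= B.+1)%N -> chi i = 0.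
    by rewrite leqNgt => /negPf Bi; rewrite /chi /q Bi coefs1.
  have [c cV|x hx] := @divisible_extension _ _ _ (restr B.+1) chi char0_divisible.
    pose c' i := if (B.+1 < b i)%N then c 0 i else 0.
    have sup i : c' i != 0 -> (B.+1 < b i)%N by rewrite /c'; case: ifP; rewrite ?eqxx.
    have h1 := @r_rel B.+1 c' sup (restr_rel cV).
    have e : \prod_i q i ^ c' i = \prod_i r i ^ c' i.
      transitivity (\prod_i (r i ^ c' i * unit_monomial U (v i *~ - c' i))).
        apply: eq_bigr => i _; rewrite unit_monomialMz // /q.
        case: ifP => Bi; last by rewrite /c' Bi oppr0 !expr0z mulr1.
        by rewrite unit_exprzMl ?unitrV // exprz_inv.
      rewrite big_split /= -unit_monomial_sum // (_ : \sum_i _ = 0) ?unit_monomial0 ?mulr1 //.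
      under eq_bigr do rewrite mulrNz.
      by rewrite sumrN (restr_rel cV) oppr0.
    have := h1 B.+1 (ltnSn _); rewrite coefs1 /= -e lead1_prod => [h2|i]; last exact: eqmod1z.
    apply: (etrans _ h2); rewrite /int_act; apply: eq_bigr => i _; rewrite lead1z // -/(chi i) /c'.
    by case: (ltnP B.+1 (b i)) => [//|iB]; rewrite (chi0 i iB) !mul0rz.
  pose e s : series k := Series (fun j => if j == 0%N then 1 else if j == B.+1 then x s else 0).
  have e1 s : eqmod B.+1 (e s) 1.
    by move=> [|j] jB; rewrite coefs1 /= ?eqSS ?ltn_eqF.
  have eB s : coefs (e s) B.+1 = x s by rewrite /= eqxx.
  have ue s : e s \is a GRing.unit by exact: eqmod1_unit (e1 s).
  exists (fun s => U s * e s); split=> [s|i j ji jB]; first by rewrite unitrM uU ue.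
  have -> : unit_monomial (fun s => U s * e s) (v i) = W i * unit_monomial e (v i).
    rewrite /W /unit_monomial -big_split; apply: eq_bigr => s _ /=.
    by rewrite unit_exprzMl.
  have E1 : eqmod B.+1 (unit_monomial e (v i)) 1 by apply: eqmod1_prod => s; exact: eqmod1z.
  have [Bi|iB] := ltnP B.+1 (b i).
    have qE : r i = W i * q i by rewrite /q Bi mulrC divrK.
    rewrite qE; have : eqmod B.+2 (unit_monomial e (v i)) (q i).
      move=> l; rewrite ltnS leq_eqVlt => /predU1P[->|lB].
        rewrite -/(chi i) -hx /unit_monomial lead1_prod => [|s]; last exact: eqmod1z.
        by apply: eq_bigr => s _; rewrite lead1z // eB mxE Bi.
      by rewrite E1 // q1.
    by move=> h; apply: (eqmodM (fun l _ => erefl) h).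
  have jB' : (j < B.+1)%N by exact: leq_trans ji iB.
  have h : eqmod B.+1 (W i * unit_monomial e (v i)) (W i * 1).
    exact: (eqmodM (fun l _ => erefl) E1).
  by rewrite h // mulr1 hU.
Qed.

End Units.

(** * Constructibility of the jets of arcs at the origin *)

Section TPower.
Variable k : closedFieldType.
Implicit Types x y : series k.

Definition tpow a : series k := Series (fun j => (j == a)%:R).
Definition sshift a x : series k := Series (fun j => coefs x (j + a)%N).

Lemma coefs_tpowM a x j : coefs (tpow a * x) j = if (j < a)%N then 0 else coefs x (j - a)%N.
Proof.
rewrite coefsM; case: ltnP => aj.
  rewrite big1 // => i _ /=; rewrite ltn_eqF ?mul0r //.
  by rewrite (leq_trans _ aj).
have ha : (a < j.+1)%N by [].
rewrite (bigD1 (Ordinal ha)) //= eqxx mul1r big1 ?addr0 // => i ia.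
case: eqP => [e|]; last by rewrite mul0r.
by case/eqP: ia; apply: val_inj.
Qed.

Lemma tpowD a b : tpow (a + b)%N = tpow a * tpow b.
Proof.
apply: seriesP => j; rewrite coefs_tpowM /=; case: ltnP => aj.
  by rewrite ltn_eqF // ltn_addr.
by congr (_%:R); rewrite -{1}(subnKC aj) eqn_add2l.
Qed.

Lemma tpow0 : tpow 0 = 1.
Proof. by apply: seriesP. Qed.

Lemma tpowM (a n : nat) : tpow (a * n)%N = tpow a ^+ n.
Proof. by elim: n => [|n IH]; rewrite ?muln0 ?tpow0 ?expr0 // mulnS tpowD IH exprS. Qed.

Lemma tpow_sshift a x : (forall j, (j < a)%N -> coefs x j = 0) -> x = tpow a * sshift a x.
Proof.
move=> h; apply: seriesP => j; rewrite coefs_tpowM; case: ltnP => [/h //|aj] /=.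
by rewrite subnK.
Qed.

Lemma tpow_unit_inj e e' x y : x \is a GRing.unit -> y \is a GRing.unit ->
  tpow e * x = tpow e' * y -> x = y.
Proof.
move=> ux uy h; have ee : e = e'.
  have [lt|lt|//] := ltngtP e e'.
    have : coefs (tpow e * x) e = coefs (tpow e' * y) e by rewrite h.
    rewrite !coefs_tpowM lt ltnn subnn.
    by move: ux; rewrite series_unitE => /eqP.
  have : coefs (tpow e * x) e' = coefs (tpow e' * y) e' by rewrite h.
    rewrite !coefs_tpowM lt ltnn subnn.
  by move: uy; rewrite series_unitE => /eqP ? /esym.
apply: seriesP => j; have : coefs (tpow e * x) (j + e)%N = coefs (tpow e' * y) (j + e)%N by rewrite h.
by rewrite !coefs_tpowM ee ltnNge leq_addl /= addnK.
Qed.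

End TPower.

Section Constructible.
Variables (k : closedFieldType) (char0 : [pchar k] =i pred0).
Variables (L : nmodType) (N n : nat) (lam : 'I_N -> L).
Hypothesis lam_gen : forall u, exists c : 'I_N -> nat, u = \sum_i lam i *+ c i.
Variable iota : L -> 'rV[int]_n.
Hypothesis iotaD : forall u v, iota (u + v) = iota u + iota v.
Hypothesis iota_inj : injective iota.
Variable m : nat.
Local Notation A := (monoid_algebra k L).
Local Notation mon := (monomial k).
Local Notation X := (jet_space A m).
Local Notation lc := (@locally_closed k X).

Let iota0 : iota 0 = 0.
Proof. by apply: (addrI (iota 0)); rewrite -iotaD !addr0. Qed.
Let iotaMn u d : iota (u *+ d) = iota u *+ d.
Proof. by elim: d => [|d IH]; rewrite ?mulr0n ?iota0 // !mulrS iotaD IH. Qed.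
Let iota_sum (I : Type) (r : seq I) (F : I -> L) :
  iota (\sum_(i <- r) F i) = \sum_(i <- r) iota (F i).
Proof. exact: (big_morph iota iotaD iota0). Qed.

Let pext (g0 f : jet A m -> k) : f =1 g0 -> polyfun (@jet_gen k L m) g0 -> polyfun (@jet_gen k L m) f.
Proof. by move=> /funext ->. Qed.
Let pcst := PolyCst (@jet_gen k L m).
Let padd := @PolyAdd k _ _ (@jet_gen k L m).
Let pmul := @PolyMul k _ _ (@jet_gen k L m).

(** The value at [lam i] has order [a i], with [a i = m.+1] when it vanishes. *)
Definition order_stratum (a : 'I_N -> nat) : set (jet A m) :=
  [set psi : jet A m | forall i,
     (forall j, (j < a i)%N -> jcoef (psi (mon (lam i))) j = 0) /\
     ((a i <= m)%N -> jcoef (psi (mon (lam i))) (a i) != 0)].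

Lemma order_stratum_lc a : (forall i, a i <= m.+1)%N -> lc (order_stratum a).
Proof.
move=> am.
have -> : order_stratum a =
  [set psi : jet A m | forall p : {p : 'I_N * nat | (p.2 < a p.1)%N},
       jcoef (psi (mon (lam (sval p).1))) (sval p).2 = 0] `&`
  [set psi : jet A m | \prod_(i < N | (a i <= m)%N) jcoef (psi (mon (lam i))) (a i) != 0].
  apply/seteqP; split=> psi.
    move=> h; split=> [[[i j] /= ja]|/=]; first by have [h1 _] := h i; exact: h1.
    by apply/prodf_neq0 => i ai; have [_ h2] := h i; exact: h2.
  move=> [/= h1 /prodf_neq0 h2] i; split=> [j ja|ai]; last exact: h2.
  exact: (h1 (exist _ (i, j) ja)).
apply: lcI.
  apply: lc_closed; apply: zclosed_all => -[[i j] /= ja].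
  apply: zclosed_eq0; apply: (@jet_poly k L m).
  by rewrite -ltnS (leq_trans ja).
apply: lc_open; apply: zopen_nz; apply: polyfun_prod => i ai.
exact: (@jet_poly k L m).
Qed.

Lemma order_stratum_disjoint (a a' : 'I_N -> nat) : (forall i, a i <= m.+1)%N ->
  (forall i, a' i <= m.+1)%N -> order_stratum a `&` order_stratum a' !=set0 -> a =1 a'.
Proof.
move=> ha ha' [psi [h h']] i.
have [h1 h2] := h i; have [h1' h2'] := h' i.
have [lt|lt|//] := ltngtP (a i) (a' i).
  have am : (a i <= m)%N by rewrite -ltnS (leq_trans lt).
  by have := h2 am; rewrite (h1' _ lt) eqxx.
have am : (a' i <= m)%N by rewrite -ltnS (leq_trans lt).
by have := h2' am; rewrite (h1 _ lt) eqxx.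
Qed.

Lemma order_stratum_cover (psi : jet A m) :
  exists a : {ffun 'I_N -> 'I_m.+2}, order_stratum (fun i => a i) psi.
Proof.
pose f (i : 'I_N) := find (fun j => jcoef (psi (mon (lam i))) j != 0) (seq.iota 0 m.+1).
have fm i : (f i < m.+2)%N by have := find_size (fun j => jcoef (psi (mon (lam i))) j != 0) (seq.iota 0 m.+1); rewrite size_iota.
exists [ffun i => Ordinal (fm i)] => i; rewrite ffunE /=; split=> [j jf|fi].
  have := before_find 0%N jf; rewrite nth_iota ?add0n; last exact: leq_trans jf (fm i).
  by move=> /negbFE /eqP.
have h : has (fun j => jcoef (psi (mon (lam i))) j != 0) (seq.iota 0 m.+1).
  by rewrite has_find size_iota ltnS.
by have := nth_find 0%N h; rewrite -/(f i) nth_iota ?add0n // ltnS.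
Qed.

(** The value at [lam i] divided by its power of [t].  Only the coefficients
    below [m.+1 - a i] are those of every lift, the others being set to zero. *)
Definition leading_part (a : 'I_N -> nat) (psi : jet A m) i : series k :=
  sshift (a i) (jet_lift (psi (mon (lam i)))).

(** The binomial relations between the leading parts.  A relation that involves
    [lam i] is only meaningful below [t^(m + 1 - a i)], hence the bound on [j]. *)
Definition relation_locus (a : 'I_N -> nat) : set (jet A m) :=
  [set psi | forall j (c c' : 'I_N -> nat),
     (forall i, (c i != 0%N) || (c' i != 0%N) -> (j + a i <= m)%N) ->
     \sum_i lam i *+ c i = \sum_i lam i *+ c' i ->
     eqmod j.+1 (\prod_i leading_part a psi i ^+ c i) (\prod_i leading_part a psi i ^+ c' i)].

Lemma relation_locus_closed a : @zclosed k X (relation_locus a).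
Proof.
pose Q (p : nat * (('I_N -> nat) * ('I_N -> nat)) * nat) :=
  [/\ forall i, (p.1.2.1 i != 0%N) || (p.1.2.2 i != 0%N) -> (p.1.1 + a i <= m)%N,
     \sum_i lam i *+ p.1.2.1 i = \sum_i lam i *+ p.1.2.2 i & (p.2 < p.1.1.+1)%N].
have -> : relation_locus a = [set psi | forall p : {p | Q p},
   coefs (\prod_i leading_part a psi i ^+ (sval p).1.2.1 i) (sval p).2 =
   coefs (\prod_i leading_part a psi i ^+ (sval p).1.2.2 i) (sval p).2].
  apply/seteqP; split=> psi h; first by case=> [[[j [c c']] l] [/= q1 q2 q3]]; exact: (h j c c' q1 q2 l q3).
  move=> j c c' q1 q2 l q3.
  have q : Q (j, (c, c'), l) by split.
  exact: (h (exist _ _ q)).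
apply: zclosed_all => p.
have hw i : sfun (polyfun (@jet_gen k L m)) (fun psi => leading_part a psi i).
  apply: sfun_shift; apply/(jfun_sfun pext pcst); exact: jfun_jet.
have hp (c : 'I_N -> nat) : sfun (polyfun (@jet_gen k L m)) (fun psi => \prod_i leading_part a psi i ^+ c i).
  by apply: (sfun_prod pext pcst padd pmul) => i; exact: (sfun_exp pext pcst padd pmul).
by apply: zclosed_eq; apply: hp.
Qed.

Lemma leading_part_unit a psi i : order_stratum a psi -> (a i <= m)%N ->
  leading_part a psi i \is a GRing.unit.
Proof. by move=> /(_ i) [_ h] /h; rewrite series_unitE. Qed.

(** For an arc the values at the two members of a relation are equal; dividing
    both by their powers of [t] leaves an identity between leading parts. *)
Lemma arc_relation_locus a (phi : formal_arc A) : order_stratum a (jet_of_arc m phi) ->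
  relation_locus a (jet_of_arc m phi).
Proof.
move=> ha j c c' sup rel; set psi := jet_of_arc m phi.
have psiE u l : (l <= m)%N -> jcoef (psi u) l = coefs (phi u) l.
  by move=> lm; rewrite /psi /= jcoef_truncate.
pose W i := sshift (a i) (phi (mon (lam i))).
have uW i : (a i <= m)%N -> W i \is a GRing.unit.
  by move=> am; rewrite series_unitE /W [coefs _ _]/= add0n -psiE //; have [_ /(_ am)] := ha i.
have fact i : (a i <= m)%N -> phi (mon (lam i)) = tpow k (a i) * W i.
  move=> am; apply: tpow_sshift => l la; rewrite -psiE.
    by have [h _] := ha i; exact: h.
  exact: leq_trans (ltnW la) am.
have key (d : 'I_N -> nat) : (forall i, d i != 0%N -> (a i <= m)%N) ->
    phi (mon (\sum_i lam i *+ d i)) = tpow k (\sum_i a i * d i)%N * \prod_i W i ^+ d i /\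
    \prod_i W i ^+ d i \is a GRing.unit.
  move=> hd; split; last first.
    apply: series_prod_unit => i _; have [->|di] := eqVneq (d i) 0%N.
      by rewrite expr0 unitr1.
    by rewrite unitrX // uW // hd.
  rewrite (monhom_lam lam d (lrmorphism_monhom phi)).
  rewrite (big_morph (tpow k) (@tpowD k) (tpow0 k)) -big_split.
  apply: eq_bigr => i _; rewrite tpowM; have [->|di] := eqVneq (d i) 0%N.
    by rewrite !expr0 [RHS]mulr1.
  by rewrite [RHS]/= -exprMn -fact // hd.
have hc i : c i != 0%N -> (a i <= m)%N.
  by move=> ci; apply: leq_trans (sup i _); rewrite ?ci // leq_addl.
have hc' i : c' i != 0%N -> (a i <= m)%N.
  by move=> ci; apply: leq_trans (sup i _); rewrite ?ci ?orbT // leq_addl.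
have [e1 u1] := key c hc; have [e2 u2] := key c' hc'.
have wW d : (forall i, d i != 0%N -> (j + a i <= m)%N) ->
   eqmod j.+1 (\prod_i leading_part a psi i ^+ d i) (\prod_i W i ^+ d i).
  move=> hd; apply: eqmod_prod => i _; have [->|di] := eqVneq (d i) 0%N.
    by rewrite !expr0.
  apply: eqmodX => l lj; rewrite /= psiE //.
  by apply: leq_trans (hd i di); rewrite leq_add2r -ltnS.
apply: (eqmod_trans (wW c _)); first by move=> i ci; apply: sup; rewrite ci.
apply: (@eqmod_trans _ _ _ (\prod_i W i ^+ c' i)); last first.
  by apply: eqmod_sym; apply: wW => i ci; apply: sup; rewrite ci orbT.
have E := etrans (esym e1) (etrans (congr1 (fun u => phi (mon u)) rel) e2).
by rewrite (tpow_unit_inj u1 u2 E).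
Qed.

Definition origin_set : set A := [set mon u | u in [set u : L | u != 0]].

(** The quotients [r] of the leading parts of [psi] and of [phi0] satisfy all
    the relations between the generators, with the precision [b]; so there is a
    character [U] of the lattice which agrees with them, and [phi0] times that
    character lifts [psi]. *)
Lemma arc_lift a (phi0 : formal_arc A) (psi : jet A m) : arcs_at origin_set phi0 ->
  order_stratum a (jet_of_arc m phi0) -> order_stratum a psi -> relation_locus a psi ->
  exists2 phi : formal_arc A, arcs_at origin_set phi & jet_of_arc m phi = psi.
Proof.
move=> org0 ord0 ord rel; set psi0 := jet_of_arc m phi0.
have rel0 : relation_locus a psi0 by exact: arc_relation_locus.
pose w := leading_part a psi; pose w0 := leading_part a psi0.
have uw i : (a i <= m)%N -> w i \is a GRing.unit by exact: leading_part_unit.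
have uw0 i : (a i <= m)%N -> w0 i \is a GRing.unit by exact: leading_part_unit.
pose r i := if (a i <= m)%N then w i / w0 i else 1.
have ur i : r i \is a GRing.unit.
  by rewrite /r; case: ifP => [am|_]; rewrite ?unitr1 // unitrM unitrV uw // uw0.
pose b i := (m.+1 - a i)%N.
have rrel j (c : 'I_N -> int) : (forall i, c i != 0 -> (j < b i)%N) ->
   \sum_i iota (lam i) *~ c i = 0 -> eqmod j.+1 (\prod_i r i ^ c i) 1.
  move=> sup e0.
  (* An integral relation is split into its positive and negative parts, a pair
     of exponent vectors with equal sums in the semigroup. *)
  pose cp i := if c i is Posz l then l else 0%N.
  pose cn i := if c i is Negz l then l.+1 else 0%N.
  have cE i : c i = (cp i)%:Z - (cn i)%:Z.
    by rewrite /cp /cn; case: (c i) => l; rewrite ?subr0 ?NegzE ?sub0r.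
  have sup' i : (cp i != 0%N) || (cn i != 0%N) -> (j + a i <= m)%N.
    move=> h; have := sup i; rewrite /b.
    have -> : c i != 0 by move: h; rewrite /cp /cn; case: (c i) => [[|l]|l].
    move=> /(_ isT); lia.
  have ee : \sum_i lam i *+ cp i = \sum_i lam i *+ cn i.
    apply: iota_inj; rewrite !iota_sum; apply/eqP; rewrite -subr_eq0.
    apply/eqP; rewrite -sumrB; apply: (etrans _ e0); apply: eq_bigr => i _.
    by rewrite !iotaMn cE mulrzBr -!pmulrn.
  have h1 := rel j cp cn sup' ee; have h0 := rel0 j cp cn sup' ee.
  have ux (v : 'I_N -> series k) (d : 'I_N -> nat) : (forall i, (a i <= m)%N -> v i \is a GRing.unit) ->
     (forall i, d i != 0%N -> (j + a i <= m)%N) -> \prod_i v i ^+ d i \is a GRing.unit.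
    move=> hv hd; apply: series_prod_unit => i _; have [->|di] := eqVneq (d i) 0%N.
      by rewrite expr0 unitr1.
    by rewrite unitrX // hv // (leq_trans _ (hd i di)) // leq_addl.
  have sp i : cp i != 0%N -> (j + a i <= m)%N by move=> h; apply: sup'; rewrite h.
  have sn i : cn i != 0%N -> (j + a i <= m)%N by move=> h; apply: sup'; rewrite h orbT.
  set Pp := \prod_i w i ^+ cp i; set Pn := \prod_i w i ^+ cn i.
  set Qp := \prod_i w0 i ^+ cp i; set Qn := \prod_i w0 i ^+ cn i.
  have E : (\prod_i r i ^ c i) * (Qp * Pn) = Pp * Qn.
    rewrite -!big_split; apply: eq_bigr => i _ /=.
    have [ci|ci] := eqVneq (c i) 0.
      by rewrite /cp /cn ci expr0z !expr0 !mulr1.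
    have am : (a i <= m)%N by have := sup i ci; rewrite /b; lia.
    rewrite /r am /cp /cn; case: (c i) => l.
      rewrite expr0 !mulr1 -[_ ^ _]/((w i / w0 i) ^+ l) exprMn -mulrA exprVn mulVr ?mulr1 //.
      by rewrite unitrX // uw0.
    rewrite expr0 !mul1r -[_ ^ _]/(((w i / w0 i) ^+ l.+1)^-1).
    by rewrite -exprVn invrM ?unitrV ?uw ?uw0 // invrK exprMn -mulrA -exprMn mulVr ?uw // expr1n mulr1.
  have uX : Qp * Pn \is a GRing.unit by rewrite unitrM (ux w0) // (ux w).
  rewrite -[X in eqmod _ X _](mulrK uX) -[X in eqmod _ _ X](mulrV uX) E.
  apply: eqmodM => //; rewrite mulrC; apply: eqmodM => //; exact: eqmod_sym.
have [U [uU hU]] := @unit_interpolation k char0 N n (iota \o lam) r b ur rrel m.+1.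
pose chi u := phi0 (mon u) * unit_monomial U (iota u).
have hchi : monhom chi.
  have [h0 hD] := lrmorphism_monhom phi0; split=> [|u v].
    by rewrite /chi h0 iota0 unit_monomial0 mulr1.
  by rewrite /chi hD iotaD unit_monomialD // mulrACA.
pose phi : formal_arc A := ma_lrmorphism hchi.
exists phi.
  move=> _ [u u0 <-]; rewrite (ma_lrmorphismE hchi) /chi.
  rewrite coefsM big_ord_recl big_ord0 addr0 /= org0 ?mul0r //.
  by exists u.
apply: (jet_ext lam_gen) => i; rewrite /= (ma_lrmorphismE hchi) /chi.
apply/jet_eqP => j jm; rewrite jcoef_truncate //.
have psi0E u l : (l <= m)%N -> jcoef (psi0 u) l = coefs (phi0 u) l.
  by move=> lm; rewrite /psi0 /= jcoef_truncate.
(* When [a i = m.+1] both jets vanish at [lam i]. *)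
have [am|ma] := leqP (a i) m; last first.
  have h (p : jet A m) l : order_stratum a p -> (l <= m)%N -> jcoef (p (mon (lam i))) l = 0.
    by move=> /(_ i) [h _] lm; apply: h; exact: leq_ltn_trans lm ma.
  rewrite h // coefsM big1 // => l _; rewrite -psi0E ?h ?mul0r //;
  by apply: leq_trans jm; rewrite -ltnS.
rewrite (@tpow_sshift _ (a i) (phi0 _)); last first.
  move=> l la; rewrite -psi0E; last exact: leq_trans (ltnW la) am.
  by have [h _] := ord0 i; exact: h.
rewrite -mulrA coefs_tpowM; case: ltnP => ja.
  by have [h _] := ord i; rewrite h.
have -> : jcoef (psi (mon (lam i))) j = coefs (w i) (j - a i)%N by rewrite /= subnK.
have -> : w i = w0 i * r i by rewrite /r am mulrC divrK // uw0.
have h1 : eqmod (b i) (sshift (a i) (phi0 (mon (lam i)))) (w0 i).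
  by move=> l lb; rewrite /= psi0E //; move: lb; rewrite /b; lia.
have h2 : eqmod (b i) (unit_monomial U (iota (lam i))) (r i).
  by move=> l lb; apply: hU => //; move: lb; rewrite /b; lia.
by apply: (eqmodM h1 h2); rewrite /b; lia.
Qed.

(** The strata are indexed by the orders of the generators.  A stratum that
    contains the jet of some arc at the origin meets the liftable jets in the
    closed set [relation_locus]; the other strata contribute nothing. *)
Lemma arcs_jets_constructible :
  exists (J : finType) (F : J -> set (jet A m)),
  [/\ forall j, lc (F j), forall i j, i != j -> F i `&` F j = set0 &
   [set jet_of_arc m phi | phi in arcs_at origin_set] = [set x | exists j, F j x]].
Proof.
pose S : set (jet A m) := [set jet_of_arc m phi | phi in arcs_at origin_set]; pose F (a : {ffun 'I_N -> 'I_m.+2}) := order_stratum (fun i => a i) `&` S.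
have le_a (a : {ffun 'I_N -> 'I_m.+2}) i : (a i <= m.+1)%N by rewrite -ltnS.
exists {ffun 'I_N -> 'I_m.+2}, F; split.
- move=> a; have [[psi0 [ord0 [phi0 org0 e0]]]|h] := pselect (exists psi, F a psi).
    have -> : F a = order_stratum (fun i => a i) `&` relation_locus (fun i => a i).
      apply/seteqP; split=> [psi [ord [phi org e]]|psi [ord rel]].
        by split=> //; move: ord; rewrite -e; exact: arc_relation_locus.
      split=> //; have [|phi org e] := arc_lift org0 _ ord rel; first by rewrite e0.
      by exists phi.
    by apply: lcI; [exact/order_stratum_lc/le_a|apply: lc_closed; exact: relation_locus_closed].
  have -> : F a = set0 by apply/seteqP; split=> // psi Fpsi; case: h; exists psi.
  exact: lc0.
- move=> a a' aa'; apply/seteqP; split=> // psi [[h _] [h' _]]; case/eqP: aa'.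
  apply/ffunP => i; apply: val_inj.
  apply: (@order_stratum_disjoint (fun i => a i) (fun i => a' i) (le_a a) (le_a a')).
  by exists psi.
- apply/seteqP; split=> psi; first by move=> Spsi; have [a ha] := order_stratum_cover psi; exists a.
  by move=> [a []].
Qed.

End Constructible.

(** * Farkas' lemma with integral multipliers *)

Section Farkas.
Variables (F : realFieldType) (n : nat).
Implicit Types (g b : 'rV[F]_n) (y : 'cV[F]_n).

Definition dot g y : F := (g *m y) 0 0.

Lemma dotDl g b y : dot (g + b) y = dot g y + dot b y.
Proof. by rewrite /dot mulmxDl mxE. Qed.
Lemma dotZl a g y : dot (a *: g) y = a * dot g y.
Proof. by rewrite /dot -scalemxAl mxE. Qed.
Lemma dotNl g y : dot (- g) y = - dot g y.
Proof. by rewrite -scaleN1r dotZl mulN1r. Qed.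
Lemma dotBl g b y : dot (g - b) y = dot g y - dot b y.
Proof. by rewrite dotDl dotNl. Qed.
Lemma dotDr g y z : dot g (y + z) = dot g y + dot g z.
Proof. by rewrite /dot mulmxDr mxE. Qed.
Lemma dotZr a g y : dot g (a *: y) = a * dot g y.
Proof. by rewrite /dot -scalemxAr mxE. Qed.
Lemma dotNr g y : dot g (- y) = - dot g y.
Proof. by rewrite -scaleN1r dotZr mulN1r. Qed.
Lemma dotBr g y z : dot g (y - z) = dot g y - dot g z.
Proof. by rewrite dotDr dotNr. Qed.
Lemma dot_suml (I : Type) (r : seq I) (P : pred I) (G : I -> 'rV[F]_n) y :
  dot (\sum_(i <- r | P i) G i) y = \sum_(i <- r | P i) dot (G i) y.
Proof. by rewrite /dot mulmx_suml summxE. Qed.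

Lemma dot_sqr_gt0 b : b != 0 -> 0 < dot b b^T.
Proof.
move=> b0; rewrite /dot mxE; under eq_bigr do rewrite mxE -expr2.
have /existsP [i hi] : [exists i, b 0 i != 0].
  apply: contraR b0; rewrite negb_exists => /forallP h; apply/eqP/rowP => i.
  by rewrite mxE; have := h i; rewrite negbK => /eqP.
rewrite (bigD1 i) //=; apply: ltr_pwDl; first by rewrite exprn_even_gt0.
by apply: sumr_ge0 => j _; exact: sqr_ge0.
Qed.

(** Nonnegative combinations of a list, with one coefficient per entry; the
    recursion on the list drives the proof of [farkas]. *)
Fixpoint conic (s : seq 'rV[F]_n) b : Prop :=
  if s is g :: s' then exists2 a, 0 <= a & conic s' (b - a *: g) else b = 0.

(** Undoes the projection in the inductive step of [farkas]. *)
Lemma conic_shift g s (c : 'rV[F]_n -> F) b : {in s, forall h, 0 <= c h} ->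
  conic [seq h + c h *: g | h <- s] b -> conic (g :: s) b.
Proof.
elim: s b => [|h s IH] b c0 /=; first by move=> ->; exists 0; rewrite ?scale0r ?subr0.
move=> [a a0 /IH]; case=> [x xs|e e0 he]; first by apply: c0; rewrite inE xs orbT.
exists (e + a * c h).
  by rewrite addr_ge0 // mulr_ge0 // c0 // mem_head.
exists a => //; move: he; congr conic.
by apply/rowP => i; rewrite !mxE; ring.
Qed.

Lemma conic_sum s b : conic s b -> exists2 a : nat -> F, (forall i, 0 <= a i) &
  b = \sum_(i < size s) a i *: s`_i.
Proof.
elim: s b => [|g s IH] b /=; first by move=> ->; exists (fun=> 0); rewrite ?big_ord0.
move=> [a a0 /IH [c c0 e]]; exists (fun i => if i is j.+1 then c j else a).
  by case.
by rewrite big_ord_recl /= -e addrC subrK.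
Qed.

(** Induction on the number of generators.  If [y] separates [b] from the cone
    of [s] but is negative on [g], the vectors are projected along [g] onto the
    hyperplane orthogonal to [y] and the induction applies to the projections. *)
Theorem farkas s b : conic s b \/
  exists y, {in s, forall g, 0 <= dot g y} /\ dot b y < 0.
Proof.
elim: {s}(size s) {-2}s (erefl (size s)) b => [|N IH] [|g s] //=.
  move=> _ b; have [->|b0] := eqVneq b 0; first by left.
  right; exists (- b^T); split=> //; rewrite dotNr oppr_lt0; exact: dot_sqr_gt0.
case=> sN b; have [h|[y [y1 y2]]] := IH s sN b.
  by left; exists 0 => //; rewrite scale0r subr0.
have [g0|g0] := leP 0 (dot g y).
  by right; exists y; split=> // h; rewrite inE => /predU1P[->|/y1].
have ng : dot g y != 0 by rewrite lt_eqF.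
pose c h := - (dot h y / dot g y).
pose pr h := h + c h *: g.
have sz : size [seq pr h | h <- s] = N by rewrite size_map.
have [hc|[z [z1 z2]]] := IH [seq pr h | h <- s] sz (pr b).
  have c0 : {in s, forall h, 0 <= c h}.
    by move=> h hs; rewrite /c oppr_ge0 mulr_ge0_le0 ?y1 // invr_le0 ltW.
  have [a a0 ha] := conic_shift c0 hc; left; exists (a + dot b y / dot g y).
    by rewrite addr_ge0 // mulr_le0 ?invr_le0 ?ltW.
  move: ha; congr conic; rewrite /pr /c.
  by apply/rowP => i; rewrite !mxE; ring.
right; exists (z - (dot g z / dot g y) *: y); split.
  move=> h; rewrite inE => /predU1P[->|hs].
    by rewrite dotBr dotZr divfK // subrr.
  have := z1 (pr h) (map_f _ hs); rewrite /pr dotDl dotZl /c dotBr dotZr.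
  rewrite mulNr; suff -> : dot h y / dot g y * dot g z = dot g z / dot g y * dot h y by [].
  by rewrite mulrC mulrA mulrAC.
move: z2; rewrite /pr dotDl dotZl /c dotBr dotZr mulNr.
suff -> : dot b y / dot g y * dot g z = dot g z / dot g y * dot b y by [].
by rewrite mulrC mulrA mulrAC.
Qed.

End Farkas.

Section Lattice.
Variable d : nat.
Local Notation M := 'rV[int]_d.
Variables (L : addrClosed M) (s : seq M).
Hypothesis s_gen : forall u, u \in L <->
    exists c : 'I_(size s) -> nat, u = \sum_(i < size s) s`_i *+ c i.

Definition rat_point (u : M) : 'rV[rat]_d := map_mx intr u.

Lemma gen_in g : g \in s -> g \in L.
Proof.
move=> gs; apply/s_gen; have gi : (index g s < size s)%N by rewrite index_mem.
exists (fun i => (i == Ordinal gi) : nat).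
rewrite (bigD1 (Ordinal gi)) //= eqxx mulr1n nth_index // big1 ?addr0 // => i /negPf ->.
by rewrite mulr0n.
Qed.

Lemma rat_pointD u v : rat_point (u + v) = rat_point u + rat_point v.
Proof. by rewrite /rat_point map_mxD. Qed.
Lemma rat_point0 : rat_point 0 = 0.
Proof. by rewrite /rat_point map_mx0. Qed.
Lemma rat_pointMn u m : rat_point (u *+ m) = m%:R *: rat_point u.
Proof.
elim: m => [|m IH]; first by rewrite mulr0n scale0r /rat_point map_mx0.
by rewrite mulrS rat_pointD IH -natr1 scalerDl scale1r addrC.
Qed.
Lemma rat_point_inj : injective rat_point.
Proof.
move=> u v /rowP e; apply/rowP => i; have := e i; rewrite !mxE.
exact: intr_inj.
Qed.

Lemma rat_nat (a : rat) : 0 <= a -> exists p q : nat, (0 < q)%N /\ q%:R * a = p%:R.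
Proof.
move=> a0; have := numqE a; move: (numq_ge0 a) (denq_gt0 a); rewrite a0.
case: (numq a) => // p _; case: (denq a) => // q q0 e.
by exists p, q; split=> //; rewrite mulrC; exact: esym e.
Qed.

(** Clearing denominators. *)
Lemma conic_clear (t : seq M) (z : 'rV[rat]_d) : {in t, forall g, g \in L} ->
  conic [seq rat_point g | g <- t] z ->
  exists N l, [/\ (0 < N)%N, l \in L & N%:R *: z = rat_point l].
Proof.
elim: t z => [|g t IH] z tL /=.
  move=> ->; exists 1%N, 0; split=> //; first exact: rpred0.
  by rewrite scaler0 /rat_point map_mx0.
move=> [a /rat_nat [p [q [q0 e]]] /IH [x xt|N [l [N0 lL e']]]].
  by apply: tL; rewrite inE xt orbT.
exists (q * N)%N, (l *+ q + g *+ (N * p)); split.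
- by rewrite muln_gt0 q0.
- by rewrite rpredD ?rpredMn // tL // mem_head.
rewrite rat_pointD !rat_pointMn -e' !natrM -e.
by apply/rowP => i; rewrite !mxE; ring.
Qed.

(** By [farkas] over [rat], rational functionals detect membership in the cone
    generated by [L] and [- x]; clearing denominators makes the combination
    integral, at the cost of the multiple [N]. *)
Lemma int_farkas (x u : M) : x \in L ->
  (forall y : 'cV[rat]_d, {in s, forall g, 0 <= dot (rat_point g) y} ->
     dot (rat_point x) y = 0 -> 0 <= dot (rat_point u) y) ->
  exists N C, (0 < N)%N /\ u *+ N + x *+ C \in L.
Proof.
move=> xL h.
(* Adding [- x] to the generators expresses that [x] is inverted. *)
have [|[y [y1 y2]]] := farkas (- rat_point x :: [seq rat_point g | g <- s]) (rat_point u).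
  move=> [b /rat_nat [p [q [q0 e]]] /conic_clear]; case=> [|N [l [N0 lL e']]]; first exact: gen_in.
  exists (N * q)%N, (N * p)%N; split; first by rewrite muln_gt0 N0.
  suff -> : u *+ (N * q) + x *+ (N * p) = l *+ q by apply: rpredMn.
  apply: rat_point_inj; rewrite rat_pointD !rat_pointMn -e' !natrM -e.
  by apply/rowP => i; rewrite !mxE; ring.
have sy : {in s, forall g, 0 <= dot (rat_point g) y}.
  by move=> g gs; apply: y1; rewrite inE map_f ?orbT.
have xy : dot (rat_point x) y = 0.
  apply/eqP; rewrite eq_le; apply/andP; split.
    by have := y1 _ (mem_head _ _); rewrite dotNl oppr_ge0.
  have [c ->] := (s_gen x).1 xL.
  rewrite (big_morph rat_point rat_pointD rat_point0) dot_suml sumr_ge0 // => i _.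
  by rewrite rat_pointMn dotZl mulr_ge0 ?ler0n // sy // mem_nth.
by have := h y sy xy; rewrite leNgt y2.
Qed.

End Lattice.

(** * Faces of the cone and faces of the semigroup *)

Section Faces.
Variables (R : realType) (d : nat).
Local Notation M := 'rV[int]_d.
Variables (L : addrClosed M) (s : seq M).
Hypothesis s_gen : forall u, u \in L <->
    exists c : 'I_(size s) -> nat, u = \sum_(i < size s) s`_i *+ c i.
Local Notation rp := (@real_point R d).
Local Notation sigma := (dual_cone (cone_of R L)).
Implicit Types (n : 'cV[R]_d) (theta : set 'cV[R]_d) (u : M).

Lemma pairing_dot (x : 'rV[R]_d) n : pairing x n = dot x n.
Proof. by []. Qed.

Lemma real_rat u : rp u = map_mx ratr (rat_point u).
Proof. by apply/rowP => i; rewrite !mxE ratr_int. Qed.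

Lemma pair_rat u (y : 'cV[rat]_d) :
  pairing (rp u) (map_mx ratr y) = ratr (dot (rat_point u) y).
Proof. by rewrite real_rat /pairing -map_mxM mxE. Qed.

Lemma rpMn u m : rp (u *+ m) = m%:R *: rp u.
Proof.
elim: m => [|m IH]; first by rewrite mulr0n scale0r real_point0.
by rewrite mulrS real_pointD IH -natr1 scalerDl scale1r addrC.
Qed.

Lemma rp_sum (I : Type) (r : seq I) (P : pred I) (G : I -> M) :
  rp (\sum_(i <- r | P i) G i) = \sum_(i <- r | P i) rp (G i).
Proof. exact: (big_morph rp (@real_pointD R d) (@real_point0 R d)). Qed.

Lemma cone_of_in u : u \in L -> cone_of R L (rp u).
Proof.
move=> uL; exists [:: (1, u)]; last by rewrite big_seq1 scale1r.
by move=> p; rewrite inE => /eqP ->.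
Qed.

Lemma sigma_ge0 n u : sigma n -> u \in L -> 0 <= pairing (rp u) n.
Proof. by move=> sn /cone_of_in; apply: sn. Qed.

Lemma sigmaP n : sigma n <-> {in s, forall g, 0 <= pairing (rp g) n}.
Proof.
split=> [sn g gs|h x [t tL ->]]; first by apply: sigma_ge0 => //; exact: (gen_in s_gen).
rewrite pairing_dot dot_suml big_seq; apply: sumr_ge0 => p /tL [p0 pL].
rewrite dotZl mulr_ge0 //; have [c ->] := (s_gen p.2).1 pL.
rewrite rp_sum dot_suml; apply: sumr_ge0 => i _.
by rewrite rpMn dotZl mulr_ge0 ?ler0n // h // mem_nth.
Qed.

(** A point in the relative interior of the face of the semigroup that is dual
    to [theta]. *)
Definition face_point theta : M := \sum_(g <- s | g \in orthogonal_lattice theta) g.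

Lemma orthP theta u : u \in orthogonal_lattice theta <->
  forall n, theta n -> pairing (rp u) n = 0.
Proof. by split; [move/asboolP|move=> h; apply/asboolP]. Qed.

Lemma face_point_in theta : face_point theta \in L.
Proof.
rewrite /face_point big_seq_cond; apply: rpred_sum => g /andP[gs _].
exact: (gen_in s_gen).
Qed.

Lemma face_point_orth theta : face_point theta \in orthogonal_lattice theta.
Proof. by apply: rpred_sum. Qed.

Lemma face_sub theta n : faces sigma theta -> theta n -> sigma n.
Proof. by move=> [x _ ->] []. Qed.

Lemma face_gen_eq0 theta n : sigma n -> pairing (rp (face_point theta)) n = 0 ->
  {in s, forall g, g \in orthogonal_lattice theta -> pairing (rp g) n = 0}.
Proof.
move=> sn; rewrite /face_point rp_sum pairing_dot dot_suml big_seq_cond => /eqP.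
rewrite psumr_eq0 => [/allP h g gs go|g /andP[gs _]]; last first.
  by apply: sigma_ge0 => //; exact: (gen_in s_gen).
by apply/eqP; have := h g gs; rewrite gs go.
Qed.

(** The vector [x] cutting out [theta] need not be integral.  By [farkas] it is a
    nonnegative combination of generators, and those that occur vanish on
    [theta], so they are summands of [face_point theta]. *)
Lemma faceE theta n : faces sigma theta ->
  theta n <-> sigma n /\ pairing (rp (face_point theta)) n = 0.
Proof.
move=> ft; split=> [tn|[sn pn]].
  by split; [exact: face_sub tn|have /orthP := face_point_orth theta; apply].
have [x x0 te] := ft; rewrite te; split=> //=.
have [/conic_sum [a a0 xE]|[y [y1 y2]]] := farkas (map rp s) x; last first.
  have /x0 : sigma y by apply/sigmaP => g gs; apply: y1; exact: map_f.
  by rewrite leNgt => /negP[].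
have term m (i : 'I_(size (map rp s))) : sigma m ->
    0 <= dot (a i *: (map rp s)`_i) m.
  move=> sm; rewrite dotZl mulr_ge0 //; have hi : (i < size s)%N := leq_trans (ltn_ord i) (eq_leq (size_map rp s)).
  rewrite (nth_map 0) //; apply: (sigma_ge0 sm); apply: (gen_in s_gen).
  exact: mem_nth.
rewrite pairing_dot xE dot_suml; apply: big1 => i _; rewrite dotZl.
have hi : (i < size s)%N := leq_trans (ltn_ord i) (eq_leq (size_map rp s)).
have [->|ai] := eqVneq (a i) 0; first by rewrite mul0r.
rewrite (nth_map 0) //; apply/eqP; rewrite mulf_eq0 (negPf ai) /=; apply/eqP.
apply: (face_gen_eq0 sn pn); first exact: mem_nth.
apply/orthP => m tm; have sm := face_sub ft tm.
have : dot x m = 0 by move: tm; rewrite te => -[].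
rewrite xE dot_suml => /eqP; rewrite psumr_eq0 => [/allP h|j _]; last exact: term.
have := h i; rewrite mem_index_enum dotZl mulf_eq0 (negPf ai) (nth_map 0) //.
by move=> /(_ isT) /eqP.
Qed.

Lemma face_ext theta theta' : faces sigma theta -> faces sigma theta' ->
  (forall u, u \in L -> (u \in orthogonal_lattice theta) = (u \in orthogonal_lattice theta')) ->
  theta = theta'.
Proof.
move=> ft ft' e; have ee : face_point theta = face_point theta'.
  rewrite /face_point big_seq_cond [RHS]big_seq_cond; apply: eq_bigl => g.
  by case gs: (g \in s) => //=; apply: e; exact: (gen_in s_gen).
apply/seteqP; split=> n.
  by move/(faceE n ft); rewrite ee => h; apply/(faceE n ft').
by move/(faceE n ft'); rewrite -ee => h; apply/(faceE n ft).
Qed.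

(** By [faceE] a face is determined by the set of generators orthogonal to it. *)
Lemma faces_finite : finite_set (faces sigma).
Proof.
pose f (b : {set 'I_(size s)}) :=
  sigma `&` [set n | pairing (rp (\sum_(i in b) s`_i)) n = 0].
apply: (@sub_finite_set _ _ (f @` setT)); last exact: finite_image.
move=> theta ft; exists [set i : 'I_(size s) | s`_i \in orthogonal_lattice theta]%SET => //.
rewrite /f (_ : \sum_(i in _) _ = face_point theta).
  by apply/seteqP; split=> n /= /(faceE n ft).
rewrite /face_point (big_nth 0) big_mkord; apply: eq_bigl => i.
by rewrite inE.
Qed.

(** Real functionals include the rational ones to which [int_farkas] refers. *)
Lemma face_farkas (x u : M) : x \in L ->
  (forall n, sigma n -> pairing (rp x) n = 0 -> 0 <= pairing (rp u) n) ->
  exists N C, (0 < N)%N /\ u *+ N + x *+ C \in L.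
Proof.
move=> xL h; apply: (int_farkas s_gen) => // y sy xy.
rewrite -(ler0q R) -pair_rat; apply: h; last by rewrite pair_rat xy rmorph0.
by apply/sigmaP => g gs; rewrite pair_rat ler0q; apply: sy.
Qed.

(** A face [f] of the monoid [L] cuts out the face of [sigma] on which the sum
    [x] of the generators in [f] vanishes.  An element [u] of [L] that is zero
    there has its opposite in the semigroup with [x] inverted, so [u *+ N]
    divides a multiple of [x], which is in [f]. *)
Lemma monoid_face (f : M -> Prop) : f 0 ->
  (forall u v, u \in L -> v \in L -> f (u + v) <-> f u /\ f v) ->
  exists2 theta, faces sigma theta &
    forall u, u \in L -> f u <-> u \in orthogonal_lattice theta.
Proof.
move=> f0 fD.
have fMn u m : u \in L -> (0 < m)%N -> f (u *+ m) <-> f u.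
  move=> uL; elim: m => // -[|m] IH _; first by rewrite mulr1n.
  by rewrite mulrS fD ?rpredMn // IH //; split=> [[]|].
have fsum (I : eqType) (r : seq I) (G : I -> M) : {in r, forall i, G i \in L} ->
   f (\sum_(i <- r) G i) <-> {in r, forall i, f (G i)}.
  elim: r => [|i r IH] h; first by rewrite big_nil.
  have hr : {in r, forall i, G i \in L} by move=> j jr; apply: h; rewrite inE jr orbT.
  rewrite big_cons fD; last 2 first.
  - by apply: h; rewrite mem_head.
  - by rewrite big_seq; apply: rpred_sum.
  rewrite IH //; split=> [[fi fr] j|hh]; first by rewrite inE => /predU1P[->|/fr].
  by split; [apply: hh; rewrite mem_head|move=> j jr; apply: hh; rewrite inE jr orbT].
pose t := [seq g <- s | `[< f g >]].
pose x := \sum_(g <- t) g.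
have tL : {in t, forall g, g \in L}.
  by move=> g; rewrite mem_filter => /andP[_]; exact: (gen_in s_gen).
have xL : x \in L by rewrite /x big_seq; apply: rpred_sum.
have fx : f x by apply/fsum => // g; rewrite mem_filter => /andP[/asboolP].
pose theta := sigma `&` [set n | pairing (rp x) n = 0].
exists theta.
  by exists (rp x) => // n sn; exact: sigma_ge0.
move=> u uL; split=> [fu|/orthP uo].
  apply/orthP => n [sn /= xn].
  have tn g : g \in t -> pairing (rp g) n = 0.
    move=> gt; move: xn; rewrite /x rp_sum pairing_dot dot_suml big_seq => /eqP.
    rewrite psumr_eq0 => [/allP /(_ g gt)|h ht]; first by rewrite gt => /eqP.
    by apply: sigma_ge0 => //; exact: tL.
  have [c uE] := (s_gen u).1 uL; move: fu; rewrite uE => /fsum fu.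
  rewrite rp_sum pairing_dot dot_suml; apply: big1 => i _; rewrite rpMn dotZl.
  have [->|ci] := eqVneq (c i) 0%N; first by rewrite mul0r.
  have gi : s`_i \in s by exact: mem_nth.
  rewrite -pairing_dot tn ?mulr0 // mem_filter gi andbT; apply/asboolP.
  apply/(fMn _ (c i)); [exact: (gen_in s_gen)|by rewrite lt0n|].
  by apply: fu; rewrite ?mem_index_enum // => j _; rewrite rpredMn // (gen_in s_gen) // mem_nth.
have [|N [C [N0 h]]] := @face_farkas x (- u) xL.
  move=> n sn xn; rewrite pairing_dot -[- u]sub0r real_pointB real_point0 sub0r dotNl.
  by rewrite -pairing_dot uo ?oppr0.
have : f ((- u *+ N + x *+ C) + u *+ N).
  rewrite addrC addrA -mulrnDl subrr mul0rn add0r.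
  by case: C {h} => [|C]; rewrite ?mulr0n // fMn.
by rewrite fD ?rpredMn // => -[_] /fMn; apply.
Qed.

Hypothesis L_sat : forall u N, (0 < N)%N -> u *+ N \in L -> u \in L.

(** This is where saturation enters: [int_farkas] only yields a multiple of [u]. *)
Lemma face_lift theta u : faces sigma theta ->
  (forall n, theta n -> 0 <= pairing (rp u) n) ->
  exists C, u + face_point theta *+ C \in L.
Proof.
move=> ft h; have [|N [C [N0 hN]]] := @face_farkas (face_point theta) u (face_point_in theta).
  by move=> n sn xn; apply: h; apply/faceE.
exists C; apply: (@L_sat _ N) => //.
case: N N0 hN => // N _ hN.
rewrite mulrnDl [X in _ + X]mulrS addrA; apply: rpredD; first exact: hN.
by rewrite !rpredMn // face_point_in.
Qed.

(** A point of [M / O] lies in the cone of [theta] when it is nonnegative on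
    [theta], and then every lift of it enters [L] once enough multiples of
    [face_point theta] are added. *)
Lemma quotient_coneP theta u : faces sigma theta ->
  ((\pi_(quotient_lattice theta) u)%qT \in @quotient_cone R d L theta) <->
  exists C, u + face_point theta *+ C \in L.
Proof.
move=> ft; split=> [/asboolP[u' [x [e cx ox]]]|[C hC]].
  apply: face_lift => // n tn.
  have /orthP /(_ n tn) : u - u' \in orthogonal_lattice theta.
    by rewrite Quotient.idealrBE; apply/eqP.
  have := ox n tn; rewrite !pairing_dot real_pointB !dotBl => /eqP.
  rewrite subr_eq0 => /eqP e1 /eqP; rewrite subr_eq0 => /eqP ->.
  by rewrite e1; exact: (face_sub ft tn).
apply/asboolP; exists u, (rp (u + face_point theta *+ C)); split=> //.
  exact: cone_of_in.
move=> n tn; rewrite pairing_dot real_pointD opprD addrA subrr sub0r dotNl rpMn dotZl.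
have /orthP /(_ n tn) := face_point_orth theta; rewrite pairing_dot => ->.
by rewrite mulr0 oppr0.
Qed.

End Faces.

(** * Saturation, and the splitting of the lattice at a face *)

(** The equation [X^N = w] is an integral equation for [x / y]. *)
Lemma normal_root (A : comNzRingType) (x y w : A) N : normal_domain A ->
  (0 < N)%N -> y != 0 -> x ^+ N = w * y ^+ N -> exists h, x = h * y.
Proof.
move=> [_ nrm] N0 y0 e.
apply: (nrm N (fun i => if i == 0%N :> nat then - w else 0) x y y0).
rewrite (bigD1 (Ordinal N0)) //= big1 ?addr0 => [|i i0].
  by rewrite expr0 mulr1 subn0 mulNr e subrr.
by rewrite -[_ == 0%N]/(i == Ordinal N0) (negPf i0) !mul0r.
Qed.

Section Saturation.
Variables (d : nat) (L : addrClosed 'rV[int]_d).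
Local Notation M := 'rV[int]_d.

Definition differences : {pred M} := [pred u | `[< exists a b, [/\ a \in L, b \in L & u = a - b] >]].

Fact differences_zmod : zmod_closed differences.
Proof.
split=> [|u v]; first by apply/asboolP; exists 0, 0; rewrite rpred0 subrr.
move=> /asboolP[a [b [aL bL ->]]] /asboolP[a' [b' [aL' bL' ->]]]; apply/asboolP.
exists (a + b'), (b + a'); rewrite !rpredD //; split=> //.
by rewrite opprB opprD addrACA.
Qed.
HB.instance Definition _ := GRing.isZmodClosed.Build M differences differences_zmod.

Lemma generates_differences : generates_lattice L -> forall u : M,
  exists a b, [/\ a \in L, b \in L & u = a - b].
Proof.
move=> h u; apply/asboolP; apply: (h differences) => v vL.
by apply/asboolP; exists v, 0; rewrite rpred0 subr0.
Qed.

Lemma msupp_mul_monomial (k : comNzRingType) (K : nmodType) (h : monoid_algebra k K) (b a : K) :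
  monomial k a = h * monomial k b -> exists v, a = v + b.
Proof.
move=> e; apply: contrapT => /forallNP ne.
have : mcoeff a (h * monomial k b) = 0.
  have sb : fsubset (msupp (monomial k b)) (fset1 b) by exact: msuppU_le.
  have -> : h * monomial k b = _ := ma_mulw (fsubset_refl (msupp h)) sb.
  rewrite raddf_sum /= big1 // => v _.
  rewrite big_seq_fset1 mcoeffU; case: eqP => [va|]; last by rewrite mulr0n.
  by case: (ne v).
by rewrite -e mcoeffUU => /eqP; rewrite oner_eq0.
Qed.

(** Write [u] as a difference [a - b] of elements of [L].  Then [X^a / X^b] has
    its [N]-th power in the ring, hence belongs to the ring by normality. *)
Lemma normal_saturated (k : comNzRingType) :
  generates_lattice L -> normal_domain (monoid_algebra k (submonoid L)) ->
  forall (u : M) N, (0 < N)%N -> u *+ N \in L -> u \in L.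
Proof.
move=> /generates_differences gen nrm u N N0 uN.
have [a [b [aL bL uE]]] := gen u.
pose A := Submonoid aL; pose B := Submonoid bL; pose W := Submonoid uN.
have nz : monomial k B != 0 by rewrite monalgU_eq0 oner_eq0.
have eA := monomialMn k A N; have eB := monomialMn k B N.
have eW := monomialD k W (B *+ N).
have AWB : A *+ N = W + B *+ N.
  by apply: val_inj; rewrite raddfD !raddfMn /= uE mulrnBl subrK.
have e2 := congr1 (fun l => monomial k l) AWB.
have e3 := congr1 (fun y => monomial k W * y) eB.
have key := etrans (esym eA) (etrans e2 (etrans eW e3)).
have [h hE] := normal_root nrm N0 nz key.
have [v vE] := msupp_mul_monomial hE.
have -> : u = val v by have := congr1 val vE; rewrite raddfD /= uE => ->; rewrite addrK.
exact: valP.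
Qed.

End Saturation.

Section Splitting.
Variables (R : realType) (d : nat).
Local Notation M := 'rV[int]_d.
Variables (L : addrClosed M) (s : seq M).
Hypothesis s_gen : forall u, u \in L <->
    exists c : 'I_(size s) -> nat, u = \sum_(i < size s) s`_i *+ c i.
Hypothesis L_sat : forall (u : M) N, (0 < N)%N -> u *+ N \in L -> u \in L.
Local Notation rp := (@real_point R d).
Local Notation sigma := (dual_cone (cone_of R L)).
Variable theta : set 'cV[R]_d.
Hypothesis ft : faces sigma theta.
Local Notation O := (orthogonal_lattice theta).
Local Notation x0 := (face_point s theta).

Let t := [seq g <- s | g \in O].
Let B : 'M[int]_(size t, d) := \matrix_(i, j) t`_i 0 j.

Definition row_span p (A : 'M[int]_(p, d)) (u : M) := exists c : 'rV[int]_p, u = c *m A.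

Lemma row_spanD p (A : 'M[int]_(p, d)) u v : row_span A u -> row_span A v -> row_span A (u + v).
Proof. by move=> [c ->] [e ->]; exists (c + e); rewrite mulmxDl. Qed.
Lemma row_spanN p (A : 'M[int]_(p, d)) u : row_span A u -> row_span A (- u).
Proof. by move=> [c ->]; exists (- c); rewrite mulNmx. Qed.
Lemma row_span0 p (A : 'M[int]_(p, d)) : row_span A 0.
Proof. by exists 0; rewrite mul0mx. Qed.
Lemma row_spanMn p (A : 'M[int]_(p, d)) u m : row_span A u -> row_span A (u *+ m).
Proof.
move=> h; elim: m => [|m IH]; first by rewrite mulr0n; exact: row_span0.
by rewrite mulrS; apply: row_spanD.
Qed.

(** The generators in the orthogonal lattice span it as a group: by [face_lift]
    an orthogonal [u] becomes an element of [L] when a multiple of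
    [face_point theta] is added, and then only orthogonal generators occur. *)
Lemma orth_gen_span u : u \in O -> row_span B u.
Proof.
move=> uO; have [|C lL] := face_lift s_gen L_sat (u := u) ft.
  by move=> n tn; have /orthP /(_ n tn) -> := uO.
have tB g : g \in t -> row_span B g.
  move=> gt; have gi : (index g t < size t)%N by rewrite index_mem.
  exists (delta_mx 0 (Ordinal gi)); rewrite -rowE; apply/rowP => j.
  by rewrite !mxE /= nth_index.
have xB : row_span B x0.
  rewrite /face_point -big_filter big_seq; elim/big_ind: _ => [|v w|g].
  - exact: row_span0.
  - exact: row_spanD.
  - exact: tB.
have lO : u + x0 *+ C \in O.
  by rewrite rpredD // rpredMn // face_point_orth.
rewrite -[u](addrK (x0 *+ C)); apply: row_spanD; last exact/row_spanN/row_spanMn.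
move: lL lO; move: (u + _) => {uO}l; move=> lL lO.
have [c lE] := (s_gen l).1 lL; rewrite lE.
elim/big_ind: _ => [|v w|i _]; [exact: row_span0|exact: row_spanD|].
have [->|ci] := eqVneq (c i) 0%N; first by rewrite mulr0n; exact: row_span0.
apply: row_spanMn; apply: tB; rewrite mem_filter mem_nth ?andbT //.
apply/orthP => n tn; have sn := face_sub ft tn.
have := (orthP _ _).1 lO n tn; rewrite lE rp_sum pairing_dot dot_suml => /eqP.
rewrite psumr_eq0 => [/allP /(_ i)|j _].
  rewrite mem_index_enum rpMn dotZl mulf_eq0 pnatr_eq0 (negPf ci) /=.
  by move=> /(_ isT) /eqP.
rewrite rpMn dotZl mulr_ge0 ?ler0n //; apply: (sigma_ge0 sn).
by apply: (gen_in s_gen); exact: mem_nth.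
Qed.

Lemma orth_scale (z : int) u : z != 0 -> z *: u \in O -> u \in O.
Proof.
move=> z0 /orthP h; apply/orthP => n tn; have := h n tn.
have -> : rp (z *: u) = z%:~R *: rp u by apply/rowP => i; rewrite !mxE intrM.
rewrite pairing_dot dotZl => /eqP; rewrite mulf_eq0 intr_eq0 (negPf z0) /=.
by move/eqP.
Qed.

Lemma orth_row_span u : row_span B u -> u \in O.
Proof.
move=> [c ->]; rewrite mulmx_sum_row; apply: rpred_sum => i _.
have tO : row i B \in O.
  have : t`_i \in t by exact: mem_nth.
  rewrite mem_filter => /andP[tO _]; suff -> : row i B = t`_i by [].
  by apply/rowP => j; rewrite !mxE.
by rewrite -[c 0 i]intz scaler_int rpredMz.
Qed.

(** Smith's normal form of the matrix of generators gives a basis of the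
    lattice, the rows of [Q].  As the orthogonal lattice is saturated, the basis
    vectors with nonzero elementary divisor are a basis of it. *)
Lemma adapted_basis : exists (Q : 'M[int]_d) (S : {set 'I_d}), Q \in unitmx /\
  forall u, u \in O <-> forall j, j \notin S -> (u *m invmx Q) 0 j = 0.
Proof.
have [P Pu [Q Qu [e _ BE]]] := int_Smith_normal_form B.
set Delta := (\matrix_(i, j) _) in BE.
exists Q, [set j : 'I_d | (j < size t)%N && (e`_j != 0)]%SET; split=> // u; split.
  move=> /orth_gen_span [c ->] j; rewrite BE inE => jS.
  rewrite -!mulmxA mulmxV // mulmx1 mulmxA mxE big1 // => i _; rewrite [Delta _ _]mxE.
  have [ij|_] := eqVneq (i : nat) (j : nat); last by rewrite mulr0n mulr0.
  by move: jS; rewrite -ij ltn_ord /= negbK => /eqP ->; rewrite mul0rn mulr0.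
move=> h; rewrite -[u](mulmxKV Qu) mulmx_sum_row; apply: rpred_sum => j _.
have [jS|/h ->] := boolP (j \in [set j : 'I_d | (j < size t)%N && (e`_j != 0)]%SET); last first.
  by rewrite scale0r rpred0.
rewrite -[_ 0 j]intz scaler_int rpredMz //.
move: jS; rewrite inE => /andP[jt ej]; apply: (orth_scale ej).
apply: orth_row_span; exists (row (Ordinal jt) (invmx P)).
rewrite -row_mul BE -mulmxA mulKmx // row_mul; apply/rowP => l.
rewrite !mxE (bigD1 j) //= !mxE eqxx mulr1n big1 ?addr0 // => i ij.
rewrite !mxE; have [e'|_] := eqVneq (j : nat) (i : nat); last by rewrite mulr0n mul0r.
by case/eqP: ij; apply: val_inj; exact: esym e'.
Qed.

Section Basis.
Variables (Q : 'M[int]_d) (S : {set 'I_d}).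
Hypothesis Qu : Q \in unitmx.
Hypothesis OE : forall u, u \in O <-> forall j, j \notin S -> (u *m invmx Q) 0 j = 0.

Lemma basis_in j : j \in S -> row j Q \in O.
Proof.
move=> jS; apply/OE => l lS; rewrite rowE -mulmxA mulmxV // mulmx1 mxE /=.
by case: eqP => // e; rewrite e jS in lS.
Qed.

Let QS : 'M[R]_(#|S|, d) := \matrix_(i, j) (Q (enum_val i) j)%:~R.

Lemma QS_rank : \rank QS = #|S|.
Proof.
apply/eqP; apply/row_freeP.
exists (\matrix_(j, i) ((invmx Q) j (enum_val i))%:~R).
apply/matrixP => i l; rewrite !mxE.
under eq_bigr do rewrite !mxE -intrM.
rewrite -rmorph_sum /=; have := congr1 (fun A : 'M[int]_d => A (enum_val i) (enum_val l)) (mulmxV Qu).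
rewrite !mxE => ->; rewrite (inj_eq enum_val_inj); by case: eqP.
Qed.

Lemma orth_QS u : u \in O -> (rp u <= QS)%MS.
Proof.
move=> /OE h; rewrite -[u](mulmxKV Qu) mulmx_sum_row rp_sum.
apply: summx_sub => j _.
have -> : rp ((u *m invmx Q) 0 j *: row j Q) = ((u *m invmx Q) 0 j)%:~R *: rp (row j Q).
  by apply/rowP => l; rewrite [LHS]mxE [in LHS]mxE intrM !mxE.
have [jS|/h ->] := boolP (j \in S); last by rewrite scale0r sub0mx.
apply: scalemx_sub; have -> : rp (row j Q) = row (enum_rank_in jS j) QS.
  by apply/rowP => l; rewrite !mxE enum_rankK_in.
exact: row_sub.
Qed.

(** As [y] is nonnegative on [theta], Farkas' lemma writes it with the generators
    and the opposite of [face_point theta]; as it vanishes on [theta], only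
    generators orthogonal to [theta] occur. *)
Lemma orthogonal_QS (y : 'rV[R]_d) : Defs.orthogonal theta y -> (y <= QS)%MS.
Proof.
move=> oy.
have [|[n [n1 n2]]] := farkas (- rp x0 :: map rp s) y; last first.
  have sn : sigma n.
    by apply/sigmaP => // g gs; apply: n1; rewrite inE map_f ?orbT.
  have tn : theta n.
    apply/(faceE s_gen n ft); split=> //; apply/eqP; rewrite eq_le.
    rewrite (sigma_ge0 sn (face_point_in s_gen theta)) andbT.
    by have := n1 _ (mem_head _ _); rewrite dotNl oppr_ge0.
  by have := oy n tn; rewrite pairing_dot => e; rewrite e ltxx in n2.
move=> [b b0 /conic_sum [a a0 yE]].
have -> : y = (\sum_(i < size (map rp s)) a i *: (map rp s)`_i) - b *: rp x0.
  by rewrite -yE scalerN opprK addrK.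
apply: addmx_sub; last first.
  rewrite eqmx_opp; apply: scalemx_sub; apply: orth_QS; exact: face_point_orth.
apply: summx_sub => i _.
have hi : (i < size s)%N := leq_trans (ltn_ord i) (eq_leq (size_map rp s)).
have [->|ai] := eqVneq (a i) 0; first by rewrite scale0r sub0mx.
rewrite (nth_map 0) //; apply: scalemx_sub; apply: orth_QS; apply/orthP => n tn.
have sn := face_sub ft tn.
have : dot (\sum_(i < size (map rp s)) a i *: (map rp s)`_i) n = 0.
  rewrite -yE scalerN opprK dotDl dotZl -!pairing_dot oy //.
  by have [_ ->] := (faceE s_gen n ft).1 tn; rewrite mulr0 addr0.
rewrite dot_suml => /eqP; rewrite psumr_eq0 => [/allP /(_ i)|j _].
  rewrite mem_index_enum dotZl mulf_eq0 (negPf ai) (nth_map 0) //= => /(_ isT).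
  by move/eqP.
have hj : (j < size s)%N := leq_trans (ltn_ord j) (eq_leq (size_map rp s)).
rewrite dotZl mulr_ge0 // (nth_map 0) //; apply: (sigma_ge0 sn).
by apply: (gen_in s_gen); exact: mem_nth.
Qed.

Let mxtup n (X : n.-tuple 'cV[R]_d) : 'M[R]_(d, n) := \matrix_(i, j) X`_j i 0.

Lemma mxtup_rank n (X : n.-tuple 'cV[R]_d) : free X -> \rank (mxtup X) = n.
Proof.
move=> /freeP fX; rewrite -mxrank_tr; apply/eqP; apply: inj_row_free => v e.
apply/rowP => i; rewrite mxE; apply: (fX (fun i => v 0 i)).
apply/colP => j; move/rowP/(_ j): e; rewrite !mxE => e; rewrite summxE -[RHS]e.
by apply: eq_bigr => l _; rewrite !mxE.
Qed.

Lemma dot_mxtup n (X : n.-tuple 'cV[R]_d) (y : 'rV[R]_d) i : (y *m mxtup X) 0 i = dot y X`_i.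
Proof. by rewrite /dot !mxE; apply: eq_bigr => j _; rewrite !mxE. Qed.

(** Both inequalities express that the span of [theta] and the space spanned by
    the rows of [QS] are the orthogonals of each other. *)
Lemma span_dim_face : span_dim theta = (d - #|S|)%N.
Proof.
have upper n (X : n.-tuple 'cV[R]_d) : free X -> {in X, forall v, theta v} -> (n <= d - #|S|)%N.
  move=> fX Xt; have /mulmx0_rank_max : QS *m mxtup X = 0.
    apply/row_matrixP => i; rewrite row_mul row0; apply/rowP => j.
    rewrite dot_mxtup [RHS]mxE -pairing_dot.
    have -> : row i QS = rp (row (enum_val i) Q) by apply/rowP => l; rewrite !mxE.
    have /orthP := basis_in (enum_valP i); apply; apply: Xt.
    by apply: mem_nth; rewrite size_tuple.
  by rewrite QS_rank mxtup_rank //; lia.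
apply/eqP; rewrite eqn_leq; apply/andP; split.
  by apply/bigmax_leqP => n /asboolP[X fX Xt]; exact: upper fX Xt.
pose D := (\dim {:'cV[R]_d}).+1.
pose P (n : 'I_D) : bool := `[< exists2 X : n.-tuple 'cV[R]_d, free X & {in X, forall v, theta v} >].
rewrite -[span_dim theta]/(\max_(n < D | P n) n).
have P0 : P ord0.
  by apply/asboolP; exists [tuple]; rewrite ?nil_free.
have [|n Pn maxE] := @eq_bigmax_cond _ P (fun n : 'I_D => n : nat).
  by apply/card_gt0P; exists ord0.
have /asboolP [X fX Xt] := Pn.
have Xmax v : theta v -> v \in <<X>>%VS.
  move=> tv; apply: contraT => vX.
  have fvX : free [tuple of v :: X] by rewrite free_cons vX fX.
  have nD : (n.+1 < D)%N.
    have := dimvS (subvf <<[tuple of v :: X]>>%VS).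
    by rewrite (eqP fvX) size_tuple /D ltnS.
  have Pn1 : P (Ordinal nD).
    apply/asboolP; exists [tuple of v :: X] => // w.
    by rewrite inE => /predU1P[->|/Xt].
  have /= n1 := @leq_bigmax_cond _ P (fun n : 'I_D => n : nat) (Ordinal nD) Pn1.
  by rewrite maxE ltnn in n1.
have ker : (kermx (mxtup X) <= QS)%MS.
  apply/row_subP => i; apply: orthogonal_QS => v /Xmax vX.
  rewrite (coord_span vX) /pairing mulmx_sumr summxE big1 // => j _.
  rewrite -scalemxAr mxE -/(dot _ _) -dot_mxtup -row_mul mulmx_ker.
  by rewrite !mxE mulr0.
rewrite maxE; have := mxrankS ker; rewrite mxrank_ker QS_rank mxtup_rank //; lia.
Qed.

End Basis.

(** The lattice is the direct sum of the orthogonal lattice, with basis [e] and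
    coordinates [z], and of a complement, the image of the projection [sec]. *)
Lemma face_splitting : exists (e : 'I_(codim theta) -> M)
    (z : M -> 'I_(codim theta) -> int) (sec : M -> M),
  [/\ forall i, e i \in O, forall i j, z (e i) j = (i == j)%:R,
      forall u v i, z (u + v) i = z u i + z v i & forall u i, z (sec u) i = 0] /\
  [/\ forall u v, sec (u + v) = sec u + sec v, forall u, u \in O -> sec u = 0 &
     forall u, u = sec u + \sum_i e i *~ z u i].
Proof.
have [Q [S [Qu OE]]] := adapted_basis.
have cE : codim theta = #|S|.
  rewrite /codim (span_dim_face Qu OE) subKn //.
  by rewrite -[X in (_ <= X)%N]card_ord max_card.
pose ev i : 'I_d := enum_val (cast_ord cE i).
have evS i : ev i \in S by exact: enum_valP.
have ev_inj : injective ev by move=> i j /enum_val_inj /cast_ord_inj.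
pose w u : 'rV[int]_d := u *m invmx Q.
have wD u v : w (u + v) = w u + w v by rewrite /w mulmxDl.
have w_row j l : w (row j Q) 0 l = (j == l)%:R.
  by rewrite /w rowE -mulmxA mulmxV // mulmx1 mxE eq_sym.
have uE u : u = \sum_j w u 0 j *: row j Q.
  by rewrite -mulmx_sum_row /w mulmxKV.
pose sec u := \sum_(j | j \notin S) w u 0 j *: row j Q.
have w0 : w 0 = 0 by rewrite /w mul0mx.
have w_sec u j : w (sec u) 0 j = if j \in S then 0 else w u 0 j.
  rewrite /w /sec mulmx_suml summxE.
  under eq_bigr => l _ do rewrite -scalemxAl mxE -/(w _) w_row.
  case: ifPn => jS.
    by rewrite big1 // => l lS; have [e|_] := eqVneq l j; rewrite ?mulr0 //; move: lS; rewrite e jS.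
  rewrite (bigD1 j) //= eqxx mulr1 big1 ?addr0 // => l /andP[_ /negPf ->].
  by rewrite mulr0.
exists (fun i => row (ev i) Q), (fun u i => w u 0 (ev i)), sec.
split; split.
- by move=> i; exact: (basis_in Qu OE).
- by move=> i j; rewrite w_row (inj_eq ev_inj).
- by move=> u v i; rewrite wD mxE.
- by move=> u i; rewrite w_sec evS.
- move=> u v; rewrite /sec -big_split; apply: eq_bigr => j _.
  by rewrite wD mxE scalerDl.
- by move=> u /OE h; rewrite /sec big1 // => j jS; rewrite /w h // scale0r.
- move=> u; rewrite {1}(uE u) (bigID (mem S)) /= addrC; congr (_ + _).
  rewrite (big_enum_val (fun j => w u 0 j *: row j Q)).
  rewrite (reindex (cast_ord cE)) /=; last first.
    by exists (cast_ord (esym cE)) => i _; rewrite ?cast_ordK ?cast_ordKV.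
  by apply: eq_bigr => i _; rewrite -scaler_int intz.
Qed.
End Splitting.

(** * Characters with support on a face and characters at the origin *)

(** The situation of a face: [pi] is the quotient by the orthogonal lattice, [G]
    the image of [L] with [x0] inverted, [e] and [z] a basis of the kernel of
    [pi] and its coordinates, and [sec] an additive section of [pi]. *)
Section Correspondence.
Variables (k : closedFieldType) (M Qt : zmodType) (pi : {additive M -> Qt}).
Variables (L : addrClosed M) (G : addrClosed Qt) (c : nat).
Variables (e : 'I_c -> M) (z : M -> 'I_c -> int) (sec : Qt -> M) (x0 : M).
Hypothesis x0L : x0 \in L.
Hypothesis pi_x0 : pi x0 = 0.
Hypothesis GP : forall u, pi u \in G <-> exists C, u + x0 *+ C \in L.
Hypothesis pi_e : forall i, pi (e i) = 0.
Hypothesis z_e : forall i j, z (e i) j = (i == j)%:R.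
Hypothesis zD : forall u v i, z (u + v) i = z u i + z v i.
Hypothesis z_sec : forall q i, z (sec q) i = 0.
Hypothesis pi_sec : forall q, pi (sec q) = q.
Hypothesis secD : forall p q, sec (p + q) = sec p + sec q.
Hypothesis uE : forall u, u = sec (pi u) + \sum_i e i *~ z u i.

Local Notation Ls := (submonoid L).
Local Notation Gs := (submonoid G).
Local Notation Lam := ((Gs * {ffun 'I_c -> nat})%type : nmodType).

Definition x0s : Ls := Submonoid x0L.

Lemma val_submonoidD (V : nmodType) (T : addrClosed V) (l l' : submonoid T) :
  val (l + l') = val l + val l'.
Proof. by rewrite raddfD. Qed.
Lemma val_submonoidMn (V : nmodType) (T : addrClosed V) (l : submonoid T) n :
  val (l *+ n) = val l *+ n.
Proof. by rewrite raddfMn. Qed.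
Lemma val_submonoid0 (V : nmodType) (T : addrClosed V) : val (0 : submonoid T) = 0.
Proof. by rewrite raddf0. Qed.

Lemma val_submonoid_sum (V : nmodType) (T : addrClosed V) (I : Type) (r : seq I) (F : I -> submonoid T) :
  val (\sum_(i <- r) F i) = \sum_(i <- r) val (F i).
Proof. exact: (big_morph val (@val_submonoidD V T) (@val_submonoid0 V T)). Qed.

Lemma pi_in (l : Ls) : pi (val l) \in G.
Proof. by apply/GP; exists 0%N; rewrite mulr0n addr0; exact: valP. Qed.

Lemma ker_in u : pi u = 0 -> pi u \in G.
Proof. by move=> ->; exact: rpred0. Qed.

Definition cone_elt (q : Qt) : Gs := insubd 0 q.
Lemma cone_eltK q : q \in G -> val (cone_elt q) = q.
Proof. by move=> qG; rewrite /cone_elt insubdK. Qed.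
Lemma cone_elt_val (g : Gs) : cone_elt (val g) = g.
Proof. by apply: val_inj; rewrite cone_eltK //; exact: valP. Qed.
Lemma cone_eltD p q : p \in G -> q \in G -> cone_elt (p + q) = cone_elt p + cone_elt q.
Proof.
by move=> pG qG; apply: val_inj; rewrite val_submonoidD !cone_eltK // rpredD.
Qed.
Lemma cone_elt0 : cone_elt 0 = 0.
Proof. by apply: val_inj; rewrite val_submonoid0 cone_eltK ?rpred0. Qed.

Lemma sec0 : sec 0 = 0.
Proof. by apply: (addrI (sec 0)); rewrite -secD !addr0. Qed.

(** The free generators of the second factor. *)
Definition delta i : Lam := (0, [ffun j => (j == i) : nat]).

Lemma delta_sum (v : {ffun 'I_c -> nat}) : \sum_i delta i *+ v i = (0, v) :> Lam.
Proof.
have sum1 (r : seq 'I_c) : (\sum_(i <- r) delta i *+ v i).1 = 0.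
  elim: r => [|i r IH]; first by rewrite big_nil.
  rewrite big_cons -[LHS]/((delta i *+ v i).1 + (\sum_(j <- r) delta j *+ v j).1) IH addr0.
  by elim: (v i) => [//|n IHn]; rewrite mulrS -[LHS]/(0 + (delta i *+ n).1) IHn addr0.
have sum2 (r : seq 'I_c) j : (\sum_(i <- r) delta i *+ v i).2 j = (\sum_(i <- r) (j == i) * v i)%N.
  elim: r => [|i r IH]; first by rewrite !big_nil ffunE.
  rewrite !big_cons -[in LHS]/((delta i *+ v i).2 + (\sum_(l <- r) delta l *+ v l).2).
  rewrite ffunE IH; apply: (congr2 addn) => //; elim: (v i) => [|n IHn]; first by rewrite muln0 ffunE.
  by rewrite mulrS -[in LHS]/((delta i).2 + (delta i *+ n).2) ffunE IHn ffunE mulnS.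
rewrite [LHS]surjective_pairing; congr (_, _); first exact: sum1.
apply/ffunP => j; rewrite sum2 (bigD1 j) //= eqxx mul1n big1 ?addn0 // => i ij.
by rewrite eq_sym (negPf ij).
Qed.

Lemma Lam_gen N (s : 'I_N -> M) :
  (forall i, s i \in L) ->
  (forall u, u \in L -> exists d : 'I_N -> nat, u = \sum_i s i *+ d i) ->
  forall l : Lam, exists d : 'I_(N + c) -> nat, l = \sum_i
    (match fintype.split i with inl j => (cone_elt (pi (s j)), 0) | inr j => delta j end : Lam) *+ d i.
Proof.
move=> sL s_gen [g v].
have gG : pi (sec (val g)) \in G by rewrite pi_sec; exact: valP.
have [C lL] := (GP _).1 gG; have [d dE] := s_gen _ lL.
have sG i : pi (s i) \in G by apply/GP; exists 0%N; rewrite mulr0n addr0.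
exists (fun i => match fintype.split i with inl j => d j | inr j => v j end).
rewrite big_split_ord /=.
under eq_bigr => i _ do rewrite -[lshift c i]/(unsplit (inl i)) unsplitK.
under [X in _ = _ + X]eq_bigr => i _ do rewrite -[rshift N i]/(unsplit (inr i)) unsplitK.
rewrite delta_sum.
have injD : {morph (fun g : Gs => (g, 0) : Lam) : x y / x + y}.
  by move=> x y; congr (_, _); rewrite addr0.
have injM (x : Gs) n : ((x, 0) : Lam) *+ n = (x *+ n, 0).
  by elim: n => // n IH; rewrite !mulrS injD -IH.
under eq_bigr => i _ do rewrite injM.
rewrite -(big_morph (fun g : Gs => (g, 0) : Lam) injD (erefl _)).
rewrite -[RHS]/(_ + 0, 0 + v) addr0 add0r; congr (_, _).
apply: val_inj; rewrite val_submonoid_sum; have := congr1 pi dE.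
rewrite raddfD raddfMn pi_x0 mul0rn addr0 pi_sec => ->; rewrite raddf_sum.
by apply: eq_bigr => i _; rewrite val_submonoidMn cone_eltK // raddfMn.
Qed.

(** An embedding of the semigroup in the lattice; its existence is a hypothesis
    of [arcs_jets_constructible]. *)
Definition Lam_embed (l : Lam) : M := sec (val l.1) + \sum_i e i *+ l.2 i.

Lemma Lam_embedD l l' : Lam_embed (l + l') = Lam_embed l + Lam_embed l'.
Proof.
case: l l' => [g v] [g' v']; rewrite /Lam_embed.
rewrite -[((g, v) + (g', v')).1]/(g + g') -[((g, v) + (g', v')).2]/(v + v').
rewrite val_submonoidD secD addrACA -big_split; congr (_ + _).
by apply: eq_bigr => i _; rewrite ffunE mulrnDr.
Qed.

Lemma Lam_embed_inj : injective Lam_embed.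
Proof.
have pi_sum (v : {ffun 'I_c -> nat}) : pi (\sum_i e i *+ v i) = 0.
  by rewrite raddf_sum big1 // => i _; rewrite raddfMn pi_e mul0rn.
have z0 i : z 0 i = 0 by apply: (addrI (z 0 i)); rewrite -zD !addr0.
have zMn u n i : z (u *+ n) i = z u i *+ n.
  by elim: n => [|n IH]; rewrite ?mulr0n ?z0 // !mulrS zD IH.
have z_sum (v : {ffun 'I_c -> nat}) j : z (\sum_i e i *+ v i) j = v j.
  rewrite (big_morph (fun u => z u j) (fun u v => zD u v j) (z0 j)).
  rewrite (bigD1 j) //= zMn z_e eqxx big1 ?addr0 => [|i ij]; first by rewrite mulr1n natz.
  by rewrite zMn z_e (negPf ij) mul0rn.
move=> [g v] [g' v']; rewrite /Lam_embed /= => E; congr (_, _).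
  apply: val_inj; have := congr1 pi E.
  by rewrite !raddfD !pi_sum !addr0 !pi_sec.
apply/ffunP => j; have := congr1 (fun u => z u j) E.
by rewrite !zD !z_sec !add0r !z_sum => -[].
Qed.

(** [B] is the ring of power series, or of truncated series, and [ev] the value
    at [t = 0]. *)
Section Ring.
Variables (B : comUnitAlgType k) (ev : {rmorphism B -> k}).
Hypothesis evZ : forall a x, ev (a *: x) = a * ev x.
Hypothesis ev_unit : forall x, ev x != 0 -> x \is a GRing.unit.

Definition orbit_hom (chi : Ls -> B) :=
  monhom chi /\ forall l, (ev (chi l) != 0) = (pi (val l) == 0).

(** The extension of a character that is invertible at [x0] to the points [u] such
    that [u + x0 *+ C] is in [L] for some [C]; the value [0] elsewhere is junk. *)
Definition orbit_ext (chi : Ls -> B) (u : M) : B :=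
  if pselect (exists Cl : nat * Ls, val Cl.2 = u + x0 *+ Cl.1) is left h
  then let Cl := sval (cid h) in chi Cl.2 / chi x0s ^+ Cl.1 else 0.

Definition origin_hom (chi : Lam -> B) :=
  monhom chi /\ forall l, l != 0 -> ev (chi l) = 0.

Section Ext.
Variable chi : Ls -> B.
Hypothesis hchi : orbit_hom chi.

Lemma chi_x0 : chi x0s \is a GRing.unit.
Proof. by apply: ev_unit; have [_ ->] := hchi; rewrite /= pi_x0. Qed.

Lemma orbit_extE u C (l : Ls) : val l = u + x0 *+ C -> orbit_ext chi u = chi l / chi x0s ^+ C.
Proof.
move=> lE; rewrite /orbit_ext; case: pselect => [h|[]]; last by exists (C, l).
case: (cid h) => -[C' l'] l'E; rewrite [LHS]/=.
have {}l'E : val l' = u + x0 *+ C' := l'E.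
have [[_ hD] _] := hchi.
have ee : l' + x0s *+ C = l + x0s *+ C'.
  apply: val_inj; rewrite !val_submonoidD !val_submonoidMn l'E lE /=.
  by rewrite addrAC.
have := congr1 chi ee; rewrite !hD !monhomMn; [|exact: hchi.1..] => E.
have u1 := unitrX C chi_x0; have u2 := unitrX C' chi_x0.
apply: (mulIr u1); rewrite mulrAC E divrK //.
by rewrite mulrK.
Qed.

Lemma orbit_ext_val (l : Ls) : orbit_ext chi (val l) = chi l.
Proof. by rewrite (@orbit_extE _ 0 l) ?mulr0n ?addr0 // expr0 divr1. Qed.

Lemma orbit_extP u : pi u \in G -> exists C (l : Ls), val l = u + x0 *+ C.
Proof. by move/GP => [C uC]; exists C, (Submonoid uC). Qed.

Lemma orbit_ext0 : orbit_ext chi 0 = 1.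
Proof. by rewrite -(val_submonoid0 L) orbit_ext_val; have [[]] := hchi. Qed.

Lemma orbit_extD u v : pi u \in G -> pi v \in G -> orbit_ext chi (u + v) = orbit_ext chi u * orbit_ext chi v.
Proof.
move=> /orbit_extP[C [l lE]] /orbit_extP[C' [l' l'E]].
rewrite (orbit_extE lE) (orbit_extE l'E) (@orbit_extE _ (C + C') (l + l')); last first.
  by rewrite val_submonoidD lE l'E mulrnDr addrACA.
have [[_ hD] _] := hchi.
by rewrite hD exprD invrM ?unitrX ?chi_x0 // [X in _ * X]mulrC mulrACA.
Qed.

Lemma ev_orbit_ext u : pi u \in G -> (ev (orbit_ext chi u) != 0) = (pi u == 0).
Proof.
move=> /orbit_extP[C [l lE]]; rewrite (orbit_extE lE) rmorphM mulf_eq0 negb_or.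
have -> : ev (chi x0s ^+ C)^-1 != 0.
  by rewrite rmorphV ?unitrX ?chi_x0 // invr_eq0 -unitfE rmorph_unit // unitrX // chi_x0.
rewrite andbT; have [_ ->] := hchi.
by rewrite lE raddfD raddfMn pi_x0 mul0rn addr0.
Qed.

Lemma orbit_ext_unit u : pi u = 0 -> orbit_ext chi u \is a GRing.unit.
Proof. by move=> u0; apply: ev_unit; rewrite ev_orbit_ext ?ker_in // u0. Qed.

Lemma orbit_extMz u (n : int) : pi u = 0 -> orbit_ext chi (u *~ n) = orbit_ext chi u ^ n.
Proof.
move=> u0; have h m : orbit_ext chi (u *+ m) = orbit_ext chi u ^+ m.
  elim: m => [|m IH]; first by rewrite mulr0n expr0 orbit_ext0.
  rewrite mulrS exprS orbit_extD ?IH // ker_in // raddfMn u0 mul0rn //.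
case: n => n; first exact: h.
have pm : pi (u *+ n.+1) = 0 by rewrite raddfMn u0 mul0rn.
have pmN : pi (- (u *+ n.+1)) = 0 by rewrite raddfN pm oppr0.
rewrite -[_ ^ _]/((orbit_ext chi u ^+ n.+1)^-1) -h NegzE mulrNz -pmulrn.
apply: (mulIr (orbit_ext_unit pm)); rewrite mulVr ?orbit_ext_unit // -orbit_extD ?ker_in //.
by rewrite addNr orbit_ext0.
Qed.

Lemma orbit_ext_sum (I : Type) (r : seq I) (F : I -> M) : (forall i, pi (F i) = 0) ->
  orbit_ext chi (\sum_(i <- r) F i) = \prod_(i <- r) orbit_ext chi (F i).
Proof.
move=> h; elim: r => [|i r IH]; first by rewrite !big_nil orbit_ext0.
rewrite !big_cons orbit_extD ?IH ?ker_in // raddf_sum big1 //.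
Qed.

(** The coordinates of the point of the orbit, i.e. the constant terms of the
    units attached to the basis [e]. *)
Definition torus_coord i : k := ev (orbit_ext chi (e i)).
Lemma torus_coord_neq0 i : torus_coord i != 0.
Proof. by rewrite /torus_coord ev_orbit_ext pi_e ?eqxx ?rpred0. Qed.

(** The second component of the correspondence.  The unit at [e i] is
    normalized to have constant term [1], and the free generator [delta i] goes
    to its difference with [1]. *)
Definition origin_of_orbit (l : Lam) : B :=
  orbit_ext chi (sec (val l.1)) * \prod_i ((torus_coord i)^-1 *: orbit_ext chi (e i) - 1) ^+ l.2 i.

Lemma origin_of_orbit_hom : origin_hom origin_of_orbit.
Proof.
split.
  split=> [|[g v] [g' v']].
    rewrite /origin_of_orbit [val _](val_submonoid0 G) sec0 orbit_ext0 mul1r big1 // => i _.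
    by rewrite ffunE expr0.
  rewrite /origin_of_orbit -[((g, v) + (g', v')).1]/(g + g') -[((g, v) + (g', v')).2]/(v + v').
  rewrite val_submonoidD secD orbit_extD ?pi_sec; try exact: valP.
  rewrite mulrACA; congr (_ * _); rewrite -big_split; apply: eq_bigr => i _.
  by rewrite ffunE exprD.
move=> [g v] nz; rewrite /origin_of_orbit -[(g, v).1]/g -[(g, v).2]/v rmorphM.
have [g0|g0] := eqVneq (val g) 0; last first.
  have : ~~ (ev (orbit_ext chi (sec (val g))) != 0).
    by rewrite ev_orbit_ext ?pi_sec //; exact: valP.
  by rewrite negbK => /eqP ->; rewrite mul0r.
have [i vi] : exists i, v i != 0%N.
  apply: contrapT => /forallNP h; case/eqP: nz; congr (_, _).
    by apply: val_inj; rewrite g0 val_submonoid0.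
  apply/ffunP => i; rewrite ffunE; apply/eqP; have /negP := h i.
  by rewrite negbK.
rewrite rmorph_prod (bigD1 i) //= rmorphXn rmorphB rmorph1 evZ mulVf ?torus_coord_neq0 //.
by rewrite subrr expr0n (negPf vi) mul0r mulr0.
Qed.
End Ext.

Section Hmap.
Variables (cs : 'I_c -> k) (chi : Lam -> B).
Hypothesis cs_neq0 : forall i, cs i != 0.
Hypothesis hchi : origin_hom chi.

(** The unit at [e i] recovered from its constant term and its normalized
    deviation from [1]. *)
Definition origin_unit i : B := cs i *: (1 + chi (delta i)).
Definition origin_ext (u : M) : B := chi (cone_elt (pi u), 0) * \prod_i origin_unit i ^ z u i.
(** The inverse of the pair of [torus_coord] and [origin_of_orbit]. *)
Definition orbit_of_origin (l : Ls) : B := origin_ext (val l).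

Lemma ev_origin_unit i : ev (origin_unit i) = cs i.
Proof.
rewrite /origin_unit evZ rmorphD rmorph1; have [_ ->] := hchi; first by rewrite addr0 mulr1.
apply/eqP => /(congr1 (fun l : Lam => l.2 i)) /=.
by rewrite !ffunE eqxx.
Qed.

Lemma origin_unit_unit i : origin_unit i \is a GRing.unit.
Proof. by apply: ev_unit; rewrite ev_origin_unit. Qed.

Lemma origin_extD u v : pi u \in G -> pi v \in G -> origin_ext (u + v) = origin_ext u * origin_ext v.
Proof.
move=> uG vG; rewrite /origin_ext mulrACA -big_split; congr (_ * _).
  have [[_ hD] _] := hchi.
  by rewrite -hD raddfD cone_eltD //; congr chi; congr (_, _); rewrite addr0.
by apply: eq_bigr => i _; rewrite zD exprzDr ?origin_unit_unit.
Qed.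

Lemma z0 i : z 0 i = 0.
Proof. by apply: (addrI (z 0 i)); rewrite -zD !addr0. Qed.

Lemma origin_ext0 : origin_ext 0 = 1.
Proof.
have [[h0 _] _] := hchi; rewrite /origin_ext raddf0 cone_elt0 -[(0, 0)]/(0 : Lam) h0 mul1r big1 // => i _.
by rewrite z0 expr0z.
Qed.

Lemma prod_origin_unit_neq0 u : ev (\prod_i origin_unit i ^ z u i) != 0.
Proof.
rewrite rmorph_prod; apply/prodf_neq0 => i _.
by rewrite rmorphXz ?origin_unit_unit // expfz_neq0 // ev_origin_unit.
Qed.

Lemma orbit_of_origin_hom : orbit_hom orbit_of_origin.
Proof.
split.
  split=> [|l l']; rewrite /orbit_of_origin; first by rewrite val_submonoid0 origin_ext0.
  by rewrite val_submonoidD origin_extD //; exact: pi_in.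
move=> l; rewrite /orbit_of_origin /origin_ext rmorphM mulf_eq0 negb_or prod_origin_unit_neq0 andbT.
have [[h0 _] hz] := hchi.
have [p0|p0] := eqVneq (pi (val l)) 0.
  by rewrite p0 cone_elt0 -[(0, 0)]/(0 : Lam) h0 rmorph1 oner_eq0.
rewrite hz ?eqxx //; apply: contraNneq p0 => e0.
have e1 : cone_elt (pi (val l)) = 0 := congr1 fst e0.
by rewrite -(cone_eltK (pi_in l)) e1 val_submonoid0.
Qed.

Lemma orbit_ext_of_origin u : pi u \in G -> orbit_ext orbit_of_origin u = origin_ext u.
Proof.
move=> uG; have [C [l lE]] := orbit_extP uG; rewrite (orbit_extE orbit_of_origin_hom lE).
have px m : pi (x0 *+ m) \in G by apply: ker_in; rewrite raddfMn pi_x0 mul0rn.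
have hx : origin_ext x0 \is a GRing.unit by exact: (chi_x0 orbit_of_origin_hom).
apply: (mulIr (unitrX C hx)); rewrite /orbit_of_origin divrK ?unitrX // lE origin_extD //.
congr (_ * _); elim: C {lE} => [|C IH]; first by rewrite mulr0n origin_ext0.
by rewrite mulrS exprS origin_extD ?IH // -[x0]mulr1n.
Qed.
End Hmap.

Lemma orbit_of_originK chi : orbit_hom chi -> orbit_of_origin (torus_coord chi) (origin_of_orbit chi) =1 chi.
Proof.
move=> hchi l; rewrite -[RHS](orbit_ext_val hchi); rewrite [in RHS](uE (val l)).
rewrite orbit_extD // ?pi_sec ?pi_in //; last first.
  apply: ker_in; rewrite raddf_sum big1 // => i _.
  by rewrite raddfMz pi_e mul0rz.
rewrite orbit_ext_sum //; last by move=> i; rewrite raddfMz pi_e mul0rz.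
rewrite /orbit_of_origin /origin_ext {1}/origin_of_orbit /= cone_eltK ?pi_in // [X in _ * X * _]big1 ?mulr1; last first.
  by move=> i _; rewrite ffunE expr0.
congr (_ * _); apply: eq_bigr => i _; rewrite orbit_extMz ?pi_e //; congr (_ ^ _).
rewrite /origin_unit /origin_of_orbit [val _](val_submonoid0 G) [(delta i).2]/=.
rewrite sec0.
rewrite orbit_ext0 // mul1r (bigD1 i) //= ffunE eqxx expr1 big1 ?mulr1; last first.
  by move=> j ji; rewrite ffunE (negPf ji) expr0.
rewrite addrC subrK scalerA divff ?scale1r //; exact: torus_coord_neq0.
Qed.

Lemma torus_coordK cs chi : (forall i, cs i != 0) -> origin_hom chi ->
  torus_coord (orbit_of_origin cs chi) =1 cs.
Proof.
move=> hcs hchi i; rewrite /torus_coord orbit_ext_of_origin ?ker_in // /origin_ext pi_e cone_elt0.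
have [[h0 _] hz] := hchi; rewrite -[(0, 0)]/(0 : Lam) h0 mul1r rmorph_prod.
rewrite (bigD1 i) //= z_e eqxx expr1z ev_origin_unit // big1 ?mulr1 // => j ji.
by rewrite z_e eq_sym (negPf ji) expr0z rmorph1.
Qed.

Lemma origin_ext_e cs chi i : (forall i, cs i != 0) -> origin_hom chi ->
  origin_ext cs chi (e i) = origin_unit cs chi i.
Proof.
move=> hcs hchi; rewrite /origin_ext pi_e cone_elt0; have [[h0 _] _] := hchi.
rewrite -[(0, 0)]/(0 : Lam) h0 mul1r (bigD1 i) //= z_e eqxx expr1z.
by rewrite big1 ?mulr1 // => j ji; rewrite z_e eq_sym (negPf ji) expr0z.
Qed.

Lemma origin_of_orbitK cs chi : (forall i, cs i != 0) -> origin_hom chi ->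
  origin_of_orbit (orbit_of_origin cs chi) =1 chi.
Proof.
move=> hcs hchi [g v]; rewrite /origin_of_orbit /= orbit_ext_of_origin ?pi_sec //; last exact: valP.
rewrite /origin_ext pi_sec cone_elt_val [X in _ * X * _]big1 ?mulr1; last first.
  by move=> i _; rewrite z_sec expr0z.
under eq_bigr => i _ do rewrite torus_coordK // orbit_ext_of_origin ?ker_in // origin_ext_e // /origin_unit
  scalerA mulVf // scale1r addrC addKr.
have [[h0 hD] _] := hchi.
transitivity (chi (g, 0) * chi (\sum_i delta i *+ v i)).
  congr (_ * _); rewrite (monhom_sum _ _ _ hchi.1); apply: eq_bigr => i _.
  by rewrite (monhomMn _ _ hchi.1).
rewrite -hD; congr chi.
rewrite delta_sum -[LHS]/(g + 0, 0 + v) addr0 add0r //.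
Qed.

End Ring.

(** All the constructions commute with a morphism of local rings; the case of
    interest is truncation from series to jets. *)
Section Naturality.
Variables (B B' : comUnitAlgType k) (ev : {rmorphism B -> k}) (ev' : {rmorphism B' -> k}).
Hypothesis ev_unit : forall x, ev x != 0 -> x \is a GRing.unit.
Hypothesis ev_unit' : forall x, ev' x != 0 -> x \is a GRing.unit.
Variable f : {lrmorphism B -> B'}.
Hypothesis fE : forall x, ev' (f x) = ev x.

Lemma monhom_comp (K : nmodType) (chi : K -> B) : monhom chi -> monhom (f \o chi).
Proof. by move=> [h0 hD]; split=> [|u v] /=; rewrite ?h0 ?rmorph1 // hD rmorphM. Qed.

Lemma orbit_hom_comp chi : orbit_hom ev chi -> orbit_hom ev' (f \o chi).
Proof. by move=> [h1 h2]; split=> [|l]; [exact: monhom_comp|rewrite /= fE h2]. Qed.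

Lemma orbit_ext_comp chi u : orbit_hom ev chi -> pi u \in G ->
  orbit_ext (f \o chi) u = f (orbit_ext chi u).
Proof.
move=> hchi /orbit_extP[C [l lE]].
rewrite (orbit_extE ev_unit' (orbit_hom_comp hchi) lE) (orbit_extE ev_unit hchi lE).
by rewrite /= rmorphM rmorphV ?rmorphXn // unitrX // (chi_x0 ev_unit hchi).
Qed.

Lemma torus_coord_comp chi i : orbit_hom ev chi -> torus_coord ev' (f \o chi) i = torus_coord ev chi i.
Proof. by move=> h; rewrite /torus_coord orbit_ext_comp ?fE // pi_e rpred0. Qed.

Lemma origin_of_orbit_comp chi l : orbit_hom ev chi -> origin_of_orbit ev' (f \o chi) l = f (origin_of_orbit ev chi l).
Proof.
move=> h; rewrite /origin_of_orbit orbit_ext_comp ?pi_sec //; last exact: valP.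
rewrite rmorphM rmorph_prod; congr (_ * _); apply: eq_bigr => i _.
rewrite rmorphXn; congr (_ ^+ _); rewrite rmorphB rmorph1; congr (_ - _).
by rewrite orbit_ext_comp ?pi_e ?rpred0 // torus_coord_comp //; exact: (esym (linearZ _ _)).
Qed.

Lemma orbit_of_origin_comp cs chi l : (forall i, cs i != 0) -> origin_hom ev chi ->
  (forall a x, ev (a *: x) = a * ev x) ->
  orbit_of_origin cs (f \o chi) l = f (orbit_of_origin cs chi l).
Proof.
move=> hcs h evZ; rewrite /orbit_of_origin /origin_ext rmorphM rmorph_prod; congr (_ * _).
apply: eq_bigr => i _; rewrite rmorphXz; last by apply: (origin_unit_unit evZ ev_unit hcs h).
congr (_ ^ _); rewrite /origin_unit; apply: (etrans _ (esym (linearZ _ _))).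
by congr (_ *: _); rewrite rmorphD rmorph1.
Qed.
End Naturality.

(** * Jets with origin in an orbit *)

Section OrbitJets.
Variable m : nat.
Local Notation A := (monoid_algebra k Ls).
Local Notation A' := (monoid_algebra k Lam).
Local Notation X := (jet_space A m).
Local Notation X' := (jet_space A' m).
Local Notation mon := (monomial k).
Local Notation jev := (@jet_ev k m).

Lemma jevZ a (x : jet_ring k m) : jev (a *: x) = a * jev x.
Proof. exact: jcoefZ. Qed.
Lemma sevZ a (x : series k) : series_ev (a *: x) = a * series_ev x.
Proof. by []. Qed.
Lemma sev_unit (x : series k) : series_ev x != 0 -> x \is a GRing.unit.
Proof. by rewrite series_unitE. Qed.

Lemma mulf_neq0_l (x y : k) : x * y != 0 -> x != 0.
Proof. by rewrite mulf_eq0 negb_or => /andP[]. Qed.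

Definition jhom (K : nmodType) (psi : jet (monoid_algebra k K) m) (l : K) : jet_ring k m := psi (mon l).

Definition orbit_jets : set (jet A m) :=
  [set psi | forall l : Ls, (jev (psi (mon l)) != 0) = (pi (val l) == 0)].

Definition origin_jets : set (jet A' m) :=
  [set p | forall l : Lam, l != 0 -> jev (p (mon l)) = 0].

Lemma orbit_jet_hom psi : orbit_jets psi -> orbit_hom jev (jhom psi).
Proof. by move=> h; split=> //; exact: lrmorphism_monhom. Qed.

Lemma origin_jet_hom p : origin_jets p -> origin_hom jev (jhom p).
Proof. by move=> h; split=> //; exact: lrmorphism_monhom. Qed.

(** Being a unit at the single element [x0] forces being a unit at every element
    of the face, because each of them divides a multiple of [x0]; hence only
    one open condition. *)
Lemma orbit_jets_lc : @locally_closed k X orbit_jets.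
Proof.
have -> : orbit_jets = [set psi : jet A m | forall l : {l : Ls | pi (val l) != 0},
     jcoef (psi (mon (sval l))) 0 = 0] `&` [set psi : jet A m | jcoef (psi (mon x0s)) 0 != 0].
  apply/seteqP; split=> psi.
    move=> h; split=> [[l nl]|] /=.
      by have := h l; rewrite (negPf nl) => /negbFE /eqP.
    by have := h x0s; rewrite /= pi_x0 eqxx.
  move=> [/= h1 h2] l; have [l0|l0] := eqVneq (pi (val l)) 0; last first.
    by rewrite /jet_ev (h1 (exist _ l l0)) eqxx.
  have [C [l' l'E]] : exists C (l' : Ls), val l' = - val l + x0 *+ C.
    by apply: orbit_extP; rewrite raddfN l0 oppr0 rpred0.
  have E : l + l' = x0s *+ C.
    by apply: val_inj; rewrite val_submonoidD l'E val_submonoidMn addrA subrr add0r.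
  have := congr1 (fun u => jev (psi (mon u))) E; rewrite /= monomialD monomialMn.
  rewrite !rmorphM !rmorphXn => e'.
  have : jev (psi (mon l)) * jev (psi (mon l')) != 0 by rewrite e' expf_neq0.
  exact: mulf_neq0_l.
apply: lcI.
  by apply: lc_closed; apply: zclosed_all => l; apply: zclosed_eq0; exact: jet_poly.
by apply: lc_open; apply: zopen_nz; exact: jet_poly.
Qed.

Section Regularity.
Variables (T : Type) (P : (T -> k) -> Prop).
Hypothesis P_ext : forall g f : T -> k, f =1 g -> P g -> P f.
Hypothesis P_cst : forall a, P (fun=> a).
Hypothesis P_add : forall f g, P f -> P g -> P (fun t => f t + g t).
Hypothesis P_mul : forall f g, P f -> P g -> P (fun t => f t * g t).
Hypothesis P_inv : forall f, P f -> (forall t, f t != 0) -> P (fun t => (f t)^-1).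

Lemma jfun_sum (I : Type) (r : seq I) (F : I -> T -> jet_ring k m) :
  (forall i, jfun P (F i)) -> jfun P (fun t => \sum_(i <- r) F i t).
Proof.
move=> hF; elim: r => [|i r IH].
  by apply: (jfun_ext P_ext _ (jfun_cst P_cst 0)) => t; rewrite big_nil.
by apply: (jfun_ext P_ext _ (jfun_add P_ext P_add (hF i) IH)) => t; rewrite big_cons.
Qed.

Lemma jfun_monomials (K : nmodType) (F : T -> jet (monoid_algebra k K) m) :
  (forall l, jfun P (fun t => F t (mon l))) -> forall a, jfun P (fun t => F t a).
Proof.
move=> h a; apply: (jfun_ext P_ext (G := fun t => \sum_(u <- msupp a) mcoeff u a *: F t (mon u))).
  by move=> t; rewrite lrmorphism_monomials.
by apply: jfun_sum => u; apply: (jfun_scale P_ext P_mul (P_cst _)).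
Qed.

Section Forward.
Variable F : T -> jet A m.
Hypothesis Forb : forall t, orbit_jets (F t).
Hypothesis Fmon : forall l, jfun P (fun t => F t (mon l)).

Lemma jfun_orbit_ext u : pi u \in G -> jfun P (fun t => orbit_ext (jhom (F t)) u).
Proof.
move=> /orbit_extP[C [l lE]].
apply: (jfun_ext P_ext (G := fun t => F t (mon l) * (F t (mon x0s) ^+ C)^-1)).
  by move=> t; rewrite (orbit_extE (@jet_ev_unit k m) (orbit_jet_hom (Forb t)) lE).
apply: (jfun_mul P_ext P_cst P_add P_mul) => //.
apply: (jfun_inv P_ext P_cst P_add P_mul P_inv); first exact: (jfun_exp P_ext P_cst P_add P_mul).
by move=> t; rewrite (rmorphXn jev) expf_neq0 // Forb /= pi_x0.
Qed.

Lemma P_torus_coord i : P (fun t => torus_coord jev (jhom (F t)) i).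
Proof. by apply: (jfun_orbit_ext (u := e i)); rewrite ?pi_e ?rpred0. Qed.

Lemma jfun_origin_of_orbit l : jfun P (fun t => origin_of_orbit jev (jhom (F t)) l).
Proof.
apply: (jfun_mul P_ext P_cst P_add P_mul); first by apply: jfun_orbit_ext; rewrite pi_sec; exact: valP.
apply: (jfun_prod P_ext P_cst P_add P_mul) => i.
apply: (jfun_exp P_ext P_cst P_add P_mul); apply: (jfun_add P_ext P_add); last exact: (jfun_cst P_cst).
apply: (jfun_scale P_ext P_mul); last by apply: jfun_orbit_ext; rewrite pi_e rpred0.
apply: P_inv => [|t]; first exact: P_torus_coord.
exact: (torus_coord_neq0 (@jet_ev_unit k m) (orbit_jet_hom (Forb t))).
Qed.
End Forward.

Section Backward.
Variables (cs : T -> 'I_c -> k) (F : T -> jet A' m).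
Hypothesis cs_neq0 : forall t i, cs t i != 0.
Hypothesis P_cs : forall i, P (fun t => cs t i).
Hypothesis Forg : forall t, origin_jets (F t).
Hypothesis Fmon : forall l, jfun P (fun t => F t (mon l)).

Lemma jfun_orbit_of_origin l : jfun P (fun t => orbit_of_origin (cs t) (jhom (F t)) l).
Proof.
apply: (jfun_mul P_ext P_cst P_add P_mul); first exact: Fmon.
apply: (jfun_prod P_ext P_cst P_add P_mul) => i.
apply: (jfun_exprz P_ext P_cst P_add P_mul _ P_inv).
  apply: (jfun_scale P_ext P_mul) => //.
  by apply: (jfun_add P_ext P_add); [exact: (jfun_cst P_cst)|exact: Fmon].
by move=> t; rewrite (ev_origin_unit jevZ (cs t) (origin_jet_hom (Forg t))).
Qed.
End Backward.
End Regularity.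

Definition origin_jet (x : {psi : jet A m | orbit_jets psi}) : jet A' m :=
  ma_lrmorphism (origin_of_orbit_hom jevZ (@jet_ev_unit k m) (orbit_jet_hom (svalP x))).1.

Lemma origin_jetE x l : origin_jet x (mon l) = origin_of_orbit jev (jhom (sval x)) l.
Proof. exact: ma_lrmorphismE. Qed.

Section Sec.
Variables (T I : Type) (gen : I -> T -> k).
Local Notation P := (@sections k (zariski gen) setT).
Lemma gsec_ext (g f : T -> k) : f =1 g -> P g -> P f. Proof. exact: sec_ext. Qed.
Lemma gsec_cst a : P (fun=> a). Proof. exact: sec_cst. Qed.
Lemma gsec_add f g : P f -> P g -> P (fun t => f t + g t). Proof. exact: sec_add. Qed.
Lemma gsec_mul f g : P f -> P g -> P (fun t => f t * g t). Proof. exact: sec_mul. Qed.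
Lemma gsec_inv f : P f -> (forall t, f t != 0) -> P (fun t => (f t)^-1).
Proof. by move=> h h'; apply: sec_inv. Qed.

Lemma gsec_jet_gen (K : nmodType) (F : T -> jet (monoid_algebra k K) m) :
  (forall l, jfun P (fun t => F t (mon l))) ->
  forall ai, P (@jet_gen k K m ai \o F).
Proof.
move=> h [a i].
have := jfun_monomials gsec_ext gsec_cst gsec_add gsec_mul h a; apply.
by rewrite -ltnS.
Qed.
End Sec.

Lemma origin_jet_regular : @regular_map k
  (zariski (fun ai (x : {psi : jet A m | orbit_jets psi}) => @jet_gen k Ls m ai (sval x)))
  X' origin_jet.
Proof.
apply/regular_genP; apply: gsec_jet_gen => l.
apply: (jfun_ext (@gsec_ext _ _ _) (G := fun x => origin_of_orbit jev (jhom (sval x)) l)).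
  by move=> x; rewrite origin_jetE.
apply: (jfun_origin_of_orbit (@gsec_ext _ _ _) (@gsec_cst _ _ _) (@gsec_add _ _ _) (@gsec_mul _ _ _) (@gsec_inv _ _ _)).
  by move=> x; exact: svalP.
move=> l' i im; rewrite -ltnS in im.
exact: (@sec_gen k _ _ _ _ (mon l', Ordinal im)).
Qed.

(** The jets over the orbit whose partner at the origin lies in [D]. *)
Definition orbit_part (D : set (jet A' m)) : set (jet A m) :=
  [set psi | exists h : orbit_jets psi, D (origin_jet (exist _ psi h))].

Lemma orbit_part_lc D : @locally_closed k X' D -> @locally_closed k X (orbit_part D).
Proof.
move=> /(lc_preimage origin_jet_regular) [U [V [oU oV UV]]].
have [U' oU' eU] := @zopen_sub k _ _ (@jet_gen k Ls m) orbit_jets U oU.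
have [V' oV' eV] := @zopen_sub k _ _ (@jet_gen k Ls m) orbit_jets V oV.
have -> : orbit_part D = orbit_jets `&` (U' `\` V').
  apply/seteqP; split=> psi.
    move=> [h hD]; split=> //.
    have : (origin_jet @^-1` D) (exist _ psi h) by [].
    by rewrite UV eU eV.
  move=> [h h']; exists h.
  have : (U `\` V) (exist _ psi h) by rewrite eU eV.
  by rewrite -UV.
by apply: lcI; [exact: orbit_jets_lc|exists U', V'].
Qed.

Lemma orbit_part_disjoint D D' : D `&` D' = set0 -> orbit_part D `&` orbit_part D' = set0.
Proof.
move=> DD'; apply/seteqP; split=> // psi [[h hD] [h' hD']].
rewrite (Prop_irrelevance h' h) in hD'.
by have : (D `&` D') (origin_jet (exist _ psi h)) by []; rewrite DD'.
Qed.

(** The pair of [torus_coord] and [origin_of_orbit] is regular, with regular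
    inverse [orbit_of_origin]. *)
Lemma orbit_part_iso D : D `<=` origin_jets ->
  isomorphic (@subspace k X (orbit_part D))
    (zariski (zprod_gen (@torus_gen k c) (fun ai (p : {p | D p}) => @jet_gen k Lam m ai (sval p)))).
Proof.
move=> Dorg.
have -> : @subspace k X (orbit_part D) =
  zariski (fun ai (x : {psi : jet A m | orbit_part D psi}) => @jet_gen k Ls m ai (sval x)).
  exact: subspace_zariski.
have orb (x : {psi | orbit_part D psi}) : orbit_jets (sval x).
  by have [h _] := svalP x.
pose toX (x : {psi | orbit_part D psi}) : {psi | orbit_jets psi} := exist _ (sval x) (orb x).
have toD x : D (origin_jet (toX x)).
  by have [h hD] := svalP x; rewrite /toX (Prop_irrelevance (orb x) h).
have cnz x i : torus_coord jev (jhom (sval (toX x))) i != 0.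
  exact: (torus_coord_neq0 (@jet_ev_unit k m) (orbit_jet_hom (svalP (toX x)))).
pose f x : torus k c * {p | D p} := (exist (fun y => forall i, y i != 0) _ (cnz x), exist D _ (toD x)).
have orgD (y : torus k c * {p | D p}) : origin_jets (sval y.2) by apply: Dorg; exact: svalP.
have hh y := orbit_of_origin_hom jevZ (@jet_ev_unit k m) (svalP y.1) (origin_jet_hom (orgD y)).
pose bj y : jet A m := ma_lrmorphism (hh y).1.
have bjE y l : bj y (mon l) = orbit_of_origin (sval y.1) (jhom (sval y.2)) l by exact: ma_lrmorphismE.
have borb y : orbit_jets (bj y) by move=> l; rewrite bjE; exact: (hh y).2.
have gbj y (h : orbit_jets (bj y)) : origin_jet (exist _ (bj y) h) = sval y.2.
  apply: ma_ext => l; rewrite origin_jetE /=.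
  rewrite (_ : jhom (bj y) = orbit_of_origin (sval y.1) (jhom (sval y.2))).
    by rewrite (origin_of_orbitK jevZ (@jet_ev_unit k m) (svalP y.1) (origin_jet_hom (orgD y))).
  by apply/funext => l'; rewrite /jhom bjE.
have bpart y : orbit_part D (bj y).
  by exists (borb y); rewrite gbj; exact: svalP.
apply: (@isomorphic_zariski _ _ _ _ _ _ _ f (fun y => exist (orbit_part D) _ (bpart y))).
- have Fm l : jfun (@sections k (zariski (fun ai (x : {psi : jet A m | orbit_part D psi}) => @jet_gen k Ls m ai (sval x))) setT) (fun x : {psi | orbit_part D psi} => sval x (mon l)).
    by move=> i im; rewrite -ltnS in im; exact: (@sec_gen k _ _ _ _ (mon l, Ordinal im)).
  case=> [i|ai].
    exact: (P_torus_coord (@gsec_ext _ _ _) (@gsec_cst _ _ _) (@gsec_add _ _ _) (@gsec_mul _ _ _) (@gsec_inv _ _ _) orb Fm).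
  apply: (@gsec_jet_gen _ _ _ Lam (fun x => origin_jet (toX x))) => l.
  apply: (jfun_ext (@gsec_ext _ _ _) (G := fun x => origin_of_orbit jev (jhom (sval x)) l)).
    by move=> x; rewrite origin_jetE.
  exact: (jfun_origin_of_orbit (@gsec_ext _ _ _) (@gsec_cst _ _ _) (@gsec_add _ _ _) (@gsec_mul _ _ _) (@gsec_inv _ _ _) orb Fm).
- apply: (@gsec_jet_gen _ _ _ Ls bj) => l.
  apply: (jfun_ext (@gsec_ext _ _ _) (G := fun y => orbit_of_origin (sval y.1) (jhom (sval y.2)) l)).
    by move=> y; rewrite bjE.
  apply: (jfun_orbit_of_origin (@gsec_ext _ _ _) (@gsec_cst _ _ _) (@gsec_add _ _ _) (@gsec_mul _ _ _) (@gsec_inv _ _ _) _ _ orgD).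
  + by move=> y i; apply: (svalP y.1).
  + by move=> i; exact: (@sec_gen k _ _ _ _ (inl i)).
  + move=> l' i im; rewrite -ltnS in im; exact: (@sec_gen k _ _ _ _ (inr (mon l', Ordinal im))).
- move=> [psi hpsi]; apply: eq_exist; apply: ma_ext => l; rewrite bjE /=.
  rewrite (_ : jhom (origin_jet (toX (exist _ psi hpsi))) = origin_of_orbit jev (jhom psi)).
    exact: (orbit_of_originK (@jet_ev_unit k m) (orbit_jet_hom (orb (exist _ psi hpsi)))).
  by apply/funext => l'; rewrite /jhom origin_jetE.
- move=> [[cs hcs] [p hp]]; set y := (exist _ cs hcs, exist _ p hp); rewrite /f; congr (_, _); apply: eq_exist; last exact: gbj.
  apply/funext => i /=.
  rewrite (_ : jhom (bj _) = orbit_of_origin cs (jhom p)).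
    exact: (torus_coordK jevZ (@jet_ev_unit k m) hcs (origin_jet_hom (orgD y))).
  by apply/funext => l'; rewrite /jhom bjE.
Qed.

(** The correspondence between characters also exists over power series and is
    compatible with truncation, so lifts on either side produce lifts on the
    other.  The torus coordinates of the lifted arc are those of the jet. *)
Lemma orbit_arcs psi (h : orbit_jets psi) :
  range (@jet_of_arc k A m) psi <->
  [set jet_of_arc m phi | phi in arcs_at (@origin_set k Lam)] (origin_jet (exist _ psi h)).
Proof.
have trE (x : series k) : jev (truncate m x) = series_ev x by exact: jet_ev_truncate.
split=> [[phi _ psiE]|[phi' org' psiE]].
  pose chi (l : Ls) := phi (mon l).
  have hchi : orbit_hom (@series_ev k) chi.
    split=> [|l]; first exact: lrmorphism_monhom.
    by rewrite -h -psiE /= trE.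
  have hg := origin_of_orbit_hom sevZ sev_unit hchi.
  exists (ma_lrmorphism hg.1).
    move=> _ [l nl <-]; rewrite (ma_lrmorphismE hg.1); exact: hg.2.
  apply: ma_ext => l; rewrite origin_jetE.
  have jE0 : jhom psi = @truncate k m \o chi by apply/funext => l'; rewrite /jhom -psiE.
  have jE : jhom (sval (exist orbit_jets psi h)) = @truncate k m \o chi := jE0.
  rewrite jE; apply: (etrans (congr1 (truncate m) (ma_lrmorphismE hg.1 l))).
  exact: (esym (origin_of_orbit_comp sev_unit (@jet_ev_unit k m) trE l hchi)).
pose chi' (l : Lam) := phi' (mon l).
have hchi' : origin_hom (@series_ev k) chi'.
  by split=> [|l nl]; [exact: lrmorphism_monhom|apply: org'; exists l].
pose cs := torus_coord jev (jhom psi).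
have hcs i : cs i != 0 by exact: (torus_coord_neq0 (@jet_ev_unit k m) (orbit_jet_hom h)).
have hh := orbit_of_origin_hom sevZ sev_unit hcs hchi'.
exists (ma_lrmorphism hh.1) => //.
apply: ma_ext => l; apply: (etrans (congr1 (truncate m) (ma_lrmorphismE hh.1 l))).
apply: (etrans (esym (orbit_of_origin_comp sev_unit (@truncate k m) l hcs hchi' sevZ))).
apply: (etrans _ (orbit_of_originK (@jet_ev_unit k m) (orbit_jet_hom h) l)).
have jE : @truncate k m \o chi' = origin_of_orbit jev (jhom psi).
  by apply/funext => l'; rewrite -[RHS](origin_jetE (exist orbit_jets psi h)) -psiE.
by rewrite -jE.
Qed.

Section Contribution.
Hypothesis char0 : [pchar k] =i pred0.
Variables (n : nat) (emb : M -> 'rV[int]_n).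
Hypothesis embD : forall u v, emb (u + v) = emb u + emb v.
Hypothesis emb_inj : injective emb.
Variables (N : nat) (s : 'I_N -> M).
Hypothesis sL : forall i, s i \in L.
Hypothesis s_gen : forall u, u \in L -> exists d : 'I_N -> nat, u = \sum_i s i *+ d i.

(** The strata of the jets of arcs at the origin are transported along
    [orbit_part_iso], and each contributes its class times that of the torus. *)
Lemma orbit_contribution : exists sq : seq (set (jet A m)),
  [/\ forall B, B \in sq -> @locally_closed k X B,
      forall i j, (i < size sq)%N -> (j < size sq)%N -> i != j ->
        nth set0 sq i `&` nth set0 sq j = set0,
      forall psi, (exists2 B, B \in sq & B psi) <->
        orbit_jets psi /\ range (@jet_of_arc k A m) psi &
      \sum_(B <- sq) subset_class (@jet_gen k Ls m) B =
        (Lefschetz - 1) ^+ c * constructible_class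
          (X := X') [set jet_of_arc m phi | phi in arcs_at (@origin_set k Lam)]].
Proof.
have gens := Lam_gen sL s_gen.
have iD (l l' : Lam) : emb (Lam_embed (l + l')) = emb (Lam_embed l) + emb (Lam_embed l').
  by rewrite Lam_embedD // embD.
have iI : injective (fun l : Lam => emb (Lam_embed l)).
  by move=> l l' /emb_inj; exact: Lam_embed_inj.
have [J [D [lcD disD DE]]] := arcs_jets_constructible char0 gens iD iI m.
have qX' : quasi_affine X' := @jet_space_quasi_affine k _ _ _ gens m.
have Dorg j : D j `<=` origin_jets.
  move=> p Dp; have : [set x | exists j, D j x] p by exists j.
  rewrite -DE => -[phi org <-] l nl.
  apply: (etrans (jet_ev_truncate m (phi (mon l)))); apply: org; by exists l.
have nE i : (i < size (enum J))%N ->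
    exists2 j, nth set0 [seq orbit_part (D j) | j <- enum J] i = orbit_part (D j) & index j (enum J) = i.
  move=> iJ; have [j0 _] : exists j0 : J, true.
    by case: (enum J) iJ => // j0 _ _; exists j0.
  by exists (nth j0 (enum J) i); [rewrite (nth_map j0)|rewrite index_uniq ?enum_uniq].
exists [seq orbit_part (D j) | j <- enum J]; split.
- by move=> B /mapP[j _ ->]; exact: orbit_part_lc.
- move=> i i'; rewrite size_map => /nE[j -> ij] /nE[j' -> ij'] ii'.
  apply: orbit_part_disjoint; apply: disD.
  by apply: contraNneq ii' => jj'; rewrite -ij -ij' jj'.
- move=> psi; split=> [[B /mapP[j _ ->] [h hD]]|[h hr]].
    split=> //; apply/(orbit_arcs h); rewrite DE; by exists j.
  move/(orbit_arcs h): hr; rewrite DE => -[j hD].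
  exists (orbit_part (D j)); last by exists h.
  by apply/mapP; exists j; rewrite ?mem_enum.
- rewrite (@constructible_class_fam k _ _ _ qX' J (enum J) D); last first.
  + rewrite DE; apply/seteqP; split=> p [j]; first by exists j; rewrite ?mem_enum.
    by move=> _ hD; exists j.
  + by move=> i j _ _; exact: disD.
  + by move=> j _; exact: lcD.
  + exact: enum_uniq.
  rewrite big_map mulr_sumr; apply: eq_bigr => j _.
  have iso := orbit_part_iso (Dorg j).
  apply: (etrans (K0_class_iso iso)).
  have qD := quasi_affine_sub qX' (lcD j).
  have sE : @subspace k X' (D j) = zariski (fun ai (p : {p | D j p}) => @jet_gen k Lam m ai (sval p)).
    exact: subspace_zariski.
  rewrite sE in qD; rewrite /subset_class.
  apply: (etrans (torus_prod_class c qD)); congr (_ * _).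
  by congr K0_class; exact: esym sE.
Qed.
End Contribution.

End OrbitJets.

End Correspondence.

(** * The decomposition along torus orbits *)

Section Decomposition.
Variables (R : realType) (d : nat).
Local Notation M := 'rV[int]_d.
Local Notation k := (R[i] : closedFieldType).
Variables (L : addrClosed M) (s : seq M).
Hypothesis s_gen : forall u, u \in L <->
    exists c : 'I_(size s) -> nat, u = \sum_(i < size s) s`_i *+ c i.
Hypothesis L_sat : forall (u : M) N, (0 < N)%N -> u *+ N \in L -> u \in L.
Local Notation sigma := (dual_cone (cone_of R L)).
Local Notation O theta := (@orthogonal_lattice R d theta).
Local Notation Ls := (submonoid L).
Local Notation A := (monoid_algebra k Ls).
Variable m : nat.
Local Notation X := (jet_space A m).
Local Notation jev := (@jet_ev k m).

Definition face_jets (theta : set 'cV[R]_d) : set (jet A m) :=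
  [set psi | forall l : Ls, (jev (psi (monomial k l)) != 0) = (val l \in O theta)].

Lemma pi_eq0 theta u : ((\pi_(quotient_lattice theta) u)%qT == 0) = (u \in O theta).
Proof.
rewrite -[u in RHS]subr0 Quotient.idealrBE; congr (_ == _).
exact: (esym (raddf0 (\pi_(quotient_lattice theta))%qT)).
Qed.

(** The section [sec] of the lattice projection is read off on representatives of
    the classes, the projection of [face_splitting] being trivial on the
    orthogonal lattice. *)
Lemma face_contribution theta : faces sigma theta -> exists sq : seq (set (jet A m)),
  [/\ forall B, B \in sq -> @locally_closed k X B,
      forall i j, (i < size sq)%N -> (j < size sq)%N -> i != j ->
        nth set0 sq i `&` nth set0 sq j = set0,
      forall psi, (exists2 B, B \in sq & B psi) <->
        face_jets theta psi /\ range (@jet_of_arc k A m) psi &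
      \sum_(B <- sq) subset_class (@jet_gen k Ls m) B =
        (Lefschetz - 1) ^+ codim theta * constructible_class
          [set jet_of_arc m phi | phi in arcs_at (toric_origin R (Lambda L theta))]].
Proof.
move=> ft.
pose pi : {additive M -> quotient_lattice theta} := \pi_(quotient_lattice theta)%qT.
have piP u : (pi u == 0) = (u \in O theta) := pi_eq0 theta u.
have [e [z [sec' [[eO z_e zD z_sec'] [sec'D sec'O uE']]]]] := face_splitting s_gen L_sat ft.
have sec'_pi u v : pi u = pi v -> sec' u = sec' v.
  move=> uv; have uvO : u - v \in O theta by rewrite -piP raddfB uv subrr.
  by rewrite -[u](subrK v) sec'D (sec'O _ uvO) add0r.
pose sec (q : quotient_lattice theta) := sec' (repr q).
have piK q : pi (repr q) = q by exact: reprK.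
have sec_pi u : sec (pi u) = sec' u by apply: sec'_pi; rewrite piK.
have pi_e i : pi (e i) = 0 by apply/eqP; rewrite piP.
have pi_sec q : pi (sec q) = q.
  have := congr1 pi (uE' (repr q)).
  rewrite piK raddfD raddf_sum big1 ?addr0 => [|i _]; first by move=> {2}->.
  by rewrite raddfMz pi_e mul0rz.
have secD p q : sec (p + q) = sec p + sec q.
  by rewrite /sec -sec'D; apply: sec'_pi; rewrite raddfD !piK.
have uE u : u = sec (pi u) + \sum_i e i *~ z u i by rewrite sec_pi -uE'.
have pi_x0 : pi (face_point s theta) = 0.
  by apply/eqP; rewrite piP; exact: face_point_orth.
have GP u := quotient_coneP s_gen L_sat u ft.
have sL (i : 'I_(size s)) : s`_i \in L by apply: (gen_in s_gen); exact: mem_nth.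
have [sq [sq1 sq2 sq3 sq4]] := @orbit_contribution k M (quotient_lattice theta) pi L
  (@quotient_cone R d L theta) (codim theta) e z sec (face_point s theta)
  (face_point_in s_gen theta) pi_x0 GP pi_e z_e zD (fun q i => z_sec' _ i) pi_sec secD uE
  m (@Num.Theory.pchar_num _) d id (fun _ _ => erefl) (@inj_id _) (size s) (fun i => s`_i) sL
  (fun u uL => (s_gen u).1 uL).
exists sq; split=> // psi; rewrite sq3.
have -> : face_jets theta psi <-> @orbit_jets k M _ pi L m psi; last by [].
by split=> h l; have := h l; rewrite piP.
Qed.

(** A product of truncated series is a unit exactly when its factors are, so
    that the elements with unit value form a face of the monoid [L]. *)
Lemma jet_face psi : exists2 theta, faces sigma theta & face_jets theta psi.
Proof.
pose chi (l : Ls) := psi (monomial k l).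
have [chi0 chiD] : monhom chi by exact: lrmorphism_monhom.
pose f (u : M) := exists h : u \in L, jev (chi (Submonoid h)) != 0.
have fE (l : Ls) : f (val l) <-> jev (chi l) != 0.
  split=> [[h]|nz].
    by rewrite (_ : Submonoid h = l) //; exact: val_inj.
  by exists (valP l); rewrite (_ : Submonoid _ = l) //; exact: val_inj.
have f0 : f 0.
  by rewrite -(val_submonoid0 L); apply/fE; rewrite chi0 rmorph1 oner_eq0.
have fD u v : u \in L -> v \in L -> f (u + v) <-> f u /\ f v.
  move=> uL vL; have := fE (Submonoid uL + Submonoid vL).
  have := fE (Submonoid uL); have := fE (Submonoid vL).
  rewrite chiD rmorphM mulf_eq0 negb_or val_submonoidD !SubK => -> -> ->.
  exact: (iff_sym (rwP andP)).
have [theta ft fO] := monoid_face R s_gen f0 fD.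
exists theta => // l; apply/idP/idP.
  by move=> nz; apply/(fO _ (valP l))/fE.
by move=> lO; apply/fE/(fO _ (valP l)).
Qed.

Lemma face_jets_inj theta theta' psi : faces sigma theta -> faces sigma theta' ->
  face_jets theta psi -> face_jets theta' psi -> theta = theta'.
Proof.
move=> ft ft' h h'; apply: (face_ext s_gen ft ft') => u uL.
by rewrite -(h (Submonoid uL)) -(h' (Submonoid uL)).
Qed.

(** The strata of the various faces are collected in one family indexed by pairs
    of a face and a position in its list of strata. *)
Lemma arcs_decomposition :
  constructible_class (range (@jet_of_arc k A m)) =
  \sum_(theta <- fset_set (faces sigma)) (Lefschetz - 1) ^+ codim theta *
     constructible_class (X := jet_space (toric_ring R (Lambda L theta)) m)
          [set jet_of_arc m phi | phi in arcs_at (toric_origin R (Lambda L theta))].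
Proof.
pose q theta := if pselect (faces sigma theta) is left h
  then sval (cid (face_contribution h)) else [::].
have qE theta (h : faces sigma theta) :
    q theta = sval (cid (face_contribution h)).
  by rewrite /q; case: pselect => // h'; rewrite (Prop_irrelevance h' h).
have q_lc theta B : faces sigma theta -> B \in q theta -> @locally_closed k X B.
  by move=> h; rewrite (qE _ h); case: (svalP (cid (face_contribution h))) => + _ _ _; apply.
have q_disj theta i j : faces sigma theta -> (i < size (q theta))%N -> (j < size (q theta))%N ->
    i != j -> nth set0 (q theta) i `&` nth set0 (q theta) j = set0.
  by move=> h; rewrite (qE _ h); case: (svalP (cid (face_contribution h))) => _ + _ _; apply.
have q_cover theta psi : faces sigma theta -> (exists2 B, B \in q theta & B psi) <->
    face_jets theta psi /\ range (@jet_of_arc k A m) psi.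
  by move=> h; rewrite (qE _ h); case: (svalP (cid (face_contribution h))).
have q_sum theta : faces sigma theta -> \sum_(B <- q theta) subset_class (@jet_gen k Ls m) B =
    (Lefschetz - 1) ^+ codim theta * constructible_class
      [set jet_of_arc m phi | phi in arcs_at (toric_origin R (Lambda L theta))].
  by move=> h; rewrite (qE _ h); case: (svalP (cid (face_contribution h))).
have fin := faces_finite R s_gen.
have inF theta : (theta \in fset_set (faces sigma)) = (theta \in faces sigma).
  by rewrite in_fset_set.
pose r := [seq (theta, j) | theta <- fset_set (faces sigma), j <- iota 0 (size (q theta))].
have rP theta j : (theta, j) \in r <-> faces sigma theta /\ (j < size (q theta))%N.
  split=> [/allpairsPdep[theta' [j' [+ + [-> ->]]]]|[ft jt]].
    by rewrite inF in_setE mem_iota.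
  by apply/allpairsPdep; exists theta, j; rewrite inF in_setE mem_iota.
have qX : quasi_affine X.
  have gens (u : Ls) : exists c : 'I_(size s) -> nat,
      u = \sum_(i < size s) Submonoid (gen_in s_gen (mem_nth 0 (ltn_ord i))) *+ c i.
    have [c uc] := (s_gen (val u)).1 (valP u); exists c.
    apply: val_inj; rewrite val_submonoid_sum uc; apply: eq_bigr => i _.
    by rewrite val_submonoidMn.
  exact: (@jet_space_quasi_affine k _ _ _ gens m).
have q_nth theta j psi : faces sigma theta -> (j < size (q theta))%N ->
    nth set0 (q theta) j psi -> face_jets theta psi /\ range (@jet_of_arc k A m) psi.
  move=> ft jt h; apply/(q_cover _ _ ft); exists (nth set0 (q theta) j) => //.
  by apply: mem_nth.
rewrite (@constructible_class_fam k _ _ _ qX _ r (fun tj => nth set0 (q tj.1) tj.2)).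
- rewrite big_allpairs_dep [LHS]big_seq [RHS]big_seq; apply: eq_bigr => theta.
  rewrite inF in_setE => ft; rewrite -(q_sum _ ft) [RHS](big_nth set0) /index_iota subn0.
  by [].
- apply: allpairs_uniq_dep.
  + exact: fset_uniq.
  + by move=> theta _; exact: iota_uniq.
  + by move=> [? ?] [? ?] _ _ /= [-> ->].
- move=> [theta j] /rP[ft jt]; apply: (q_lc theta) => //.
  by apply: mem_nth.
- move=> [theta j] [theta' j'] /rP[ft jt] /rP[ft' jt'] ne.
  have [E|nE] := eqVneq theta theta'.
    move: jt' ne; rewrite -E => jt' ne; apply: q_disj => //.
    by apply: contraNneq ne => /= ->.
  apply/seteqP; split=> // psi [/= h h']; case/eqP: nE.
  have [o _] := q_nth _ _ _ ft jt h.
  have [o' _] := q_nth _ _ _ ft' jt' h'.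
  exact: (face_jets_inj ft ft' o o').
- apply/seteqP; split=> psi.
    move=> hr; have [theta ft h] := jet_face psi.
    have [B Bq Bpsi] := (q_cover theta psi ft).2 (conj h hr).
    exists (theta, index B (q theta)); first by apply/rP; rewrite index_mem.
    by rewrite /= nth_index.
  move=> [[theta j] /rP[ft jt] h].
  exact: (q_nth _ _ _ ft jt h).2.
Qed.
End Decomposition.

Theorem corollary4p11 (R : realType) (d : nat) (L : addrClosed 'rV[int]_d)
  (L_fg : finitely_generated L)
  (L_gen : generates_lattice L)
  (L_convex : strictly_convex (cone_of R L))
  (L_dim : span_dim (cone_of R L) = d)
  (L_normal : normal_domain (toric_ring R (submonoid L))) :
  Pgeom (toric_ring R (submonoid L)) =
  \sum_(theta \in faces (dual_cone (cone_of R L)))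
    (Lefschetz - 1) ^+ codim theta *: Pgeom_at (toric_origin R (Lambda L theta)).
Proof.
have [s s_gen] := L_fg.
have L_sat := normal_saturated L_gen L_normal.
rewrite fsbig_finite; last exact: (faces_finite R s_gen).
apply: seriesP => m.
apply: (etrans (arcs_decomposition R s_gen L_sat m)).
rewrite (big_morph (fun x : series _ => coefs x m) (op1 := +%R) (id1 := 0)).
- by apply: eq_bigr => theta _.
- by [].
- by [].
Qed.
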